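(* Let $q>3$ be a power of an odd prime $p$, $K$ an algebraic closure of $\mathbb{F}_q$, and $\lambda\in K\setminus\{1,-1\}$. Let $\mathcal X$ be a nonsingular model of the (irreducible) plane curve with affine equation $$(X+Y)^{q+1}-2((XY)^{q}+XY)-\lambda(X-Y)^{q+1}=0,$$ with function field $K(x,y)$. Let $H$ be the group of automorphisms of $K(x,y)$ generated by $(x,y)\mapsto(x+\alpha,y+\alpha)$ ($\alpha\in\mathbb{F}_q$), $(x,y)\mapsto(\mu x,\mu y)$ ($\mu\in\mathbb{F}_q^*$) and $(x,y)\mapsto(x^{-1},y^{-1})$, and let $\Phi:(x,y)\mapsto(y,x)$. Then $\mathrm{Aut}(\mathcal X)=H\times\langle\Phi\rangle$. In particular, $\mathrm{Aut}(\mathcal X)\cong\mathrm{PGL}(2,q)\times C_2$, of order $2(q^3-q)$.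
   Context: $\mathrm{Aut}(\mathcal X)$ is the group of automorphisms of the function field $K(x,y)$ fixing $K$ elementwise; the listed maps are automorphisms of this field, $H\cong\mathrm{PGL}(2,q)$ and $\Phi$ centralizes $H$. *)

(* Defs.v *)
From HB Require Import structures.
From mathcomp Require Import all_boot all_order all_algebra all_fingroup all_solvable all_field.
Set Implicit Arguments.
Unset Strict Implicit.
Unset Printing Implicit Defensive.
Import GRing.Theory.
Local Open Scope ring_scope.

Definition isKAut (K L : fieldType) (iota : {rmorphism K -> L}) (s : L -> L) : Prop :=
  [/\ (forall a b, s (a + b) = s a + s b),
      (forall a b, s (a * b) = s a * s b),
      s 1 = 1,
      bijective s &
      (forall c : K, s (iota c) = iota c)].

Definition generated_by (K L : fieldType) (iota : {rmorphism K -> L}) (x y : L) : Prop :=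
  forall S : L -> Prop,
    (forall c : K, S (iota c)) -> S x -> S y ->
    (forall a b, S a -> S b -> S (a + b)) ->
    (forall a, S a -> S (- a)) ->
    (forall a b, S a -> S b -> S (a * b)) ->
    (forall a, S a -> S (a^-1)) ->
    forall z, S z.

Definition transcendental_over (K L : fieldType) (iota : {rmorphism K -> L}) (x : L) : Prop :=
  forall P : {poly K}, P != 0 -> (map_poly iota P).[x] != 0.

(* The three kinds of generators of H (F_q = {a in K | a^q = a}). *)
Definition H_generator (K L : fieldType) (iota : {rmorphism K -> L}) (q : nat) (x y : L)
  (s : L -> L) : Prop :=
  [\/ (exists alpha : K, alpha ^+ q = alpha /\ s x = x + iota alpha /\ s y = y + iota alpha),
      (exists mu : K, [/\ mu ^+ q = mu, mu != 0, s x = iota mu * x & s y = iota mu * y]) |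
      (s x = x^-1 /\ s y = y^-1)].

(* H = group generated by the generator automorphisms (finite, so closure under
   composition and identity suffices; the generating set is closed under inverses). *)
Inductive inH (K L : fieldType) (iota : {rmorphism K -> L}) (q : nat) (x y : L) : (L -> L) -> Prop :=
  | inH_id : inH iota q x y id
  | inH_gen : forall s, isKAut iota s -> H_generator iota q x y s -> inH iota q x y s
  | inH_comp : forall s t, inH iota q x y s -> inH iota q x y t -> inH iota q x y (s \o t).

Definition PGL2 (F : finFieldType) := ('GL_2[F] / 'Z('GL_2[F]))%g.

(* Main.v *)
(** Dividing the equation by 1 - lambda gives F = 0 with
      F = n (x - y)^(q+1) - m (x^q - y) (y^q - x),   m + n = 1,
    a form which is visibly invariant under PGL(2,q).  The line x = a meets the
    curve in q+1 distinct smooth points unless a lies in P^1(F_q), where it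
    only meets the node (a, a), whose two branches are y = O(x^q) and x = O(y^q).
      Let t be an automorphism with inverse s.  For generic c the function
    1 / (s x - c) has q+1 simple poles P_i.  If f is a product of at most q-2
    lines x = const and at most q-2 lines y = const which passes through all
    the P_i but one, then f (x - y) / (s x - c) belongs to the adjoint system of
    bidegree (q-1, q-1), apart from a single simple pole, and this is impossible.
    A counting argument then puts all the P_i on one line x = const or y = const,
    so that t x or t y is in K(x).  Up to the swap, t x = M x and t y = N y with
    Moebius maps M and N over K, and since t permutes the places above the
    nodes, M and N agree on P^1(F_q) and preserve it: M = N is in PGL(2,q). *)
Require Import Defs.
From HB Require Import structures.
From mathcomp Require Import all_boot all_order all_algebra all_fingroup all_solvable all_field.
From mathcomp Require Import ring zify.
From Stdlib Require Import ClassicalEpsilon FunctionalExtensionality.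
Set Implicit Arguments.
Unset Strict Implicit.
Unset Printing Implicit Defensive.
Import GRing.Theory.
Local Open Scope ring_scope.

(** * Bivariate polynomials *)

(** No divisors, differentials or Riemann-Roch enter. A place is a valuation ring of [L] over [K],
    given as a predicate, and orders of vanishing are expressed by explicit factorizations inside
    it. On P^1 x P^1 the curve has bidegree (q+1, q+1) and its q+1 nodes lie on the diagonal, so its
    canonical system is cut out by the forms of bidegree (q-1, q-1) through the nodes. The factor
    [x - y], of bidegree (1, 1), already vanishes at all nodes; what is left for products of lines
    is (q-2, q-2), the origin of the bound q-2. That no canonical section has one simple pole is the
    residue theorem. Here it becomes a count of roots: on the fibre of x through the supposed pole,
    a polynomial of degree below q in y vanishes at the q other points. The fibre of [s x] over a
    generic c is reached through the values of [t x] and [t y] at the points with x = c. If one of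
    these functions is constant on the fibre of x for generic c, then it does not involve y at
    all. *)

Section Specialization.
Variable K : closedFieldType.

Definition spec (a : K) (P : {poly {poly K}}) : {poly K} :=
  map_poly (horner_eval a) P.

HB.instance Definition _ a :=
  GRing.RMorphism.copy (spec a) (map_poly (horner_eval a)).

Lemma specC a p : spec a p%:P = (p.[a])%:P.
Proof. exact: map_polyC. Qed.

Lemma specX a : spec a 'X = 'X.
Proof. exact: map_polyX. Qed.

Lemma specD a p r : spec a (p + r) = spec a p + spec a r. Proof. exact: rmorphD. Qed.
Lemma specB a p r : spec a (p - r) = spec a p - spec a r. Proof. exact: rmorphB. Qed.
Lemma specM a p r : spec a (p * r) = spec a p * spec a r. Proof. exact: rmorphM. Qed.
Lemma specN a p : spec a (- p) = - spec a p. Proof. exact: rmorphN. Qed.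
Lemma specXn a p k : spec a (p ^+ k) = spec a p ^+ k. Proof. exact: rmorphXn. Qed.
Lemma spec0 a : spec a 0 = 0. Proof. exact: rmorph0. Qed.
Lemma spec1 a : spec a 1 = 1. Proof. exact: rmorph1. Qed.

Lemma coef_spec a P i : (spec a P)`_i = (P`_i).[a].
Proof. exact: (coef_map (horner_eval a)). Qed.

Lemma size_spec a P : (size (spec a P) <= size P)%N.
Proof. exact: size_poly. Qed.

Lemma spec_dvd a Q : spec a Q = 0 -> exists Q1, Q = ('X - a%:P)%:P * Q1.
Proof.
move=> Q0; exists (map_poly (fun p : {poly K} => p %/ ('X - a%:P)) Q).
apply/polyP=> i; rewrite coefCM coef_map_id0 ?div0p // mulrC divpK //.
by rewrite dvdp_XsubCl /root -coef_spec Q0 coef0.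
Qed.

Lemma polyXsubCC_neq0 a : ('X - a%:P)%:P != 0 :> {poly {poly K}}.
Proof. by rewrite polyC_eq0 polyXsubC_eq0. Qed.

(** Gauss's lemma. Over an algebraically closed field [R] is primitive as soon as no specialization
    of it vanishes; a linear factor of [D] then has to divide [Q] and can be cancelled. *)
Lemma gauss_div (D : {poly K}) (F Q R : {poly {poly K}}) :
  D != 0 -> D%:P * F = Q * R -> (forall a, spec a R != 0) ->
  exists Q', F = Q' * R.
Proof.
move=> D0 E Rp; move: {2}(size D) (leqnn (size D)) => s.
elim: s D Q D0 E => [|s IH] D Q D0 E sD.
  by move: D0; rewrite -size_poly_eq0; case: (size D) sD.
have [/size_poly1P[c c0 Dc]|/closed_rootP[a]] := boolP (size D == 1%N).
  exists ((c^-1)%:P%:P * Q); rewrite -mulrA -E Dc mulrA -!polyCM mulVf //.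
  by rewrite polyC1 mul1r.
case/factor_theorem=> D1 DE.
have : spec a Q * spec a R = 0.
  by rewrite -specM -E specM specC DE hornerM hornerXsubC subrr mulr0 polyC0 mul0r.
move/eqP; rewrite mulf_eq0 (negPf (Rp a)) orbF => /eqP /spec_dvd[Q1 QE].
have D10 : D1 != 0 by apply: contraNneq D0; rewrite DE => ->; rewrite mul0r.
apply: (IH D1 Q1 D10).
  apply: (mulfI (polyXsubCC_neq0 a)).
  by rewrite mulrA -polyCM mulrC [_ * D1]mulrC -DE mulrC E QE mulrA.
by move: sD; rewrite DE size_Mmonic ?monicXsubC // size_XsubC addn2.
Qed.

(** Each vanishing specialization splits off a linear factor, which lowers the degree of the leading
    coefficient. *)
Lemma primitive_part (R : {poly {poly K}}) : R != 0 ->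
  exists c R1, [/\ c != 0, R = c%:P * R1 & forall a, spec a R1 != 0].
Proof.
move: {2}(size (lead_coef R)) (leqnn (size (lead_coef R))) => s.
elim: s R => [|s IH] R sR R0.
  move: R0; rewrite -lead_coef_eq0 -size_poly_eq0.
  by case: (size (lead_coef R)) sR.
have [[a Ra]|nR] := excluded_middle_informative (exists a, spec a R = 0); last first.
  exists 1, R; split; rewrite ?oner_eq0 ?polyC1 ?mul1r // => a.
  by apply/eqP => Ra; apply: nR; exists a.
have [R1 RE] := spec_dvd Ra.
have R10 : R1 != 0 by apply: contraNneq R0; rewrite RE => ->; rewrite mulr0.
have [|c [R2 [c0 E2 H2]]] := IH R1 _ R10.
  move: sR; rewrite RE lead_coefM lead_coefC size_monicM ?monicXsubC ?lead_coef_eq0 //.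
  by rewrite size_XsubC.
exists (('X - a%:P) * c), R2; split=> //.
  by rewrite mulf_neq0 ?polyXsubC_eq0.
by rewrite RE E2 polyCM mulrA.
Qed.

Lemma pseudo_div (P G : {poly {poly K}}) : G != 0 ->
  exists D Q S, [/\ D != 0, D%:P * P = Q * G + S & (size S < size G)%N].
Proof.
move=> G0; exists (lead_coef G ^+ scalp P G), (P %/ G), (P %% G); split.
- by rewrite expf_neq0 ?lead_coef_eq0.
- by rewrite mul_polyC Pdiv.Idomain.divp_eq.
- by rewrite Pdiv.Idomain.ltn_modp.
Qed.

(** A nonconstant polynomial over an algebraically closed field takes the value 1. *)
Lemma poly_nonroot (P : {poly K}) : P != 0 -> exists c, P.[c] != 0.
Proof.
move=> P0; have [/size_poly1P[c c0 ->]|s1] := boolP (size P == 1%N).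
  by exists 0; rewrite hornerC.
have : size (P - 1) != 1%N.
  rewrite size_polyDl ?s1 // size_polyN size_poly1 ltn_neqAle eq_sym s1.
  by rewrite lt0n size_poly_eq0.
case/closed_rootP=> c /rootP; rewrite hornerD hornerN hornerC => /eqP.
by rewrite subr_eq0 => /eqP Pc; exists c; rewrite Pc oner_eq0.
Qed.

End Specialization.

Section Evaluation.
Variables (K : closedFieldType) (L : fieldType) (iota : {rmorphism K -> L}).

(* A bivariate polynomial P : {poly {poly K}} has outer variable y and
   coefficients in K[x]; ex x p is p(x), ev x y P is P(x, y), and spec a P above
   is P(a, Y). *)
Definition ex (x : L) (p : {poly K}) : L := (map_poly iota p).[x].

HB.instance Definition _ x :=
  GRing.RMorphism.copy (ex x) (horner_eval x \o map_poly iota).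

Definition ev (x y : L) (P : {poly {poly K}}) : L := (map_poly (ex x) P).[y].

HB.instance Definition _ x y :=
  GRing.RMorphism.copy (ev x y) (horner_eval y \o map_poly (ex x)).

Lemma exC x c : ex x c%:P = iota c.
Proof. by rewrite /ex map_polyC hornerC. Qed.

Lemma exX x : ex x 'X = x.
Proof. by rewrite /ex map_polyX hornerX. Qed.

Lemma evC x y p : ev x y p%:P = ex x p.
Proof. by rewrite /ev map_polyC hornerC. Qed.

Lemma evX x y : ev x y 'X = y.
Proof. by rewrite /ev map_polyX hornerX. Qed.

Lemma evCX x y : ev x y 'X%:P = x.
Proof. by rewrite evC exX. Qed.

Lemma evCC x y c : ev x y c%:P%:P = iota c.
Proof. by rewrite evC exC. Qed.

Lemma exD x p r : ex x (p + r) = ex x p + ex x r. Proof. exact: rmorphD. Qed.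
Lemma exB x p r : ex x (p - r) = ex x p - ex x r. Proof. exact: rmorphB. Qed.
Lemma exM x p r : ex x (p * r) = ex x p * ex x r. Proof. exact: rmorphM. Qed.
Lemma exN x p : ex x (- p) = - ex x p. Proof. exact: rmorphN. Qed.
Lemma exXn x p k : ex x (p ^+ k) = ex x p ^+ k. Proof. exact: rmorphXn. Qed.
Lemma ex0 x : ex x 0 = 0. Proof. exact: rmorph0. Qed.
Lemma ex1 x : ex x 1 = 1. Proof. exact: rmorph1. Qed.
Lemma evD x y p r : ev x y (p + r) = ev x y p + ev x y r. Proof. exact: rmorphD. Qed.
Lemma evB x y p r : ev x y (p - r) = ev x y p - ev x y r. Proof. exact: rmorphB. Qed.
Lemma evM x y p r : ev x y (p * r) = ev x y p * ev x y r. Proof. exact: rmorphM. Qed.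
Lemma evN x y p : ev x y (- p) = - ev x y p. Proof. exact: rmorphN. Qed.
Lemma evXn x y p k : ev x y (p ^+ k) = ev x y p ^+ k. Proof. exact: rmorphXn. Qed.
Lemma ev0 x y : ev x y 0 = 0. Proof. exact: rmorph0. Qed.
Lemma ev1 x y : ev x y 1 = 1. Proof. exact: rmorph1. Qed.

Lemma ev_sum x y (P : {poly {poly K}}) n : (size P <= n)%N ->
  ev x y P = \sum_(i < n) ex x P`_i * y ^+ i.
Proof.
move=> sP; rewrite /ev (@horner_coef_wide _ n); last first.
  exact: leq_trans (size_poly _ _) sP.
by apply: eq_bigr => i _; rewrite coef_map.
Qed.

End Evaluation.

Definition rmD := (@specD, @exD, @evD).
Definition rmB := (@specB, @exB, @evB).
Definition rmM := (@specM, @exM, @evM).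
Definition rmN := (@specN, @exN, @evN).
Definition rmXn := (@specXn, @exXn, @evXn).
Definition rm0 := (@spec0, @ex0, @ev0).
Definition rm1 := (@spec1, @ex1, @ev1).

(** * Function fields presented by one primitive equation *)

Section Model.
Variables (K : closedFieldType) (L : fieldType) (iota : {rmorphism K -> L}).
Local Notation ex := (ex iota).
Local Notation ev := (ev iota).
Variables (x w : L) (r : nat) (G : {poly {poly K}}).
Hypothesis Htr : transcendental_over iota x.
(** The powers of [w] below [r] are independent over K(x). These hypotheses are met twice: by
    [w = y] with the curve itself, and by [w = y / x] with its blow-up at the origin. *)
Hypothesis Hind : forall S : {poly {poly K}}, (size S <= r)%N -> ev x w S = 0 -> S = 0.
Hypothesis HG0 : ev x w G = 0.
Hypothesis sG : size G = r.+1.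
Hypothesis Gprim : forall a, spec a G != 0.

Let G_neq0 : G != 0.
Proof. by rewrite -size_poly_eq0 sG. Qed.

Lemma ex_neq0 D : D != 0 -> ex x D != 0.
Proof. exact: Htr. Qed.

Lemma model_reduce (P : {poly {poly K}}) :
  exists (D : {poly K}) (Q S : {poly {poly K}}),
    [/\ D != 0, (size S <= r)%N & D%:P * P = Q * G + S].
Proof.
have [D [Q [S [D0 E sS]]]] := pseudo_div P G_neq0.
by exists D, Q, S; split=> //; rewrite -ltnS -sG.
Qed.

Lemma model_ker P : ev x w P = 0 -> exists Q, P = Q * G.
Proof.
move=> P0; have [D [Q [S [D0 sS E]]]] := model_reduce P.
have S0 : S = 0.
  apply: Hind => //; move/(congr1 (ev x w)): E.
  by rewrite rmD !rmM HG0 P0 !mulr0 add0r.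
by apply: (gauss_div D0 _ Gprim); rewrite E S0 addr0.
Qed.

(** Euclid's algorithm on [G] and [P]. A zero remainder before degree 0 would split a multiple of
    [G] into two polynomials of smaller degree, one of which vanishes at [(x, w)] against [Hind]. *)
Lemma model_bezout (P : {poly {poly K}}) : P != 0 -> (size P <= r)%N ->
  exists U V N, N != 0 /\ U * P + V * G = N%:P.
Proof.
move: {2}(size P) (leqnn (size P)) => s.
elim: s P => [|s IH] P sP P0 sPr.
  by move: P0; rewrite -size_poly_eq0; case: (size P) sP.
have [s1|s1] := leqP (size P) 1%N.
  have [c Pc] : exists c, P = c%:P by exists P`_0; apply: size1_polyC.
  exists 1, 0, c; split; last by rewrite mul1r mul0r addr0.
  by apply: contraNneq P0 => c0; rewrite Pc c0 polyC0.
have [D [Q [S [D0 E sS]]]] := pseudo_div G P0.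
have S0 : S != 0.
  apply/negP=> /eqP S0; move: E; rewrite S0 addr0 => E.
  have /eqP : ev x w Q * ev x w P = 0 by rewrite -rmM -E rmM HG0 mulr0.
  rewrite mulf_eq0 => /orP[]/eqP Z; last first.
    by move: P0; rewrite (Hind sPr Z) eqxx.
  have QP0 : Q * P != 0.
    by rewrite -E mulf_neq0 // polyC_eq0.
  have Q0 : Q != 0 by apply: contraNneq QP0 => ->; rewrite mul0r.
  have sQ : (size Q <= r)%N.
    have := congr1 (fun P : {poly {poly K}} => size P) E.
    rewrite size_Cmul // size_mul // sG => E1; rewrite -ltnS E1.
    by move: s1; case: (size P) => [|[|k]] // _; rewrite !addnS /= ltnS leq_addr.
  by move: Q0; rewrite (Hind sQ Z) eqxx.
have [||U [V [N [N0 EN]]]] := IH S _ S0 _.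
- by rewrite -ltnS; apply: leq_trans sS sP.
- exact: leq_trans (ltnW sS) sPr.
exists (- U * Q), (U * D%:P + V), N; split=> //.
by rewrite -EN -[S](addKr (Q * P)) -E; ring.
Qed.

(** Serves to move denominators into K[x]; the Bezout relation plays the role of the norm. *)
Lemma model_norm P : ev x w P != 0 ->
  exists Q N, N != 0 /\ ev x w P * ev x w Q = ex x N.
Proof.
move=> P0; have [D [Q [S [D0 sS E]]]] := model_reduce P.
have ES : ev x w S = ex x D * ev x w P.
  by move/(congr1 (ev x w)): E; rewrite rmD !rmM HG0 mulr0 add0r evC.
have S0 : S != 0.
  by apply: contraNneq (mulf_neq0 (ex_neq0 D0) P0) => S0; rewrite -ES S0 rm0.
have [U [V [N [N0 EN]]]] := model_bezout S0 sS.
exists (D%:P * U), N; split=> //.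
move/(congr1 (ev x w)): EN; rewrite rmD !rmM HG0 ES !evC mulr0 addr0 => <-.
by ring.
Qed.

Hypothesis Hgen : generated_by iota x w.

Lemma model_frac z : exists P Q, ev x w Q != 0 /\ z = ev x w P / ev x w Q.
Proof.
apply: (Hgen (S := fun z => exists P Q, ev x w Q != 0 /\ z = ev x w P / ev x w Q)).
- by move=> c; exists c%:P%:P, 1; rewrite rm1 oner_eq0 divr1 evCC.
- by exists 'X%:P, 1; rewrite rm1 oner_eq0 divr1 evCX.
- by exists 'X, 1; rewrite rm1 oner_eq0 divr1 evX.
- move=> a b [P [Q [Q0 ->]]] [P' [Q' [Q0' ->]]].
  exists (P * Q' + P' * Q), (Q * Q'); split; first by rewrite rmM mulf_neq0.
  by rewrite addf_div // rmD !rmM.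
- by move=> a [P [Q [Q0 ->]]]; exists (- P), Q; rewrite rmN mulNr.
- move=> a b [P [Q [Q0 ->]]] [P' [Q' [Q0' ->]]].
  exists (P * P'), (Q * Q'); split; first by rewrite rmM mulf_neq0.
  by rewrite mulf_div !rmM.
- move=> a [P [Q [Q0 ->]]].
  have [P0|P0] := eqVneq (ev x w P) 0.
    by exists 0, 1; rewrite rm1 oner_eq0 rm0 P0 !mul0r invr0.
  by exists Q, P; rewrite invf_div.
Qed.

Lemma model_repr z :
  exists (P : {poly {poly K}}) (D : {poly K}),
    [/\ D != 0, (size P <= r)%N & z = ev x w P / ex x D].
Proof.
have [P [Q [Q0 ->]]] := model_frac z.
have [R [N [N0 E]]] := model_norm Q0.
have [D [U [S [D0 sS ES]]]] := model_reduce (P * R).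
exists S, (N * D); split=> //; first by rewrite mulf_neq0.
have R0 : ev x w R != 0.
  by apply: contraNneq (ex_neq0 N0) => R0; rewrite -E R0 mulr0.
have -> : ev x w S = ex x D * (ev x w P * ev x w R).
  by move/(congr1 (ev x w)): ES; rewrite rmD !rmM HG0 mulr0 add0r evC.
have -> : ex x (N * D) = ev x w Q * ev x w R * ex x D by rewrite rmM E.
have D0' := ex_neq0 D0.
by field; rewrite R0 Q0 D0'.
Qed.

End Model.

(** Defined over any commutative ring, so that one expression covers the polynomial, its
    specializations and its value in [L]. *)
Definition curveF (R : comNzRingType) (q : nat) (m n x y : R) : R :=
  x ^+ q.+1 + y ^+ q.+1 - m * (x ^+ q * y ^+ q + x * y)
  - n * (x ^+ q * y + x * y ^+ q).

Lemma rmorph_curveF (R S : comNzRingType) (f : {rmorphism R -> S}) q m n x y :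
  f (curveF q m n x y) = curveF q (f m) (f n) (f x) (f y).
Proof. by rewrite /curveF !(rmorphB, rmorphD, rmorphM, rmorphXn). Qed.

Lemma spec_curveF (K : closedFieldType) (a : K) q m n x y :
  spec a (curveF q m n x y) = curveF q (spec a m) (spec a n) (spec a x) (spec a y).
Proof. by rewrite /curveF !specB !specD !specM !specD !specM !specXn. Qed.

Lemma ev_curveF (K : closedFieldType) (L : fieldType) (iota : {rmorphism K -> L}) u v
    q m n x y : ev iota u v (curveF q m n x y) =
  curveF q (ev iota u v m) (ev iota u v n) (ev iota u v x) (ev iota u v y).
Proof. by rewrite /curveF !evB !evD !evM !evD !evM !evXn. Qed.

Lemma horner_curveF (R : comNzRingType) (a : R) q m n x y :
  (curveF q m n x y).[a] = curveF q m.[a] n.[a] x.[a] y.[a].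
Proof. exact: (rmorph_curveF (horner_eval a)). Qed.

Lemma curveFC (R : comNzRingType) q (m n x y : R) :
  curveF q m n x y = curveF q m n y x.
Proof. rewrite /curveF; ring. Qed.

(** * The curve *)

Section FrobeniusPower.
Variables (K : fieldType) (q : nat).
Hypothesis Hq : [pchar K].-nat q.

Lemma frobD (R : comNzRingType) (f : {rmorphism K -> R}) (a b : R) :
  (a + b) ^+ q = a ^+ q + b ^+ q.
Proof.
apply: exprDn_pchar; apply: sub_in_pnat Hq => l _.
exact: rmorph_pchar.
Qed.

Lemma frobN (R : comNzRingType) (f : {rmorphism K -> R}) (a : R) :
  (- a) ^+ q = - a ^+ q.
Proof.
apply: exprNn_pchar; apply: sub_in_pnat Hq => l _.
exact: rmorph_pchar.
Qed.

Lemma frobB (R : comNzRingType) (f : {rmorphism K -> R}) (a b : R) :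
  (a - b) ^+ q = a ^+ q - b ^+ q.
Proof. by rewrite (frobD f) (frobN f). Qed.

End FrobeniusPower.

Record curve_params (K : closedFieldType) (q : nat) (m n : K) : Prop := CurveParams {
  cp_frob : [pchar K].-nat q;
  cp_q : (3 < q)%N;
  cp_sum : m + n = 1;
  cp_m : m != 0;
  cp_n : n != 0 }.

Section CurvePolynomial.
Variables (K : closedFieldType) (q : nat) (m n : K).
Hypothesis HP : curve_params q m n.

Let Hq : [pchar K].-nat q. Proof. by case: HP. Qed.
Let q_gt1 : (1 < q)%N. Proof. by case: HP => _ q3 _ _ _; apply: leq_trans q3. Qed.
Let mn1 : m + n = 1. Proof. by case: HP. Qed.
Let m0 : m != 0. Proof. by case: HP. Qed.
Let n0 : n != 0. Proof. by case: HP. Qed.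

(** For fixed a the y-derivative is just the factor [y^q - (m a + n a^q)], because q is 0 in [K].
    Where it vanishes, the remaining term keeps the equation nonzero unless a is in F_q. *)
Lemma curveF_factor (R : comNzRingType) (f : {rmorphism K -> R}) (a y : R) :
  curveF q (f m) (f n) a y =
  (y ^+ q - (f m * a + f n * a ^+ q)) * (y - (f m * a ^+ q + f n * a))
  - f m * f n * (a ^+ q - a) ^+ 2.
Proof.
have -> : f m = 1 - f n by rewrite -(rmorph1 f) -mn1 rmorphD addrK.
rewrite /curveF !exprSr; ring.
Qed.

Lemma curveF_frob (R : comNzRingType) (f : {rmorphism K -> R}) (a y : R) :
  a ^+ q = a -> curveF q (f m) (f n) a y = (y - a) ^+ q.+1.
Proof.
move=> aq; rewrite curveF_factor aq -mulrDl -rmorphD mn1 rmorph1 mul1r.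
by rewrite subrr expr0n mulr0 subr0 exprSr (frobB Hq f) aq.
Qed.

Lemma curveF_cross (R : comNzRingType) (f : {rmorphism K -> R}) (a y : R) :
  curveF q (f m) (f n) a y =
  f n * (a - y) ^+ q.+1 - f m * ((a ^+ q - y) * (y ^+ q - a)).
Proof.
have -> : f m = 1 - f n by rewrite -(rmorph1 f) -mn1 rmorphD addrK.
rewrite /curveF !exprSr (frobB Hq f); ring.
Qed.

Definition curve_poly : {poly {poly K}} :=
  curveF q m%:P%:P n%:P%:P 'X%:P 'X.

Lemma spec_curve_poly a :
  spec a curve_poly = curveF q m%:P n%:P a%:P 'X.
Proof.
by rewrite /curve_poly spec_curveF !specC specX !hornerC hornerX.
Qed.

Lemma horner_spec_curve a b : (spec a curve_poly).[b] = curveF q m n a b.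
Proof.
by rewrite spec_curve_poly horner_curveF !hornerC hornerX.
Qed.

Let cq : {poly K} := m%:P * 'X^q + n%:P * 'X.
Let c1 : {poly K} := m%:P * 'X + n%:P * 'X^q.

Lemma curve_polyE : curve_poly =
  'X^(q.+1) + ('X^(q.+1))%:P - cq%:P * 'X^q - c1%:P * 'X.
Proof. by rewrite /cq /c1; rewrite /curve_poly /curveF !polyCD !polyCM !polyC_exp; ring. Qed.

Lemma coef_curve_poly i : curve_poly`_i = (i == q.+1)%:R + 'X^(q.+1) *+ (i == 0)%N
  - cq * (i == q)%:R - c1 * (i == 1)%N%:R.
Proof.
by rewrite curve_polyE !coefB !coefD !coefCM coefXn coefC coefX coefXn; case: (i == 0)%N.
Qed.

Lemma size_curve_poly : size curve_poly = q.+2.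
Proof.
apply/anti_leq/andP; split.
  apply/leq_sizeP=> i qi; rewrite coef_curve_poly.
  rewrite (gtn_eqF qi) (gtn_eqF (ltnW qi)) (_ : (i == 0)%N = false); last by lia.
  by rewrite (_ : (i == 1)%N = false) ?mulr0 ?subr0 ?addr0 //; lia.
rewrite ltnNge; apply/negP=> /leq_sizeP/(_ q.+1 (leqnn _)).
rewrite coef_curve_poly eqxx (gtn_eqF (ltnSn q)) (_ : (q.+1 == 1)%N = false); last by lia.
rewrite !mulr0 !subr0 mulr0n addr0 => /eqP; apply/negP; exact: oner_neq0.
Qed.

Lemma lead_curve_poly : lead_coef curve_poly = 1.
Proof.
rewrite lead_coefE size_curve_poly /= coef_curve_poly eqxx (gtn_eqF (ltnSn q)).
rewrite (_ : (q.+1 == 1)%N = false); last by lia.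
by rewrite !mulr0 !subr0 mulr0n addr0.
Qed.

Lemma spec_curve_neq0 a : spec a curve_poly != 0.
Proof.
apply/eqP=> /(congr1 (fun P : {poly K} => P`_q.+1)); rewrite coef_spec.
have -> : curve_poly`_q.+1 = 1 by rewrite -lead_curve_poly lead_coefE size_curve_poly.
by rewrite hornerC coef0 => /eqP; apply/negP; exact: oner_neq0.
Qed.

(** Excludes a root Y = c X^d. One exponent always occurs alone: d+1 for d < q, q+1 for d > q, and
    2q for d = q. *)
Lemma curveF_monomial c d : c != 0 -> (0 < d)%N ->
  curveF q m%:P n%:P 'X (c%:P * 'X^d) != 0.
Proof.
move=> c0 d0; apply/eqP=> E.
have C k : c ^+ q.+1 * (k == d * q.+1)%N%:R + (k == q.+1)%:R
   - (m * c ^+ q) * (k == q + d * q)%N%:R - (m * c) * (k == d.+1)%:R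
   - (n * c) * (k == q + d)%N%:R - (n * c ^+ q) * (k == (d * q).+1)%:R = 0.
  have {1}-> : 0 = (curveF q m%:P n%:P 'X (c%:P * 'X^d))`_k by rewrite E coef0.
  have -> : curveF q m%:P n%:P 'X (c%:P * 'X^d) =
    (c ^+ q.+1)%:P * 'X^(d * q.+1) + 'X^(q.+1) - (m * c ^+ q)%:P * 'X^(q + d * q)
    - (m * c)%:P * 'X^(d.+1) - (n * c)%:P * 'X^(q + d)
    - (n * c ^+ q)%:P * 'X^((d * q).+1).
    rewrite /curveF !exprMn -!exprM !exprD !polyCM !polyC_exp ![_ ^+ _.+1]exprSr.
    ring.
  by rewrite !coefB coefD !coefCM !coefXn.
case: (ltngtP d q) => dq.
- have := C d.+1.
  rewrite (_ : (_ == d * q.+1)%N = false); last by nia.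
  rewrite (_ : (_ == q.+1)%N = false); last by lia.
  rewrite (_ : (_ == q + d * q)%N = false); last by nia.
  rewrite (_ : (_ == q + d)%N = false); last by lia.
  rewrite (_ : (_ == (d * q).+1)%N = false); last by nia.
  rewrite eqxx !mulr0 mulr1 !subr0 addr0 add0r => /eqP.
  by rewrite oppr_eq0 mulf_eq0 (negPf m0) (negPf c0).
- have := C q.+1.
  rewrite (_ : (_ == d * q.+1)%N = false); last by nia.
  rewrite (_ : (_ == d.+1)%N = false); last by lia.
  rewrite (_ : (_ == q + d * q)%N = false); last by nia.
  rewrite (_ : (_ == q + d)%N = false); last by lia.
  rewrite (_ : (_ == (d * q).+1)%N = false); last by nia.
  rewrite eqxx !mulr0 !subr0 add0r => /eqP.
  by apply/negP; exact: oner_neq0.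
- have := C (q + d)%N.
  rewrite (_ : (_ == d * q.+1)%N = false); last by nia.
  rewrite (_ : (_ == q.+1)%N = false); last by lia.
  rewrite (_ : (_ == q + d * q)%N = false); last by nia.
  rewrite (_ : (_ == d.+1)%N = false); last by lia.
  rewrite (_ : (_ == (d * q).+1)%N = false); last by nia.
  rewrite eqxx !mulr0 mulr1 !subr0 addr0 add0r => /eqP.
  by rewrite oppr_eq0 mulf_eq0 (negPf n0) (negPf c0).
Qed.

End CurvePolynomial.

(** * Irreducibility of the equation *)

Section Irreducibility.
Variables (K : closedFieldType) (q : nat) (m n : K).
Hypothesis HP : curve_params q m n.

Let Hq : [pchar K].-nat q. Proof. by case: HP. Qed.
Let q_gt1 : (1 < q)%N. Proof. by case: HP => _ q3 _ _ _; apply: leq_trans q3. Qed.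
Let mn1 : m + n = 1. Proof. by case: HP. Qed.
Let m0 : m != 0. Proof. by case: HP. Qed.
Let n0 : n != 0. Proof. by case: HP. Qed.

Let F := curve_poly q m n.

Lemma coef_mul1 (R : comNzRingType) (P Q : {poly R}) :
  (P * Q)`_1 = P`_0 * Q`_1 + P`_1 * Q`_0.
Proof. by rewrite coefM !big_ord_recl big_ord0 addr0. Qed.

Lemma lead_factor_const (G H : {poly {poly K}}) : F = G * H ->
  exists2 g : K, g != 0 & lead_coef G = g%:P.
Proof.
move=> E; have : lead_coef G * lead_coef H = 1.
  by rewrite -lead_coefM -E lead_curve_poly.
move=> E1.
have : size (lead_coef G) == 1%N.
  have : lead_coef G %| 1 by rewrite -E1 dvdp_mulIl.
  by rewrite dvdp1.
by case/size_poly1P=> g g0 ->; exists g.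
Qed.

(* On the line X = 0 the curve degenerates to Y^(q+1) = 0. *)
Lemma factor_at0 (G H : {poly {poly K}}) : F = G * H -> (1 < size G)%N ->
  spec 0 G = (lead_coef G).[0] *: 'X^((size G).-1).
Proof.
move=> E sG; have [g g0 lG] := lead_factor_const E.
have sE : (size G).-1.+1 = size G by rewrite prednK // (ltn_trans _ sG).
have sS : size (spec 0 G) = size G.
  apply/anti_leq; rewrite size_spec /= -{1}sE ltnNge; apply/negP.
  move/leq_sizeP/(_ _ (leqnn _)); rewrite coef_spec -lead_coefE lG hornerC => g00.
  by rewrite g00 eqxx in g0.
have : spec 0 G %| ('X - 0%:P) ^+ q.+1.
  have -> : ('X - 0%:P) ^+ q.+1 = spec 0 F.
    rewrite spec_curve_poly (curveF_frob HP (polyC : {rmorphism K -> _})) //.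
    by rewrite expr0n; case: q q_gt1.
  by rewrite E rmM dvdp_mulIl.
case/dvdp_exp_XsubCP=> k _; rewrite subr0.
case/eqpP=> [[a b] /=]; case/andP=> a0 b0 Eab.
have SE : spec 0 G = (a^-1 * b) *: 'X^k by rewrite -scalerA -Eab scalerA mulVf ?scale1r.
have ab0 : a^-1 * b != 0 by rewrite mulf_neq0 ?invr_eq0.
have kE : k = (size G).-1 by rewrite -sS SE size_scale // size_polyXn.
rewrite SE -kE; congr (_ *: _).
have := coef_spec 0 G k; rewrite SE coefZ coefXn eqxx mulr1 => ->.
by rewrite kE -lead_coefE.
Qed.

(** The constant coefficient in Y of a factor divides X^(q+1), so a linear factor has a monomial
    root. *)
Lemma no_linear_factor (G H : {poly {poly K}}) : F = G * H -> size G != 2%N.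
Proof.
move=> E; apply/negP=> /eqP sG.
have [g g0 lG] := lead_factor_const E.
have G1 : G`_1 = g%:P by rewrite -lG lead_coefE sG.
have G00 : (G`_0).[0] = 0.
  have := coef_spec 0 G 0; rewrite (factor_at0 E) ?sG // coefZ coefXn mulr0 => <- //.
have GE : G = (G`_0)%:P + g%:P%:P * 'X.
  apply/polyP=> i; rewrite coefD coefCM coefC coefX.
  case: i => [|[|i]]; rewrite ?mulr0 ?addr0 // ?mulr1 ?add0r //.
  by rewrite nth_default ?sG.
have G0X : G`_0 %| 'X^(q.+1).
  have <- : F`_0 = 'X^(q.+1).
    by rewrite coef_curve_poly /= (_ : (0 == q)%N = false) ?mulr0 ?subr0 ?add0r ?mulr1n //; lia.
  by rewrite E coefM big_ord_recl big_ord0 addr0 dvdp_mulIl.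
have [c [d [c0 d0 G0E]]] : exists c d, [/\ c != 0, (0 < d)%N & G`_0 = c *: 'X^d].
  have : G`_0 %| ('X - 0%:P) ^+ q.+1 by rewrite subr0.
  case/dvdp_exp_XsubCP=> d _; rewrite subr0.
  case/eqpP=> [[a b] /=]; case/andP=> a0 b0 Eab.
  have GE' : G`_0 = (a^-1 * b) *: 'X^d by rewrite -scalerA -Eab scalerA mulVf ?scale1r.
  exists (a^-1 * b), d; split=> //; first by rewrite mulf_neq0 ?invr_eq0.
  case: d {Eab} GE' => // GE'; move: G00; rewrite GE' hornerZ expr0 hornerC mulr1 => /eqP.
  by rewrite mulf_eq0 invr_eq0 (negPf a0) (negPf b0).
pose r := (- (g^-1 * c))%:P * 'X^d.
have : F.[r] = 0.
  rewrite E hornerM GE hornerD hornerC hornerM hornerX hornerC G0E /r.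
  by rewrite -mul_polyC mulrA -polyCM mulrN mulrA mulfV // mul1r polyCN mulNr addrN mul0r.
rewrite /F /curve_poly horner_curveF.
rewrite !hornerC hornerX => /eqP; apply/negP.
by apply: curveF_monomial; rewrite // oppr_eq0 mulf_neq0 ?invr_eq0.
Qed.

(** Two factors of degree at least 2 in Y both reduce at X = 0 to multiples of Y^2, so their product
    has no term XY. The node at the origin, however, contributes the term -m XY. *)
Lemma curve_poly_irreducible (G H : {poly {poly K}}) :
  F = G * H -> (1 < size G)%N -> (size H <= 1)%N.
Proof.
move=> E sG; rewrite leqNgt; apply/negP=> sH.
have E' : F = H * G by rewrite mulrC.
have nG := no_linear_factor E; have nH := no_linear_factor E'.
have cG i : (i < 2)%N -> (G`_i)`_0 = 0.
  move=> i2; rewrite -horner_coef0 -coef_spec (factor_at0 E sG) coefZ coefXn.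
  by rewrite (_ : (i == _) = false) ?mulr0 //; lia.
have cH i : (i < 2)%N -> (H`_i)`_0 = 0.
  move=> i2; rewrite -horner_coef0 -coef_spec (factor_at0 E' sH) coefZ coefXn.
  by rewrite (_ : (i == _) = false) ?mulr0 //; lia.
have : (F`_1)`_1 = - m.
  rewrite coef_curve_poly /= mulr0n addr0 (_ : (1 == q)%N = false); last by lia.
  rewrite (_ : (1 == q.+1)%N = false); last by lia.
  rewrite mulr0 subr0 mulr1 sub0r coefN coefD !coefCM coefX coefXn.
  by rewrite (_ : (1 == q)%N = false) ?mulr0 ?mulr1 ?addr0 //; lia.
rewrite E coef_mul1 coefD !coef_mul1.
rewrite !cG // !cH // !(mul0r, mulr0) !addr0 => /eqP.
by rewrite eq_sym oppr_eq0 (negPf m0).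
Qed.

Variables (L : fieldType) (iota : {rmorphism K -> L}).

Lemma ev_curve_poly x y : ev iota x y F = curveF q (iota m) (iota n) x y.
Proof. by rewrite /F /curve_poly ev_curveF !evCC evCX evX. Qed.

(** Descent on the degree of a relation: the pseudo-remainder of [F] by its primitive part is a
    shorter relation, hence zero, and the primitive part would be a proper factor of [F]. *)
Lemma curve_indep x y (S : {poly {poly K}}) :
  transcendental_over iota x -> curveF q (iota m) (iota n) x y = 0 ->
  (size S <= q.+1)%N -> ev iota x y S = 0 -> S = 0.
Proof.
move=> Htr Fxy; move: {2}(size S) (leqnn (size S)) => s.
elim: s S => [|s IH] S sS sSq S0.
  by apply/eqP; rewrite -size_poly_eq0; case: (size S) sS.
apply/eqP; apply: contraT => nS.
have s1 : (1 < size S)%N.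
  rewrite ltnNge; apply/negP=> s1; move: nS S0.
  rewrite (size1_polyC s1) polyC_eq0 evC => c0 /eqP.
  by apply/negP; apply: Htr.
have [c [R [c0 SE Rp]]] := primitive_part nS.
have sR : size R = size S by rewrite SE size_Cmul.
have R0 : ev iota x y R = 0.
  move: S0; rewrite SE rmM evC => /eqP.
  by rewrite mulf_eq0 (negPf (Htr _ c0)) /= => /eqP.
have nR : R != 0 by apply: contraNneq nS => R00; rewrite SE R00 mulr0.
have [D [Q [T [D0 E sT]]]] := pseudo_div F nR.
have T0 : T = 0.
  apply: IH.
  - by rewrite -ltnS (leq_trans _ sS) // -sR.
  - by rewrite (leq_trans (ltnW sT)) // sR.
  - move/(congr1 (ev iota x y)): E; rewrite rmD !rmM ev_curve_poly Fxy R0.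
    by rewrite !mulr0 add0r.
have [Q' FE] := gauss_div D0 (etrans E (etrans (congr1 _ T0) (addr0 _))) Rp.
have F0 : F != 0 by rewrite -size_poly_eq0 size_curve_poly.
have Q0 : Q' != 0 by apply: contraNneq F0 => Q0; rewrite FE Q0 mul0r.
have sQ : (1 < size Q')%N.
  have : size F = size (Q' * R) by rewrite -FE.
  rewrite size_curve_poly // size_mul // sR => sE.
  rewrite ltnNge; apply/negP=> sQ.
  by move: (leq_add sQ sSq); case: (size Q' + size S)%N sE => //= k <-; rewrite add1n ltnn.
have := curve_poly_irreducible FE sQ.
by rewrite sR leqNgt s1.
Qed.

End Irreducibility.

(** * Places *)

Section ValuationRings.
Variables (K : closedFieldType) (L : fieldType) (iota : {rmorphism K -> L}).

Record valring (O : L -> Prop) : Prop := Valring {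
  vr_const : forall c, O (iota c);
  vr_sub : forall a b, O a -> O b -> O (a - b);
  vr_mul : forall a b, O a -> O b -> O (a * b);
  vr_total : forall a, O a \/ O a^-1 }.

(** The inverse of 0 is 0, so 0 needs a disjunct of its own. The trivial ring [L] is allowed, with
    maximal ideal 0. *)
Definition vmax (O : L -> Prop) (z : L) := O z /\ (z = 0 \/ ~ O z^-1).

Section Theory.
Variable O : L -> Prop.
Hypothesis HO : valring O.

Lemma vr0 : O 0. Proof. by rewrite -(rmorph0 iota); apply: vr_const. Qed.
Lemma vr1 : O 1. Proof. by rewrite -(rmorph1 iota); apply: vr_const. Qed.
Lemma vr_opp a : O a -> O (- a).
Proof. by move=> Oa; rewrite -sub0r; apply: vr_sub => //; apply: vr0. Qed.
Lemma vr_add a b : O a -> O b -> O (a + b).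
Proof. by move=> Oa Ob; rewrite -[b]opprK; apply: vr_sub => //; apply: vr_opp. Qed.
Lemma vr_exp a k : O a -> O (a ^+ k).
Proof.
by move=> Oa; elim: k => [|k IH]; rewrite ?expr0 ?exprS; [apply: vr1|apply: vr_mul].
Qed.

Lemma vr_ex x p : O x -> O (ex iota x p).
Proof.
move=> Ox; elim/poly_ind: p => [|p c IH]; first by rewrite rm0; apply: vr0.
rewrite rmD rmM exX exC.
by apply: vr_add; [apply: vr_mul | apply: vr_const].
Qed.

Lemma vr_ev x y P : O x -> O y -> O (ev iota x y P).
Proof.
move=> Ox Oy; elim/poly_ind: P => [|P p IH]; first by rewrite rm0; apply: vr0.
rewrite rmD rmM evX evC.
by apply: vr_add; [apply: vr_mul | apply: vr_ex].
Qed.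

Lemma vmax_in a : vmax O a -> O a. Proof. by case. Qed.

Lemma vmax0 : vmax O 0. Proof. by split; [apply: vr0 | left]. Qed.

Lemma vmax1 : ~ vmax O 1.
Proof.
by case=> _ [/eqP|]; [rewrite oner_eq0 | rewrite invr1; apply; apply: vr1].
Qed.

Lemma vmax_mull a b : O a -> vmax O b -> vmax O (a * b).
Proof.
move=> Oa [Ob b0]; split; first exact: vr_mul.
have [->|nab] := eqVneq (a * b) 0; first by left.
right=> Oab; case: b0 => [b0|]; first by rewrite b0 mulr0 eqxx in nab.
apply; have [a0 b0] : a != 0 /\ b != 0 by apply/andP; rewrite -negb_or -mulf_eq0.
have -> : b^-1 = a * (a * b)^-1 by rewrite invfM mulrA mulfV // mul1r.
exact: vr_mul.
Qed.

Lemma vmax_mulr a b : vmax O a -> O b -> vmax O (a * b).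
Proof. by move=> ma Ob; rewrite mulrC; apply: vmax_mull. Qed.

Lemma vmax_opp a : vmax O a -> vmax O (- a).
Proof. by move=> ma; rewrite -mulN1r; apply: vmax_mull => //; apply/vr_opp/vr1. Qed.

Lemma vmax_add a b : vmax O a -> vmax O b -> vmax O (a + b).
Proof.
move=> ma mb; have [->|a0] := eqVneq a 0; first by rewrite add0r.
have [->|b0] := eqVneq b 0; first by rewrite addr0.
case: (vr_total HO (a / b)) => [Oab | ].
  have -> : a + b = (a / b + 1) * b by rewrite mulrDl mul1r divfK.
  by apply: vmax_mull => //; apply: vr_add => //; apply: vr1.
rewrite invf_div => Oba.
have -> : a + b = (b / a + 1) * a by rewrite mulrDl mul1r divfK // addrC.
by apply: vmax_mull => //; apply: vr_add => //; apply: vr1.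
Qed.

Lemma vmax_sub a b : vmax O a -> vmax O b -> vmax O (a - b).
Proof. by move=> ma mb; apply: vmax_add => //; apply: vmax_opp. Qed.

Lemma vmax_const c : vmax O (iota c) -> c = 0.
Proof.
case=> _ [/eqP|]; first by rewrite fmorph_eq0 => /eqP.
by case; rewrite -fmorphV; apply: vr_const.
Qed.

Lemma vr_unit a : O a -> ~ vmax O a -> a != 0 /\ O a^-1.
Proof.
move=> Oa na; split; first by apply/eqP => a0; apply: na; rewrite a0; apply: vmax0.
by have [//|nO] := classic (O a^-1); case: na; split=> //; right.
Qed.

Lemma vmax_prime a b : O a -> O b -> vmax O (a * b) -> vmax O a \/ vmax O b.
Proof.
move=> Oa Ob mab; have [|na] := classic (vmax O a); [by left | right].
have [a0 Oa'] := vr_unit Oa na.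
by rewrite -[b](mulKf a0); apply: vmax_mull.
Qed.

Lemma vmax_inv a : ~ O a -> vmax O a^-1.
Proof.
move=> na; split; first by case: (vr_total HO a).
by right; rewrite invrK.
Qed.

Lemma vmax_expS a k : vmax O a -> vmax O (a ^+ k.+1).
Proof. by move=> ma; rewrite exprS; apply: vmax_mulr => //; apply/vr_exp/vmax_in. Qed.

Lemma vr_center x a : vmax O (x - iota a) -> O x.
Proof. by case=> Ox _; rewrite -[x](subrK (iota a)); apply: vr_add => //; apply: vr_const. Qed.

Lemma vmax_ex x a p : vmax O (x - iota a) -> vmax O (ex iota x p - iota p.[a]).
Proof.
move=> mx; elim/poly_ind: p => [|p c IH].
  by rewrite rm0 horner0 rmorph0 subr0; apply: vmax0.
rewrite exD exM exX exC hornerMXaddC rmorphD rmorphM.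
have -> : ex iota x p * x + iota c - (iota p.[a] * iota a + iota c)
   = (ex iota x p - iota p.[a]) * iota a + ex iota x p * (x - iota a) by ring.
apply: vmax_add; first by apply: vmax_mulr => //; apply: vr_const.
by apply: vmax_mull => //; apply: vr_ex; apply: vr_center mx.
Qed.

Lemma vmax_ev x y a b P : vmax O (x - iota a) -> vmax O (y - iota b) ->
  vmax O (ev iota x y P - iota (spec a P).[b]).
Proof.
move=> mx my; elim/poly_ind: P => [|P p IH].
  by rewrite ev0 spec0 horner0 rmorph0 subr0; apply: vmax0.
rewrite evD evM specD specM evX evC specX specC hornerMXaddC rmorphD rmorphM.
set u := iota _.[b]; set v := iota p.[a].
have -> : ev iota x y P * y + ex iota x p - (u * iota b + v)
   = (ev iota x y P - u) * iota b + ev iota x y P * (y - iota b)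
     + (ex iota x p - v) by ring.
apply: vmax_add; last exact: vmax_ex.
apply: vmax_add; first by apply: vmax_mulr => //; apply: vr_const.
by apply: vmax_mull => //; apply: vr_ev; [apply: vr_center mx | apply: vr_center my].
Qed.

Lemma vmax_ev0 x y a b P : vmax O (x - iota a) -> vmax O (y - iota b) ->
  vmax O (ev iota x y P) -> (spec a P).[b] = 0.
Proof.
move=> mx my mP; apply: vmax_const.
have -> : iota (spec a P).[b] =
  ev iota x y P - (ev iota x y P - iota (spec a P).[b]) by ring.
by apply: vmax_sub => //; apply: vmax_ev.
Qed.

End Theory.

Definition yconst (p : {poly K}) : {poly {poly K}} := map_poly polyC p.

Lemma spec_yconst a p : spec a (yconst p) = p.
Proof. by apply/polyP=> i; rewrite coef_spec coef_map hornerC. Qed.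

Lemma ev_yconst x y p : ev iota x y (yconst p) = ex iota y p.
Proof.
rewrite /ev -map_poly_comp; congr (_.[y]).
by apply: eq_map_poly => c; apply: exC.
Qed.

(** First-order expansion in X - a, with the coefficient at X = a kept as a polynomial in Y. *)
Lemma taylor_at a (P : {poly {poly K}}) :
  exists P1, P = yconst (spec a P) + ('X - a%:P)%:P * P1.
Proof.
have [|P1 E] := @spec_dvd K a (P - yconst (spec a P)).
  by rewrite rmB spec_yconst subrr.
by exists P1; rewrite -E addrC subrK.
Qed.

Lemma ev_taylor_at x y a P : exists P1,
  ev iota x y P = ex iota y (spec a P) + (x - iota a) * ev iota x y P1.
Proof.
have [P1 {1}->] := taylor_at a P; exists P1.
by rewrite rmD rmM ev_yconst evC rmB exX exC.
Qed.

(** * The local ring at a simple point of a fibre *)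

Section LocalRing.
Variables (x w : L) (r : nat) (G : {poly {poly K}}) (a b : K) (E : {poly K}).
Hypothesis Htr : transcendental_over iota x.
Hypothesis Hind : forall S : {poly {poly K}},
  (size S <= r)%N -> ev iota x w S = 0 -> S = 0.
Hypothesis HG0 : ev iota x w G = 0.
Hypothesis sG : size G = r.+1.
Hypothesis Gprim : forall c, spec c G != 0.
Hypothesis Hgen : generated_by iota x w.
Hypothesis Gab : spec a G = ('X - b%:P) * E.
Hypothesis Eb : E.[b] != 0.

Local Notation e := (ev iota x w).
Let phi (P : {poly {poly K}}) := (spec a P).[b].
Let t := x - iota a.

Let phiM P Q : phi (P * Q) = phi P * phi Q.
Proof. by rewrite /phi rmM hornerM. Qed.

Let phi1 : phi 1 = 1.
Proof. by rewrite /phi rm1 hornerC. Qed.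

Let e1 : e 1 = 1.
Proof. exact: ev1. Qed.

Let phi1n : phi 1 != 0.
Proof. by rewrite phi1 oner_neq0. Qed.

Let e_mul1 P : e P * e 1 = t ^+ 0 * e P.
Proof. by rewrite e1 mulr1 expr0 mul1r. Qed.

Let t_neq0 : t != 0.
Proof.
have := Htr (negbT (polyXsubC_eq0 a)).
by rewrite -[_.[x]]/(ex iota x _) rmB exX exC.
Qed.

Let phi_ker P : e P = 0 -> phi P = 0.
Proof.
move=> eP; have [Q ->] := model_ker Hind HG0 sG Gprim eP.
by rewrite phiM /phi Gab hornerM hornerXsubC subrr mul0r mulr0.
Qed.

Let phi_neq0 P : phi P != 0 -> e P != 0.
Proof. by apply: contra_neq => /phi_ker. Qed.

(** Both [P] and [G] are divisible by w - b modulo [t]. Multiplying by the local unit [E(w)] lets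
    the relation [G = 0] eliminate that part of [P], and the rest is a multiple of [t]. *)
Let phi_eq0 P : phi P = 0 ->
  exists P' Q', phi Q' != 0 /\ e P * e Q' = t * e P'.
Proof.
move=> /eqP/factor_theorem[P2 EP].
have [P1 EP1] := ev_taylor_at x w a P.
have [G1] := ev_taylor_at x w a G; rewrite HG0 Gab rmM rmB exX exC => EG.
exists (P1 * yconst E - yconst P2 * G1), (yconst E); split; first by rewrite /phi spec_yconst.
rewrite evB !evM !ev_yconst EP1 EP exM exB exX exC -/t.
rewrite -/t in EG.
apply/eqP; rewrite -subr_eq0; apply/eqP.
set u := ex _ _ P2; set v := ex _ _ E in EG *; set z := w - _ in EG *.
have -> : forall p1 g1 : L, (u * z + t * p1) * v - t * (p1 * v - u * g1)
  = u * (z * v + t * g1) by move=> *; ring.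
by rewrite -EG mulr0.
Qed.

Let local_factor P : e P != 0 -> exists k P' Q',
  [/\ phi P' != 0, phi Q' != 0 & e P * e Q' = t ^+ k * e P'].
Proof.
move=> P0; have [Q [N [N0 EN]]] := model_norm Htr Hind HG0 sG P0.
(* The induction is on the multiplicity of [a] in a norm of [P]. Every factor [t] taken out of [P]
   lowers it by one, which is why the extraction stops. *)
have [k [N1 + EN1]] := multiplicity_XsubC N a; rewrite N0 /= => N1a.
have {EN EN1 N0} : e P * e Q = t ^+ k * e N1%:P.
  by rewrite EN EN1 rmM rmXn rmB exX exC evC mulrC.
have : phi N1%:P != 0 by rewrite /phi specC hornerC.
move: N1%:P => {N1 N1a N} R; elim: k P Q R {P0} => [|k IH] P Q R R0 EPQ.
  exists 0%N, P, 1; split; [|exact: phi1n|exact: e_mul1].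
  apply/negP=> /eqP P0.
  have : phi (P * Q - R) = 0.
    by apply: phi_ker; rewrite rmB rmM EPQ expr0 mul1r subrr.
  rewrite /phi rmB hornerD hornerN -/(phi (P * Q)) -/(phi R) phiM P0 mul0r sub0r.
  by move/eqP; rewrite oppr_eq0 (negPf R0).
have [P0|nP] := eqVneq (phi P) 0; last first.
  by exists 0%N, P, 1; split; [|exact: phi1n|exact: e_mul1].
have [P1 [Q1 [Q10 E1]]] := phi_eq0 P0.
have [||k' [P' [Q' [P'0 Q'0 E2]]]] := IH P1 Q (R * Q1).
- by rewrite phiM mulf_neq0.
- apply: (mulfI t_neq0); rewrite mulrA -E1 mulrAC EPQ exprS rmM; ring.
exists k'.+1, P', (Q1 * Q'); split=> //; first by rewrite phiM mulf_neq0.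
by rewrite rmM mulrA E1 -mulrA E2 exprS mulrA.
Qed.

(** The ring consists of the fractions whose denominator does not vanish at (a, b). It is total
    because every nonzero function is a power of [t] times a local unit. *)
Lemma local_valring : exists O, [/\ valring O, vmax O (x - iota a)
  & forall P : {poly {poly K}}, (spec a P).[b] = 0 -> vmax O (ev iota x w P)].
Proof.
pose O z := exists P Q, phi Q != 0 /\ z = e P / e Q.
have OE P : O (e P).
  by exists P, 1; rewrite e1 divr1.
have HO : valring O.
  split.
  - by move=> c; have := OE c%:P%:P; rewrite evCC.
  - move=> _ _ [P [Q [Q0 ->]]] [P' [Q' [Q'0 ->]]].
    exists (P * Q' - P' * Q), (Q * Q'); rewrite phiM mulf_neq0 //; split=> //.
    rewrite -mulNr addf_div ?phi_neq0 // rmB !rmM; congr (_ / _); ring.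
  - move=> _ _ [P [Q [Q0 ->]]] [P' [Q' [Q'0 ->]]].
    exists (P * P'), (Q * Q'); rewrite phiM mulf_neq0 //; split=> //.
    by rewrite mulf_div !rmM.
  - move=> z; have [P [Q [Q0 ->]]] := model_frac Hgen z.
    have [P0|P0] := eqVneq (e P) 0.
      by left; rewrite P0 mul0r; have := OE 0; rewrite rm0.
    have [k [P1 [P2 [P10 P20 EP]]]] := local_factor P0.
    have [l [Q1 [Q2 [Q10 Q20 EQ]]]] := local_factor Q0.
    have {EP} EP : e P = t ^+ k * e P1 / e P2 by rewrite -EP mulfK // phi_neq0.
    have {EQ} EQ : e Q = t ^+ l * e Q1 / e Q2 by rewrite -EQ mulfK // phi_neq0.
    have [p1 p2 q1 q2] : [/\ e P1 != 0, e P2 != 0, e Q1 != 0 & e Q2 != 0].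
      by split; apply: phi_neq0.
    have et : t = e ('X%:P - a%:P%:P) by rewrite rmB evCX evCC.
    rewrite EP EQ; case: (leqP l k) => [lk|/ltnW kl]; [left|right].
      exists ((('X%:P - a%:P%:P) ^+ (k - l)) * P1 * Q2), (P2 * Q1).
      rewrite phiM mulf_neq0 //; split=> //; rewrite !rmM rmXn -et.
      rewrite -{1}(subnK lk) exprD.
      by field; rewrite p2 q1 q2 expf_neq0.
    exists ((('X%:P - a%:P%:P) ^+ (l - k)) * P2 * Q1), (P1 * Q2).
    rewrite phiM mulf_neq0 //; split=> //; rewrite !rmM rmXn -et.
    rewrite -{1}(subnK kl) exprD.
    by field; rewrite p1 p2 q1 q2 !expf_neq0.
have Om P : phi P = 0 -> vmax O (e P).
  move=> P0; split=> //; have [->|eP] := eqVneq (e P) 0; [by left | right].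
  case=> [P' [Q' [Q'0 EQ]]].
  have : e P * e P' = e Q'.
    by rewrite -[e P'](divfK (phi_neq0 Q'0)) -EQ mulrA mulfV // mul1r.
  move=> E1; have : phi (P * P' - Q') = 0.
    by apply: phi_ker; rewrite rmB rmM E1 subrr.
  rewrite /phi rmB hornerD hornerN -/(phi (P * P')) -/(phi Q') phiM P0 mul0r sub0r.
  by move/eqP; rewrite oppr_eq0 (negPf Q'0).
exists O; split=> //.
have -> : x - iota a = e ('X%:P - a%:P%:P) by rewrite rmB evCX evCC.
by apply: Om; rewrite /phi rmB !specC hornerD hornerN !hornerC hornerX subrr.
Qed.

End LocalRing.
End ValuationRings.

(** * Coordinate pairs, fibres and branches *)

Section CurvePairs.
Variables (K : closedFieldType) (L : fieldType) (iota : {rmorphism K -> L}).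
Variables (q : nat) (m n : K).
Hypothesis HP : curve_params q m n.

Let Hq : [pchar K].-nat q. Proof. by case: HP. Qed.
Let q_gt1 : (1 < q)%N. Proof. by case: HP => _ q3 _ _ _; apply: leq_trans q3. Qed.
Let mn1 : m + n = 1. Proof. by case: HP. Qed.
Let m0 : m != 0. Proof. by case: HP. Qed.
Let n0 : n != 0. Proof. by case: HP. Qed.

Local Notation F := (curve_poly q m n).

(** The coordinates are kept variable: exchange, translation by F_q and inversion give new pairs, so
    that a local study at the origin covers every finite node and both branches, and one on the
    affine part also covers infinity. *)
Record cpair (x y : L) : Prop := CPair {
  cp_eq : curveF q (iota m) (iota n) x y = 0;
  cp_tr : transcendental_over iota x;
  cp_gen : generated_by iota x y }.

Lemma transcendentalP x : transcendental_over iota x <-> forall c, x != iota c.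
Proof.
split=> [Htr c|Hx P P0].
  have := Htr _ (negbT (polyXsubC_eq0 c)).
  by rewrite -[_.[x]]/(ex iota x _) exB exX exC subr_eq0.
have [s ->] := closed_field_poly_normal P.
rewrite map_polyZ hornerZ mulf_neq0 ?fmorph_eq0 ?lead_coef_eq0 //.
elim: s => [|z s IH]; first by rewrite big_nil rmorph1 hornerC oner_neq0.
rewrite big_cons rmorphM hornerM mulf_neq0 //.
rewrite rmorphB /= map_polyX map_polyC hornerXsubC subr_eq0; exact: Hx.
Qed.

Lemma qnat0 : q%:R = 0 :> K.
Proof.
have pq := pdiv_prime q_gt1.
have /(pnatP _ (ltnW q_gt1))/(_ _ pq (pdiv_dvd q)) pc := Hq.
by apply/eqP; rewrite -(dvdn_pcharf pc) pdiv_dvd.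
Qed.

(** At a zero of the derivative the equation takes the value [- m n (a^q - a)^2], which is not 0 off
    F_q. *)
Lemma curve_deriv_neq0 a b : a ^+ q != a -> curveF q m n a b = 0 ->
  (spec a F)^`().[b] != 0.
Proof.
move=> aq Fab.
have -> : spec a F = ('X^q - (m * a + n * a ^+ q)%:P) * ('X - (m * a ^+ q + n * a)%:P)
    - (m * n * (a ^+ q - a) ^+ 2)%:P.
  rewrite spec_curve_poly (curveF_factor HP (polyC : {rmorphism K -> _})) /=.
  by rewrite !(polyCM, polyCD, polyC_exp, polyCN).
rewrite derivB derivC subr0 derivM !derivB !derivC derivXn derivX !subr0.
rewrite -mulr_natr -polyC_natr qnat0 polyC0 mulr0 mul0r add0r mulr1.
rewrite hornerD hornerN hornerC hornerXn; apply/negP=> /eqP Eb.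
move: Fab; rewrite (curveF_factor HP (idfun : {rmorphism K -> K})) //= Eb mul0r.
move/eqP; rewrite sub0r oppr_eq0 !mulf_eq0 (negPf m0) (negPf n0) !subr_eq0 (negPf aq).
by [].
Qed.

Lemma curve_simple_root a b : a ^+ q != a -> curveF q m n a b = 0 ->
  exists2 E : {poly K}, spec a F = ('X - b%:P) * E & E.[b] != 0.
Proof.
move=> aq Fab; have : root (spec a F) b.
  by apply/rootP; rewrite horner_spec_curve.
case/factor_theorem=> E EF; exists E; first by rewrite mulrC.
have := curve_deriv_neq0 aq Fab.
by rewrite EF derivM derivXsubC mulr1 !hornerE subrr mulr0 add0r.
Qed.

Lemma lead_spec_curve a : lead_coef (spec a F) = 1 /\ size (spec a F) = q.+2.
Proof.
have cF : (spec a F)`_q.+1 = 1.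
  rewrite coef_spec.
  have -> : F`_q.+1 = 1 by rewrite -(lead_curve_poly HP) lead_coefE size_curve_poly.
  by rewrite hornerC.
have sF : size (spec a F) = q.+2.
  apply/anti_leq; rewrite -{1}(size_curve_poly HP) size_spec /=.
  rewrite ltnNge; apply/negP=> /leq_sizeP/(_ _ (leqnn _)); rewrite cF => /eqP.
  by rewrite oner_eq0.
by rewrite lead_coefE sF.
Qed.

Lemma curve_fiber a : a ^+ q != a ->
  exists bs : seq K, [/\ uniq bs, size bs = q.+1
    & forall b, (b \in bs) = (curveF q m n a b == 0)].
Proof.
move=> aq; have [bs E] := closed_field_poly_normal (spec a F).
have [lF sF] := lead_spec_curve a; rewrite lF scale1r in E; exists bs; split.
- rewrite -separable_prod_XsubC -E unlock /separable_poly.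
  apply/Pdiv.ClosedField.root_coprimep => b /rootP.
  by rewrite horner_spec_curve => /(curve_deriv_neq0 aq).
- by move: sF; rewrite E size_prod_XsubC => -[].
- move=> b; rewrite -horner_spec_curve -[_ == 0]/(root _ b) E.
  by rewrite root_prod_XsubC.
Qed.

Lemma place_smooth x y a b : cpair x y -> a ^+ q != a -> curveF q m n a b = 0 ->
  exists O, [/\ valring iota O, vmax O (x - iota a) & vmax O (y - iota b)].
Proof.
case=> Fxy Htr Hgen aq Fab.
have [E EF Eb] := curve_simple_root aq Fab.
have Hi (S : {poly {poly K}}) : (size S <= q.+1)%N -> ev iota x y S = 0 -> S = 0.
  exact: (curve_indep HP Htr Fxy).
have F0 : ev iota x y F = 0 by rewrite ev_curve_poly.
have [O [HO mx mP]] := local_valring Htr Hi F0 (size_curve_poly HP)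
  (spec_curve_neq0 HP) Hgen EF Eb.
exists O; split=> //.
have -> : y - iota b = ev iota x y ('X - b%:P%:P) by rewrite evB evX evCC.
by apply: mP; rewrite specB specX specC !hornerE subrr.
Qed.

Lemma cpair_neq x y c : cpair x y -> x != iota c.
Proof. by case=> _ /transcendentalP. Qed.

Lemma cpair_swap x y : cpair x y -> cpair y x.
Proof.
case=> Fxy Htr Hgen; split; first by rewrite curveFC.
(* If y were a constant c, then by symmetry x would be a root of the nonzero polynomial
   [spec c F]. *)
- apply/transcendentalP=> c; apply/eqP=> yc.
  have := Htr _ (spec_curve_neq0 HP c).
  rewrite -[_.[x]]/(ex iota x _) spec_curve_poly /ex.
  rewrite (rmorph_curveF (map_poly iota)) horner_curveF /= !map_polyC map_polyX /=.
  by rewrite !hornerC hornerX -yc curveFC Fxy eqxx.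
- by move=> S Sc Sy Sx; apply: Hgen.
Qed.

(** The chart Y = XW of the blow-up of the origin: this is F(X, XW) / X^2. At X = 0 it reduces to -m
    W, so this chart sees one branch, at the simple root W = 0; the other branch is at W
    infinite. *)
Definition branch_poly : {poly {poly K}} :=
  ('X^(q.-1))%:P * ('X^(q.+1) + 1) - (m *: 'X^(q.-1 + q.-1))%:P * 'X^q
  - m%:P%:P * 'X - n%:P%:P * ('X^(q.-1))%:P * ('X + 'X^q).

Lemma ev_branch_poly x w :
  x ^+ 2 * ev iota x w branch_poly = curveF q (iota m) (iota n) x (x * w).
Proof.
rewrite /branch_poly !(evB, evD, evM, evXn, ev1) !evX !evC.
rewrite -!mul_polyC !(exM, exC, exXn, exX) exprD /curveF.
rewrite !exprMn -{2 4 5 7 9 10}(prednK (ltnW q_gt1)) !exprSr.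
case: q q_gt1 => // k _ /=; rewrite !exprSr; ring.
Qed.

Lemma coef_branch_poly i : branch_poly`_i =
  'X^(q.-1) * ((i == q.+1)%:R + (i == 0)%N%:R) - m *: 'X^(q.-1 + q.-1) * (i == q)%:R
  - m%:P * (i == 1)%N%:R - n%:P * 'X^(q.-1) * ((i == 1)%N%:R + (i == q)%:R).
Proof.
rewrite /branch_poly !coefB -mulrA !coefCM !coefD !coefXn coefX coef1.
by rewrite mulrA.
Qed.

Lemma size_branch_poly : size branch_poly = q.+2.
Proof.
apply/anti_leq/andP; split.
  apply/leq_sizeP=> i qi; rewrite coef_branch_poly.
  rewrite (_ : (i == q.+1) = false); last by lia.
  rewrite (_ : (i == q) = false); last by lia.
  rewrite (_ : (i == 0)%N = false); last by lia.
  rewrite (_ : (i == 1)%N = false); last by lia.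
  by rewrite !(mulr0, addr0, subr0).
rewrite ltnNge; apply/negP=> /leq_sizeP/(_ q.+1 (leqnn _)).
rewrite coef_branch_poly eqxx (_ : (q.+1 == 1)%N = false); last by lia.
rewrite (_ : (q.+1 == q)%N = false); last by lia.
rewrite !(mulr0, addr0, subr0, mulr1) => /eqP; apply/negP.
by rewrite expf_neq0 // polyX_eq0.
Qed.

Lemma spec0_branch_poly : spec 0 branch_poly = ('X - 0%:P) * (- m)%:P.
Proof.
have p0 : (0 ^+ q.-1 = 0 :> K) by rewrite expr0n; case: q q_gt1 => // -[].
rewrite /branch_poly !(specB, specD, specM, specXn, spec1) !specX !specC.
rewrite -mul_polyC !hornerE exprD p0 !(mulr0, mul0r, polyC0, subr0, sub0r).
by rewrite polyCN mulrN mulrC oppr0 sub0r.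
Qed.

Lemma spec_branch_neq0 a : spec a branch_poly != 0.
Proof.
have [->|a0] := eqVneq a 0.
  by rewrite spec0_branch_poly mulf_neq0 ?polyXsubC_eq0 // polyC_eq0 oppr_eq0.
apply/eqP=> /(congr1 (fun P : {poly K} => P`_q.+1)); rewrite coef_spec coef0.
rewrite coef_branch_poly eqxx (_ : (q.+1 == 1)%N = false); last by lia.
rewrite (_ : (q.+1 == q)%N = false); last by lia.
rewrite !(mulr0, addr0, subr0, mulr1) hornerXn => /eqP; apply/negP.
by rewrite expf_neq0.
Qed.

(* The branch of the node at the origin along which y = O(x^q). *)
Lemma place_branch x y : cpair x y ->
  exists O, [/\ valring iota O, vmax O x & vmax O (y / x)].
Proof.
move=> cxy; have [Fxy Htr Hgen] := cxy.
have x0 : x != 0 by rewrite -(rmorph0 iota); apply: cpair_neq cxy.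
have Ew : x * (y / x) = y by rewrite mulrC divfK.
have Hi (S : {poly {poly K}}) :
    (size S <= q.+1)%N -> ev iota x (y / x) S = 0 -> S = 0.
  move=> sS S0.
  (* A relation in y / x of degree at most q becomes a relation in y after multiplication by x^q. *)
  pose T : {poly {poly K}} := \poly_(j < q.+1) (S`_j * 'X^(q - j)).
  have T0 : T = 0.
    apply: (curve_indep HP Htr Fxy); first exact: size_poly.
    rewrite (ev_sum _ _ _ (size_poly _ _)).
    transitivity (x ^+ q * ev iota x (y / x) S); last by rewrite S0 mulr0.
    rewrite (ev_sum _ _ _ sS) mulr_sumr; apply: eq_bigr => i _.
    rewrite coef_poly ltn_ord exM exXn exX expr_div_n.
    have -> : x ^+ q = x ^+ (q - i) * x ^+ i by rewrite -exprD subnK // -ltnS.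
    by field; rewrite expf_neq0.
  apply/polyP=> j; rewrite coef0; have [jq|jq] := ltnP j q.+1; last first.
    by rewrite nth_default // (leq_trans sS).
  have := congr1 (fun P : {poly {poly K}} => P`_j) T0; rewrite coef0 coef_poly jq.
  by move/eqP; rewrite mulf_eq0 expf_eq0 polyX_eq0 andbF orbF => /eqP.
have B0 : ev iota x (y / x) branch_poly = 0.
  apply: (mulfI (expf_neq0 2 x0)).
  by rewrite ev_branch_poly Ew Fxy mulr0.
have Hgen' : generated_by iota x (y / x).
  move=> S Sc Sx Sw Sadd Sopp Smul Sinv; apply: Hgen => //.
  by rewrite -Ew; apply: Smul.
have m1 : (- m)%:P.[0] != 0 by rewrite hornerC oppr_eq0.
have [O [HO mx mP]] := local_valring Htr Hi B0 size_branch_poly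
  spec_branch_neq0 Hgen' spec0_branch_poly m1.
exists O; split=> //; first by rewrite -[x]subr0 -(rmorph0 iota).
by rewrite -[y / x](evX iota x); apply: mP; rewrite specX hornerX.
Qed.

End CurvePairs.

(** * Moebius substitutions and the invariance of the equation *)

Section Moebius.
Variables (K : closedFieldType) (L : fieldType) (iota : {rmorphism K -> L}).

Definition moebius (a b c d : K) (z : L) : L :=
  (iota a * z + iota b) / (iota c * z + iota d).

Lemma moebius_den_neq0 a b c d z : a * d - b * c != 0 ->
  transcendental_over iota z -> iota c * z + iota d != 0.
Proof.
move=> D0 /transcendentalP Hz; have [c0|c0] := eqVneq c 0.
  rewrite c0 rmorph0 mul0r add0r fmorph_eq0; apply: contraNneq D0 => d0.
  by rewrite c0 d0 !mulr0 subr0.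
apply: contra (Hz (- d / c)) => /eqP E.
have ic : iota c != 0 by rewrite fmorph_eq0.
rewrite fmorph_div rmorphN -(inj_eq (mulfI ic)) mulrC [X in _ == X]mulrC divfK //.
by rewrite -addr_eq0 mulrC E.
Qed.

Lemma moebiusK a b c d z : a * d - b * c != 0 -> iota c * z + iota d != 0 ->
  - iota c * moebius a b c d z + iota a != 0 /\
  moebius d (- b) (- c) a (moebius a b c d z) = z.
Proof.
move=> D0 cz.
have iD : iota a * iota d - iota b * iota c != 0.
  by rewrite -!rmorphM -rmorphB fmorph_eq0.
have E : - iota c * moebius a b c d z + iota a =
  (iota a * iota d - iota b * iota c) / (iota c * z + iota d).
  by rewrite /moebius; field.
have E0 : - iota c * moebius a b c d z + iota a != 0.
  by rewrite E mulf_neq0 ?invr_neq0.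
split=> //; rewrite {1}/moebius !rmorphN E /moebius; field.
by rewrite iD cz.
Qed.

Lemma moebius_comp a b c d a' b' c' d' z :
  iota c * z + iota d != 0 ->
  moebius a' b' c' d' (moebius a b c d z) =
  moebius (a' * a + b' * c) (a' * b + b' * d) (c' * a + d' * c) (c' * b + d' * d) z.
Proof.
move=> cz; rewrite /moebius !(rmorphD, rmorphM).
(* When the outer denominator vanishes, so does that of the product, and both sides are 0 by the
   convention on inverses. *)
have [E|E] := eqVneq (iota c' * ((iota a * z + iota b) / (iota c * z + iota d)) + iota d') 0.
  rewrite E invr0 mulr0.
  have -> : (iota c' * iota a + iota d' * iota c) * z + (iota c' * iota b + iota d' * iota d)
    = (iota c' * ((iota a * z + iota b) / (iota c * z + iota d)) + iota d')
      * (iota c * z + iota d) by field.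
  by rewrite E mul0r invr0 mulr0.
have E' : (iota c' * iota a + iota d' * iota c) * z + (iota c' * iota b + iota d' * iota d)
    = (iota c' * ((iota a * z + iota b) / (iota c * z + iota d)) + iota d')
      * (iota c * z + iota d) by field.
rewrite E' invfM.
field.
rewrite cz /=.
have -> : iota c' * (iota a * z + iota b) + iota d' * (iota c * z + iota d) =
 (iota c' * ((iota a * z + iota b) / (iota c * z + iota d)) + iota d')
      * (iota c * z + iota d) by field.
by rewrite mulf_neq0.
Qed.

Lemma moebius_transcendental a b c d z : a * d - b * c != 0 ->
  transcendental_over iota z -> transcendental_over iota (moebius a b c d z).
Proof.
move=> D0 Htr; have cz := moebius_den_neq0 D0 Htr.
have [_ zE] := moebiusK D0 cz.
apply/transcendentalP => k; apply/eqP=> E.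
move/transcendentalP: Htr => /(_ ((d * k - b) / (- c * k + a)))/eqP; apply.
by rewrite -zE E /moebius fmorph_div !(rmorphD, rmorphM, rmorphN).
Qed.

Variables (q : nat) (m n : K).
Hypothesis HP : curve_params q m n.
Local Notation cpair := (cpair iota q m n).

(** A map with coefficients in F_q commutes with the q-th power, so the equation is only multiplied
    by det^2 over the product of the denominators at x, y, x^q and y^q. *)
Lemma cpair_moebius a b c d x y : a * d - b * c != 0 ->
  [/\ a ^+ q = a, b ^+ q = b, c ^+ q = c & d ^+ q = d] ->
  cpair x y -> cpair (moebius a b c d x) (moebius a b c d y).
Proof.
move=> D0 [aq bq cq dq] cxy; have [Fxy Hx Hgen] := cxy.
have [_ Hy _] := cpair_swap HP cxy.
have cx := moebius_den_neq0 D0 Hx; have cy := moebius_den_neq0 D0 Hy.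
split; [|exact: moebius_transcendental|].
- have powm z : moebius a b c d z ^+ q = moebius a b c d (z ^+ q).
    rewrite /moebius expr_div_n !(frobD (cp_frob HP) iota) !exprMn -!rmorphXn.
    by rewrite aq bq cq dq.
  have cX : iota c * x ^+ q + iota d != 0.
    have := expf_neq0 q cx.
    by rewrite (frobD (cp_frob HP) iota) exprMn -!rmorphXn cq dq.
  have cY : iota c * y ^+ q + iota d != 0.
    have := expf_neq0 q cy.
    by rewrite (frobD (cp_frob HP) iota) exprMn -!rmorphXn cq dq.
  have mE : iota m = 1 - iota n by rewrite -(rmorph1 iota) -(cp_sum HP) rmorphD addrK.
  suff -> : curveF q (iota m) (iota n) (moebius a b c d x) (moebius a b c d y)
    = (iota a * iota d - iota b * iota c) ^+ 2 / ((iota c * x ^+ q + iota d) *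
       (iota c * y ^+ q + iota d) * (iota c * x + iota d) * (iota c * y + iota d))
      * curveF q (iota m) (iota n) x y by rewrite Fxy mulr0.
  rewrite /curveF !exprSr !powm /moebius mE.
  move: (x ^+ q) (y ^+ q) cX cY => X Y cX cY.
  by field; rewrite cx cy cX cY.
- have [_ xE] := moebiusK D0 cx; have [_ yE] := moebiusK D0 cy.
  move=> S Sc Sx Sy Sadd Sopp Smul Sinv.
  have Smob z : S z -> S (moebius d (- b) (- c) a z).
    by move=> Sz; apply (Smul); [|apply (Sinv)]; apply (Sadd) => //; apply (Smul).
  by apply: Hgen => //; [rewrite -xE | rewrite -yE]; apply: Smob.
Qed.

Lemma q_gt0 : (0 < q)%N.
Proof. by apply: leq_trans (cp_q HP). Qed.

Lemma frob0 : (0 : K) ^+ q = 0.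
Proof. by rewrite expr0n; case: q q_gt0. Qed.

Lemma cpair_translate a x y : a ^+ q = a -> cpair x y ->
  cpair (x - iota a) (y - iota a).
Proof.
move=> aq cxy; have D0 : 1 * 1 - (- a) * 0 != 0 :> K by rewrite mulr0 mulr1 subr0 oner_neq0.
have mE z : moebius 1 (- a) 0 1 z = z - iota a.
  by rewrite /moebius rmorph1 rmorph0 rmorphN mul0r mul1r add0r divr1.
rewrite -!mE; apply: cpair_moebius => //; split; rewrite ?expr1n ?frob0 //.
by rewrite (frobN (cp_frob HP) (idfun : {rmorphism K -> K})) aq.
Qed.

Lemma cpair_inv x y : cpair x y -> cpair x^-1 y^-1.
Proof.
move=> cxy; have D0 : 0 * 0 - 1 * 1 != 0 :> K.
  by rewrite mulr0 mulr1 sub0r oppr_eq0 oner_neq0.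
have mE z : moebius 0 1 1 0 z = z^-1.
  by rewrite /moebius rmorph1 rmorph0 mul0r mul1r add0r addr0 mul1r.
by rewrite -!mE; apply: cpair_moebius => //; split; rewrite ?expr1n ?frob0.
Qed.

End Moebius.

(** * Regular functions *)

Section RegularFunctions.
Variables (K : closedFieldType) (L : fieldType) (iota : {rmorphism K -> L}).
Variables (q : nat) (m n : K).
Hypothesis HP : curve_params q m n.
Local Notation cpair := (cpair iota q m n).
Local Notation F := (curve_poly q m n).

(** The equation is monic in y, so y is integral over K[x]. If y had a pole, dividing by y^(q+1)
    would write 1 as a multiple of y^-1 in the ring. *)
Lemma center_y O x y : valring iota O -> cpair x y -> O x -> O y.
Proof.
move=> HO cxy Ox; apply: NNPP => nOy.
have my := vmax_inv HO nOy; have Oy := vmax_in my.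
have y0 : y != 0 by rewrite -(rmorph0 iota); apply: cpair_neq (cpair_swap HP cxy).
apply: (vmax1 HO).
have E : 1 = y^-1 * (iota m * (x ^+ q + x * y^-1 ^+ q.-1)
   + iota n * (x ^+ q * y^-1 ^+ q.-1 + x) - x ^+ q.+1 * y^-1 ^+ q).
  have t0 : y ^+ q.-1 != 0 by rewrite expf_neq0.
  have yq : y ^+ q = y ^+ q.-1 * y by rewrite -exprSr (prednK (q_gt0 HP)).
  apply/eqP; rewrite -subr_eq0; apply/eqP.
  transitivity (curveF q (iota m) (iota n) x y / (y ^+ q.-1 * y * y)).
    by rewrite /curveF !exprSr !exprVn yq; field; rewrite y0 t0.
  by rewrite (cp_eq cxy) mul0r.
rewrite E; apply: (vmax_mulr HO) => //.
have Om := vr_const HO m; have On := vr_const HO n.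
have X k : O (x ^+ k) by apply: (vr_exp HO).
have Y k : O (y^-1 ^+ k) by apply: (vr_exp HO).
apply: (vr_sub HO) => //; last by apply: (vr_mul HO).
apply: (vr_add HO) => //; apply: (vr_mul HO) => //; apply: (vr_add HO) => //; apply: (vr_mul HO) => //.
Qed.

(** At such a place [spec a F] vanishes at y. It splits over [K] and the maximal ideal is prime, so
    one of its linear factors vanishes. *)
Lemma center_fiber O x y a : valring iota O -> cpair x y -> vmax O (x - iota a) ->
  exists b, curveF q m n a b = 0 /\ vmax O (y - iota b).
Proof.
move=> HO cxy mx; have Ox := vr_center HO mx; have Oy := center_y HO cxy Ox.
have [P1] := ev_taylor_at iota x y a F; rewrite ev_curve_poly (cp_eq cxy) => /eqP.
rewrite eq_sym addr_eq0 => /eqP E.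
have : vmax O (ex iota y (spec a F)).
  by rewrite E; apply/(vmax_opp HO)/(vmax_mulr HO) => //; apply: (vr_ev HO).
have [bs EF] := closed_field_poly_normal (spec a F).
have rt b : b \in bs -> curveF q m n a b = 0.
  move=> bbs; rewrite -horner_spec_curve; apply/rootP.
  by rewrite EF rootZ ?root_prod_XsubC // lead_coef_eq0 (spec_curve_neq0 HP).
rewrite EF (lead_spec_curve HP a).1 scale1r {EF E}.
elim: bs rt => [|b bs IH] rt; first by rewrite big_nil ex1 => /(vmax1 HO).
rewrite big_cons exM exB exX exC => /(vmax_prime HO) [||mb|mbs].
- by apply: (vr_sub HO) => //; apply: (vr_const HO).
- exact: vr_ex.
- by exists b; split=> //; apply: rt; rewrite mem_head.
- by apply: IH => // c cbs; apply: rt; rewrite inE cbs orbT.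
Qed.

Lemma center_node O x y a : valring iota O -> cpair x y -> a ^+ q = a ->
  vmax O (x - iota a) -> vmax O (y - iota a).
Proof.
move=> HO cxy aq mx; have [b [Fab mb]] := center_fiber HO cxy mx.
move: Fab; rewrite (curveF_frob HP (idfun : {rmorphism K -> K})) // => /eqP.
by rewrite expf_eq0 /= subr_eq0 => /eqP <-.
Qed.

Lemma swapped_branch x y : cpair x y -> exists O s,
  [/\ valring iota O, vmax O y, O s & x = y ^+ q * s].
Proof.
move=> cxy; have cyx := cpair_swap HP cxy.
have [O [HO my mw]] := place_branch HP cyx.
have y0 : y != 0 by rewrite -(rmorph0 iota); apply: cpair_neq cyx.
have im : iota m != 0 by rewrite fmorph_eq0 (cp_m HP).
set w := x / y in mw; have xE : x = y * w by rewrite mulrC divfK.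
(* Solve the equation for the term m x y: with x = y w every other term is divisible by y^(q+1), and
   [s] is the cofactor divided by m. *)
pose s := (iota m)^-1 * (w ^+ q.+1 + 1 - iota m * (w ^+ q * y ^+ q.-1)
   - iota n * (w ^+ q + w)).
have Ow := vmax_in mw; have Oy := vmax_in my.
have Om := vr_const HO m; have On := vr_const HO n.
exists O, s; split=> //.
  have W k : O (w ^+ k) by apply: (vr_exp HO).
  have Y k : O (y ^+ k) by apply: (vr_exp HO).
  apply: (vr_mul HO) => //; first by rewrite -fmorphV; apply: (vr_const HO).
  apply: (vr_sub HO) => //; last by apply: (vr_mul HO) => //; apply: (vr_add HO).
  apply: (vr_sub HO) => //; last by apply: (vr_mul HO) => //; apply: (vr_mul HO).
  by apply: (vr_add HO) => //; apply: (vr1 HO).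
apply: (mulfI im); apply: (mulfI y0).
have yq : y ^+ q = y ^+ q.-1 * y by rewrite -exprSr (prednK (q_gt0 HP)).
apply/eqP; rewrite -subr_eq0; apply/eqP.
transitivity (- curveF q (iota m) (iota n) x y); last by rewrite (cp_eq cxy) oppr0.
rewrite /s /curveF [in RHS]xE !exprMn !exprSr yq xE.
by field; rewrite y0 im.
Qed.

(** The factor [h] makes the order of vanishing exceed r, while the degree is at most r; the factors
    y - a are stripped off one by one. *)
Lemma high_order_eq0 O y a r (p : {poly K}) h : valring iota O ->
  y != iota a -> vmax O (y - iota a) -> vmax O h -> (size p <= r.+1)%N ->
  ex iota y p = (y - iota a) ^+ r * h -> p = 0.
Proof.
move=> HO ya my; elim: r p h => [|r IH] p h mh sp E.
  move: E; rewrite (size1_polyC sp) exC expr0 mul1r => E.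
  by rewrite (vmax_const HO (c := p`_0)) ?E // polyC0.
have Oy := vr_center HO my.
have p0 : p.[a] = 0.
  apply: (vmax_const HO).
  have -> : iota p.[a] = ex iota y p - (ex iota y p - iota p.[a]) by ring.
  apply: (vmax_sub HO) (vmax_ex HO _ my); rewrite E.
  by apply: (vmax_mull HO) => //; apply: (vr_exp HO) => //; apply: vmax_in.
move/eqP: p0 => /factor_theorem[p1 Ep].
suff p10 : p1 = 0 by rewrite Ep p10 mul0r.
have ya0 : y - iota a != 0 by rewrite subr_eq0.
apply: (IH p1 h) => //.
  have [->|p10] := eqVneq p1 0; first by rewrite size_poly0.
  by move: sp; rewrite Ep size_Mmonic ?monicXsubC // size_XsubC addn2.
by apply: (mulIf ya0); rewrite mulrAC -exprSr -E Ep exM exB exX exC.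
Qed.

(* At the node (a, a) the conductor is the maximal ideal: a function vanishing
   on both branches is a polynomial in x and y locally. *)
Lemma node_conductor x y a (P : {poly {poly K}}) h : cpair x y -> a ^+ q = a ->
  (size P <= q.+1)%N -> ev iota x y P = (x - iota a) * h ->
  (forall O, valring iota O -> vmax O (x - iota a) -> vmax O h) -> spec a P = 0.
Proof.
move=> cxy aq sP EP Hh; have cxy' := cpair_translate HP aq cxy.
have [P1 E0] := ev_taylor_at iota x y a P.
have [P2 E1] := ev_taylor_at iota x y a P1.
move: E0 E1 EP; set p := spec a P; set p1 := spec a P1.
set X := x - iota a; set Y := y - iota a => E0 E1 EP.
have X0 : X != 0 by rewrite subr_eq0; apply: cpair_neq cxy.
have ya : y != iota a by apply: cpair_neq (cpair_swap HP cxy).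
have [u Eu] : exists u, ex iota y p1 = iota p1.[a] + Y * ex iota y u.
  exists ((p1 - p1.[a]%:P) %/ ('X - a%:P)).
  have : 'X - a%:P %| p1 - p1.[a]%:P by rewrite dvdp_XsubCl /root !hornerE subrr.
  move/divpK => /(congr1 (ex iota y)); rewrite exM !exB exX !exC -/Y => D.
  by rewrite mulrC D addrC subrK.
have [v Ev] : exists v, ex iota y p = iota p.[a] + Y * ex iota y v.
  exists ((p - p.[a]%:P) %/ ('X - a%:P)).
  have : 'X - a%:P %| p - p.[a]%:P by rewrite dvdp_XsubCl /root !hornerE subrr.
  move/divpK => /(congr1 (ex iota y)); rewrite exM !exB exX !exC -/Y => D.
  by rewrite mulrC D addrC subrK.
(* First branch, where Y / X vanishes: the constant term of [P] is 0, and after division by X every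
   term other than [p1.[a]] vanishes. *)
have p1a : p1.[a] = 0.
  have [O [HO mX mYX]] := place_branch HP cxy'.
  have mh := Hh O HO mX; have Ox := vr_center HO mX; have Oy := center_y HO cxy Ox.
  rewrite -/X -/Y in mX mYX.
  have YE : Y = X * (Y / X) by rewrite mulrC divfK.
  have mY : vmax O Y by rewrite YE; apply: (vmax_mull HO) => //; apply: vmax_in.
  have pa : p.[a] = 0.
    apply: (vmax_const HO).
    have -> : iota p.[a] = X * h - Y * ex iota y v - X * ev iota x y P1.
      by rewrite -EP E0 Ev; ring.
    apply: (vmax_sub HO) => //; last by apply: (vmax_mulr HO) => //; apply: (vr_ev HO).
    apply: (vmax_sub HO) => //; first by apply: (vmax_mulr HO) => //; apply: vmax_in.
    by apply: (vmax_mulr HO) => //; apply: (vr_ex HO).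
  apply: (vmax_const HO).
  have -> : iota p1.[a] = h - (Y / X) * ex iota y v - Y * ex iota y u - X * ev iota x y P2.
    have -> : h = (Y / X) * ex iota y v + ev iota x y P1.
      apply: (mulfI X0); rewrite -EP E0 Ev pa rmorph0; field.
      exact: X0.
    by rewrite E1 Eu; ring.
  apply: (vmax_sub HO) => //; last by apply: (vmax_mulr HO) => //; apply: (vr_ev HO).
  apply: (vmax_sub HO) => //; last by apply: (vmax_mulr HO) => //; apply: (vr_ex HO).
  by apply: (vmax_sub HO) => //; apply: (vmax_mulr HO) => //; apply: (vr_ex HO).
(* Second branch, where X is a multiple of Y^q: now that [p1.[a]] is 0, [p] vanishes at y to order
   greater than q, although its degree is at most q. *)
have [O [s [HO mY Os XE]]] := swapped_branch cxy'; rewrite -/X -/Y in mY XE.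
have mX : vmax O X.
  rewrite XE; apply: (vmax_mulr HO) => //.
  by rewrite -(prednK (q_gt0 HP)); apply: (vmax_expS HO).
have mh := Hh O HO mX; have Ox := vr_center HO mX; have Oy := center_y HO cxy Ox.
apply: (high_order_eq0 (r := q) (h := s * (h - Y * ex iota y u - X * ev iota x y P2)) HO ya mY).
- apply: (vmax_mull HO) => //.
  apply: (vmax_sub HO) => //; last by apply: (vmax_mulr HO) => //; apply: (vr_ev HO).
  by apply: (vmax_sub HO) => //; apply: (vmax_mulr HO) => //; apply: (vr_ex HO).
- exact: leq_trans (size_spec _ _) sP.
- rewrite -/Y mulrA -XE -/p.
  have -> : ex iota y p = X * h - X * ev iota x y P1 by rewrite -EP E0; ring.
  by rewrite E1 Eu p1a rmorph0; ring.
Qed.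

(** The denominator in x is cancelled root by root. Over a root outside F_q the numerator has degree
    at most q in y and vanishes at the q+1 points of the fibre; over a root in F_q the conductor
    applies. *)
Theorem regular_polynomial x y g : cpair x y ->
  (forall O, valring iota O -> O x -> O g) ->
  (forall O a, valring iota O -> a ^+ q = a -> vmax O (x - iota a) -> vmax O g) ->
  exists2 P : {poly {poly K}}, (size P <= q.+1)%N & g = ev iota x y P.
Proof.
move=> cxy Hreg Hnode; have [Fxy Htr Hgen] := cxy.
have Hi (S : {poly {poly K}}) : (size S <= q.+1)%N -> ev iota x y S = 0 -> S = 0.
  exact: (curve_indep HP Htr Fxy).
have F0 : ev iota x y F = 0 by rewrite ev_curve_poly.
have [P [D [D0 sP E]]] := model_repr Htr Hi F0 (size_curve_poly HP) Hgen g.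
move: {2}(size D) (leqnn (size D)) => s.
elim: s P D D0 sP E => [|s IH] P D D0 sP E sD.
  by move: D0; rewrite -size_poly_eq0; case: (size D) sD.
have [/size_poly1P[c c0 Dc]|/closed_rootP[a]] := boolP (size D == 1%N).
  exists (c^-1%:P%:P * P).
    by rewrite size_Cmul // polyC_eq0 invr_eq0.
  by rewrite E Dc evM evCC exC fmorphV mulrC.
case/factor_theorem=> D1 DE.
have D10 : D1 != 0 by apply: contraNneq D0; rewrite DE => ->; rewrite mul0r.
have xa : x - iota a != 0 by rewrite subr_eq0; apply: cpair_neq cxy.
have D1x : ex iota x D1 != 0 by apply: Htr.
have EP : ev iota x y P = (x - iota a) * (g * ex iota x D1).
  rewrite E DE exM exB exX exC; field.
  by rewrite xa D1x.
suff /spec_dvd[P1 P1E] : spec a P = 0.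
  apply: (IH P1 D1) => //.
  - by move: sP; rewrite P1E size_Cmul // polyXsubC_eq0.
  - rewrite E P1E DE evM evC exM !exB exX !exC; field.
    by rewrite xa D1x.
  - by move: sD; rewrite DE size_Mmonic ?monicXsubC // size_XsubC addn2.
have [aq|aq] := eqVneq (a ^+ q) a.
  apply: (node_conductor cxy aq sP EP) => O HO mx.
  by apply: (vmax_mulr HO) => //; [apply: Hnode mx | apply: (vr_ex HO) => //; apply: (vr_center HO mx)].
have [bs [ubs sbs memb]] := curve_fiber HP aq.
apply/eqP; apply: contraT => P0.
have := leq_trans (size_spec a P) sP; rewrite leqNgt -sbs => /negP; case.
apply: (max_poly_roots P0 _ ubs) => //.
apply/allP=> b; rewrite memb => /eqP Fab; apply/rootP.
have [O [HO mx my]] := place_smooth HP cxy aq Fab.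
apply: (vmax_ev0 HO mx my); rewrite EP.
apply: (vmax_mulr HO) => //; have Ox := vr_center HO mx.
by apply: (vr_mul HO) => //; [apply: Hreg | apply: (vr_ex HO)].
Qed.

End RegularFunctions.

(** * The fibres of an automorphism *)

Section Pencil.
Variables (K : closedFieldType) (L : fieldType) (iota : {rmorphism K -> L}).
Variables (q : nat) (m n : K).
Hypothesis HP : curve_params q m n.
Local Notation cpair := (cpair iota q m n).
Local Notation F := (curve_poly q m n).

Lemma ex_sum x (p : {poly K}) N : (size p <= N)%N ->
  ex iota x p = \sum_(i < N) iota p`_i * x ^+ i.
Proof.
move=> sp; rewrite /ex (@horner_coef_wide _ N).
  by apply: eq_bigr => i _; rewrite coef_map.
exact: leq_trans (size_poly _ _) sp.
Qed.

Lemma ex_reverse x (p : {poly K}) N : x != 0 -> (size p <= N.+1)%N ->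
  ex iota x (\poly_(i < N.+1) p`_(N - i)) = x ^+ N * ex iota x^-1 p.
Proof.
move=> x0 sp; rewrite (ex_sum _ (size_poly _ _)) (ex_sum _ sp) mulr_sumr.
rewrite (reindex_inj rev_ord_inj); apply: eq_bigr => i _ /=.
rewrite coef_poly subSS ltnS leq_subr subKn -1?ltnS // mulrCA; congr (_ * _).
have -> : x ^+ N = x ^+ (N - i) * x ^+ i by rewrite -exprD subnK // -ltnS.
by rewrite exprVn mulfK // expf_neq0.
Qed.

(* Compare the constant terms in y after clearing the powers of 1/x. *)
Lemma pole_order_bound x y (P P' : {poly {poly K}}) : cpair x y ->
  (size P <= q.+1)%N -> (size P' <= q.+1)%N ->
  ev iota x y P = x ^+ q * y ^+ q.-1 * ev iota x^-1 y^-1 P' -> (size P <= q)%N.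
Proof.
move=> cxy sP sP' E; have [Fxy Htr Hgen] := cxy.
have q0 := q_gt0 HP.
have x0 : x != 0 by rewrite -(rmorph0 iota); apply: cpair_neq cxy.
have y0 : y != 0 by rewrite -(rmorph0 iota); apply: cpair_neq (cpair_swap HP cxy).
pose N := (\max_(j < q.+1) size (P'`_j)%R)%N.
have sN j : (size (P'`_j)%R <= N.+1)%N.
  have [jq|jq] := ltnP j q.+1; last by rewrite nth_default ?size_poly0 // (leq_trans sP').
  by rewrite ltnW // ltnS (leq_bigmax (Ordinal jq)).
pose R j : {poly K} := \poly_(i < N.+1) (P'`_j)`_(N - i).
pose T : {poly {poly K}} := \poly_(j < q.+1) ('X^q * R (q - j)%N).
(* The missing power of y is supplied by [P * 'X], whose term of degree q+1 is removed with a
   multiple of [F]; the degree is then low enough for independence. [N] bounds the degrees of the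
   coefficients of [P']. *)
pose S := ('X^N)%:P * (P * 'X) - ('X^N * P`_q)%:P * F - T.
have cF : F`_q.+1 = 1 by rewrite -(lead_curve_poly HP) lead_coefE (size_curve_poly HP).
have cF0 : F`_0 = 'X^(q.+1).
  rewrite coef_curve_poly eqxx (_ : (0 == q)%N = false); last by case: (q) q0.
  by rewrite !mulr0 !subr0 mulr1n add0r.
have S0 : S = 0.
  apply: (curve_indep HP Htr Fxy).
    apply/leq_sizeP=> j qj; rewrite !coefB !coefCM coefMX coef_poly ltnNge qj subr0.
    rewrite (_ : (j == 0)%N = false); last by case: j qj.
    move: qj; rewrite leq_eqVlt => /orP[/eqP <-|qj].
      by rewrite cF mulr1 /= subrr.
    have -> : P`_j.-1 = 0 by rewrite nth_default // (leq_trans sP) //; case: j qj.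
    by rewrite [F`_j]nth_default ?(size_curve_poly HP) // !mulr0 subr0.
  rewrite !evB !evM !evC evX ev_curve_poly Fxy mulr0 subr0 exXn exX.
  rewrite (ev_sum _ _ _ (size_poly _ _)).
  apply/eqP; rewrite subr_eq0; apply/eqP; rewrite E.
  transitivity (x ^+ N * x ^+ q * (y ^+ q * ev iota x^-1 y^-1 P')).
    have -> : y ^+ q = y ^+ q.-1 * y by rewrite -exprSr prednK.
    by ring.
  rewrite (ev_sum _ _ _ sP') !mulr_sumr [in RHS](reindex_inj rev_ord_inj).
  apply: eq_bigr => i _ /=; have iq : (i <= q)%N by rewrite -ltnS.
  rewrite coef_poly subSS ltnS leq_subr subKn // exM exXn exX (ex_reverse x0 (sN i)).
  have -> : y ^+ q * (ex iota x^-1 P'`_i * y^-1 ^+ i) = ex iota x^-1 P'`_i * y ^+ (q - i).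
    rewrite -[in y ^+ q](subnK iq) exprD exprVn; field.
    by rewrite expf_neq0.
  by ring.
(* In degree 0 this reads [R q = - X^(N+1) P_q]. The left side has degree at most N, so the leading
   coefficient [P_q] is 0. *)
have := congr1 (fun P : {poly {poly K}} => P`_0) S0.
rewrite coef0 !coefB !coefCM coefMX coef_poly cF0 /= mulr0 sub0r subn0 => /eqP.
rewrite -opprD oppr_eq0 addr_eq0 => /eqP E0.
have Pq0 : P`_q = 0.
  apply/eqP; apply: contraT => Pq.
  have E1 : R q = - ('X^(N.+1) * P`_q).
    apply: (mulfI (_ : 'X^q != 0)); first by rewrite expf_neq0 // polyX_eq0.
    by rewrite mulrN -[LHS]opprK -E0 !exprSr; ring.
  have := size_poly N.+1 (fun i => (P'`_q)`_(N - i)); rewrite -/(R q) E1 size_polyN.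
  rewrite mulrC size_mulXn // -{2}[N.+1]addn0 leq_add2l leqn0 size_poly_eq0.
  by rewrite (negPf Pq).
apply/leq_sizeP=> j; rewrite leq_eqVlt => /orP[/eqP <- //|qj].
by rewrite nth_default // (leq_trans sP).
Qed.

Lemma curveF_diag a : curveF q m n a a = 0 -> a ^+ q = a.
Proof.
rewrite (curveF_cross HP (idfun : {rmorphism K -> K})) /= subrr expr0n mulr0 sub0r.
move/eqP; rewrite oppr_eq0 !mulf_eq0 (negPf (cp_m HP)) orbb subr_eq0.
by move/eqP.
Qed.

Definition lineX (c : K) : {poly {poly K}} := 'X%:P - c%:P%:P.
Definition lineY (c : K) : {poly {poly K}} := 'X - c%:P%:P.

Lemma ev_lineX x y c : ev iota x y (lineX c) = x - iota c.
Proof. by rewrite evB evCX evCC. Qed.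

Lemma ev_lineY x y c : ev iota x y (lineY c) = y - iota c.
Proof. by rewrite evB evX evCC. Qed.

Lemma spec_lineX a b c : (spec a (lineX c)).[b] = a - c.
Proof. by rewrite specB !specC !hornerE. Qed.

Lemma spec_lineY a b c : (spec a (lineY c)).[b] = b - c.
Proof. by rewrite specB specX specC !hornerE. Qed.

Lemma prod_quotient_in O x (I : finType) (A : {set I}) (X : I -> K) k :
  valring iota O -> x != 0 -> O x^-1 -> (#|A| <= k)%N ->
  O ((\prod_(j in A) (x - iota (X j))) * x^-1 ^+ k).
Proof.
move=> HO x0 Ox' Ak; rewrite -(subnK Ak) exprD mulrCA; apply: (vr_mul HO).
  exact: (vr_exp HO).
rewrite -prodr_const -big_split /=.
apply: (big_ind O); [exact: (vr1 HO)|exact: (vr_mul HO)|move=> j _].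
rewrite mulrBl mulfV //; apply: (vr_sub HO); first exact: (vr1 HO).
by apply: (vr_mul HO) => //; apply: (vr_const HO).
Qed.

Variables (x y t : L) (I : finType) (X Y : I -> K).
Hypothesis cxy : cpair x y.
Hypothesis t0 : t != 0.
Hypothesis XYin : forall i, curveF q m n (X i) (Y i) = 0.
Hypothesis Xq : forall i, X i ^+ q != X i.
(** The last clause says that the zeros of [t] are simple: a polynomial vanishing at the centre is a
    multiple of [t] in the valuation ring. *)
Hypothesis t_zeros : forall O, valring iota O -> vmax O t ->
  exists i, [/\ vmax O (x - iota (X i)), vmax O (y - iota (Y i))
    & forall f : {poly {poly K}}, (spec (X i) f).[Y i] = 0 -> O (ev iota x y f / t)].
Hypothesis t_vanish : forall O i, valring iota O ->
  vmax O (x - iota (X i)) -> vmax O (y - iota (Y i)) -> vmax O t.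

(* If a product of lines separated P_i0 from the other zeros of t, then f / t
   would be a section of the canonical system with a single simple pole. *)
Lemma pencil_not_separated (i0 : I) (A B : {set I}) :
  (forall j, j != i0 -> (j \in A) || (j \in B)) ->
  (forall j, j \in A -> X j != X i0) -> (forall j, j \in B -> Y j != Y i0) ->
  (#|A| <= q.-2)%N -> (#|B| <= q.-2)%N -> False.
Proof.
move=> AB AX BY sA sB.
have [Fxy Htr Hgen] := cxy.
have x0 : x != 0 by rewrite -(rmorph0 iota); apply: cpair_neq cxy.
have y0 : y != 0 by rewrite -(rmorph0 iota); apply: cpair_neq (cpair_swap HP cxy).
have cxy' := cpair_inv HP cxy.
pose f : {poly {poly K}} :=
  (\prod_(j in A) lineX (X j)) * \prod_(j in B) lineY (Y j).
have evf : ev iota x y f =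
  (\prod_(j in A) (x - iota (X j))) * \prod_(j in B) (y - iota (Y j)).
  rewrite evM !(big_morph _ (evM iota x y) (ev1 iota x y)); congr (_ * _).
    by apply: eq_bigr => j _; apply: ev_lineX.
  by apply: eq_bigr => j _; apply: ev_lineY.
have spf i : (spec (X i) f).[Y i] =
  (\prod_(j in A) (X i - X j)) * \prod_(j in B) (Y i - Y j).
  rewrite specM !(big_morph _ (specM (X i)) (spec1 (X i))) hornerM !horner_prod.
  congr (_ * _).
    by apply: eq_bigr => j _; apply: spec_lineX.
  by apply: eq_bigr => j _; apply: spec_lineY.
have f_i i : i != i0 -> (spec (X i) f).[Y i] = 0.
  move=> ii0; rewrite spf; apply/eqP; rewrite mulf_eq0.
  by case/orP: (AB i ii0) => iA; apply/orP; [left|right]; apply/prodf_eq0;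
    exists i; rewrite // subrr.
have f_i0 : (spec (X i0) f).[Y i0] != 0.
  rewrite spf mulf_neq0 //; apply/prodf_neq0 => j jA; rewrite subr_eq0 eq_sym.
    exact: AX.
  exact: BY.
have fz O (h : {poly {poly K}}) : valring iota O -> O x ->
    (forall i, vmax O (x - iota (X i)) -> vmax O (y - iota (Y i)) ->
      (spec (X i) h).[Y i] = 0) -> O (ev iota x y h / t).
  move=> HO Ox Hh; have Oy := center_y HP HO cxy Ox.
  have [Ot|nOt] := classic (O t^-1); first by apply: (vr_mul HO) => //; apply: (vr_ev HO).
  have mt : vmax O t by rewrite -[t]invrK; apply: (vmax_inv HO).
  by have [i [mx my]] := t_zeros HO mt; apply; apply: Hh.
(* The first factor cancels the one remaining pole, the last one vanishes at all the nodes. *)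
pose g := (x - iota (X i0)) * (ev iota x y f / t) * (x - y).
have greg O : valring iota O -> O x -> O ((x - iota (X i0)) * (ev iota x y f / t)).
  move=> HO Ox; rewrite mulrA.
  have -> : (x - iota (X i0)) * ev iota x y f = ev iota x y (lineX (X i0) * f).
    by rewrite evM ev_lineX.
  apply: fz => // i _ _; rewrite specM hornerM spec_lineX.
  have [->|ii0] := eqVneq i i0; first by rewrite subrr mul0r.
  by rewrite f_i // mulr0.
have gO O : valring iota O -> O x -> O g.
  move=> HO Ox; have Oy := center_y HP HO cxy Ox.
  by apply: (vr_mul HO); [apply: greg|apply: (vr_sub HO)].
have gm O a : valring iota O -> a ^+ q = a -> vmax O (x - iota a) -> vmax O g.
  move=> HO aq mx; have Ox := vr_center HO mx.
  apply: (vmax_mull HO); first exact: greg.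
  have -> : x - y = (x - iota a) - (y - iota a) by ring.
  by apply: (vmax_sub HO) => //; apply: (center_node HP HO cxy).
have [P sP gP] := regular_polynomial HP cxy gO gm.
(* The same function in the coordinates at infinity, as a section of bidegree (q, q-1): the factor x
   - X_i0 raises the degree in x by one above that of the adjoint system. *)
pose g' := g * (x^-1 ^+ q * y^-1 ^+ q.-1).
have qE : q = q.-2.+2 by case: (q) (cp_q HP) => [|[]].
have g'E : g' = (1 - iota (X i0) * x^-1) *
    (((\prod_(j in A) (x - iota (X j))) * x^-1 ^+ q.-2) *
     ((\prod_(j in B) (y - iota (Y j))) * y^-1 ^+ q.-2) / t) * (y^-1 - x^-1).
  rewrite /g' /g evf qE /= !exprSr.
  field.
  by rewrite x0 y0 t0.
have [g'O g'm] : (forall O, valring iota O -> O x^-1 -> O g') /\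
   (forall O a, valring iota O -> a ^+ q = a -> vmax O (x^-1 - iota a) -> vmax O g').
  have K1 O : valring iota O -> O x^-1 -> O x -> O (x^-1 ^+ q * y^-1 ^+ q.-1).
    move=> HO Ox' Ox; have Oy' := center_y HP HO cxy' Ox'.
    by apply: (vr_mul HO); apply: (vr_exp HO).
  have K2 O : valring iota O -> O x^-1 -> ~ O x -> O ((1 - iota (X i0) * x^-1) *
    (((\prod_(j in A) (x - iota (X j))) * x^-1 ^+ q.-2) *
     ((\prod_(j in B) (y - iota (Y j))) * y^-1 ^+ q.-2) / t)).
    move=> HO Ox' nOx; have Oy' := center_y HP HO cxy' Ox'.
    apply: (vr_mul HO).
      apply: (vr_sub HO); first exact: (vr1 HO).
      by apply: (vr_mul HO) => //; apply: (vr_const HO).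
    apply: (vr_mul HO); first by apply: (vr_mul HO); apply: prod_quotient_in.
    apply: NNPP => nOt; apply: nOx.
    have mt : vmax O t by rewrite -[t]invrK; apply: (vmax_inv HO).
    by have [i [mx _ _]] := t_zeros HO mt; apply: (vr_center HO mx).
  split=> [O HO Ox'|O a HO aq mx'].
    have [Ox|nOx] := classic (O x).
      by apply: (vr_mul HO); [apply: gO|apply: K1].
    rewrite g'E; apply: (vr_mul HO); first exact: K2.
    by apply: (vr_sub HO) => //; apply: (center_y HP HO cxy').
  have Ox' := vr_center HO mx'.
  have [Ox|nOx] := classic (O x).
    apply: (vmax_mulr HO); last exact: K1.
    have a0 : a != 0.
      apply/eqP=> a0; apply: (vmax1 HO); rewrite -(mulfV x0).
      by apply: (vmax_mull HO) => //; move: mx'; rewrite a0 rmorph0 subr0.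
    apply: (gm O a^-1) => //; first by rewrite exprVn aq.
    have ia : iota a != 0 by rewrite fmorph_eq0.
    have -> : x - iota a^-1 = (- x * iota a^-1) * (x^-1 - iota a).
      by rewrite fmorphV; field; rewrite x0 ia.
    apply: (vmax_mull HO) => //; apply: (vr_mul HO); last exact: (vr_const HO).
    exact: (vr_opp HO).
  have mx0 := vmax_inv HO nOx.
  rewrite g'E; apply: (vmax_mull HO); first exact: K2.
  apply: (vmax_sub HO) => //.
  have := center_node HP HO cxy' (frob0 HP); rewrite !rmorph0 !subr0; exact.
have [P' sP' g'P] := regular_polynomial HP cxy' g'O g'm.
have sPq : (size P <= q)%N.
  apply: (pole_order_bound cxy sP sP'); rewrite -gP -g'P /g' !exprVn.
  by field; rewrite !expf_neq0.
(* On the line x = X_i0 the polynomial has degree at most q-1 in y, and it vanishes at the q points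
   of the fibre other than P_i0 because x - X_i0 does while f / t is regular there. *)
have spP : spec (X i0) P = 0.
  have [bs [ubs sbs memb]] := curve_fiber HP (Xq i0).
  apply/eqP; apply: contraT => P0.
  have := leq_trans (size_spec (X i0) P) sPq; rewrite leqNgt => /negP; case.
  have Ybs : Y i0 \in bs by rewrite memb XYin.
  have srem : size (rem (Y i0) bs) = q by rewrite size_rem // sbs.
  rewrite -[X in (X < _)%N]srem; apply: (max_poly_roots P0); last exact: rem_uniq.
  apply/allP=> b; rewrite mem_rem_uniq // !inE memb => /andP[bY /eqP Fb].
  have [O [HO mx my]] := place_smooth HP cxy (Xq i0) Fb.
  have Ox := vr_center HO mx; have Oy := vr_center HO my.
  apply/rootP; apply: (vmax_ev0 HO mx my); rewrite -gP.
  apply: (vmax_mulr HO); last exact: (vr_sub HO).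
  apply: (vmax_mulr HO) => //; apply: fz => // i mxi myi; apply: f_i.
  apply: contraNneq bY => ii0; apply/eqP; apply/eqP; rewrite eq_sym -subr_eq0.
  apply/eqP; apply: (vmax_const HO); rewrite rmorphB -ii0.
  have -> : iota (Y i) - iota b = (y - iota b) - (y - iota (Y i)) by ring.
  exact: (vmax_sub HO).
have [P1 PE] := spec_dvd spP.
have xX : x - iota (X i0) != 0 by rewrite subr_eq0; apply: cpair_neq cxy.
have E1 : ev iota x y f / t * (x - y) = ev iota x y P1.
  apply: (mulfI xX); rewrite mulrA -/g gP PE evM evC exB exX exC //.
have [O [HO mx my]] := place_smooth HP cxy (Xq i0) (XYin i0).
have Ox := vr_center HO mx; have Oy := vr_center HO my.
have mt := t_vanish HO mx my.
(* Now f (x - y) / t is a polynomial, so f (x - y) vanishes at P_i0. But f does not vanish there,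
   and x = y would put P_i0 on the diagonal, over F_q. *)
have : vmax O (ev iota x y f * (x - y)).
  have -> : ev iota x y f * (x - y) = t * ev iota x y P1.
    by rewrite -E1; field.
  by apply: (vmax_mulr HO) => //; apply: (vr_ev HO).
case/(vmax_prime HO) => [||mf|mxy].
- exact: (vr_ev HO).
- exact: (vr_sub HO).
- by move: f_i0; rewrite (vmax_ev0 HO mx my mf) eqxx.
- have XY : X i0 = Y i0.
    apply/eqP; rewrite -subr_eq0; apply/eqP; apply: (vmax_const HO); rewrite rmorphB.
    have -> : iota (X i0) - iota (Y i0) = (x - y) - (x - iota (X i0)) + (y - iota (Y i0)).
      by ring.
    by apply: (vmax_add HO) => //; apply: (vmax_sub HO).
  have := Xq i0; rewrite (curveF_diag (a := X i0)) ?eqxx //.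
  by rewrite {2}XY.
Qed.

End Pencil.

(** * Counting q+1 points with two coordinates *)

Section Separation.
Variables (I : finType) (K : eqType) (q : nat).
Hypothesis q3 : (3 < q)%N.
Hypothesis cI : #|I| = q.+1.

Let same (X : I -> K) i := [set j | (j != i) && (X j == X i)].

(** Points sharing Y with i must go to [A], those sharing X to [B], and the rest [C] is free. [A] is
    filled up to q-2 first; if [C] is not exhausted, at most 2 points are left for [B], which is
    within q-2 since q > 3. *)
Lemma split_others (X Y : I -> K) i : (forall j k, X j = X k -> Y j = Y k -> j = k) ->
  (#|same X i| <= q.-2)%N -> (#|same Y i| <= q.-2)%N ->
  exists A B : {set I}, [/\ forall j, j != i -> (j \in A) || (j \in B),
    forall j, j \in A -> X j != X i, forall j, j \in B -> Y j != Y i,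
    (#|A| <= q.-2)%N & (#|B| <= q.-2)%N].
Proof.
move=> inj sX sY.
pose C := [set j | [&& j != i, X j != X i & Y j != Y i]].
have D j : j != i -> X j == X i -> Y j != Y i.
  by move=> ji /eqP Xj; apply: contraNneq ji => Yj; apply/eqP; apply: inj.
have cC : (#|same X i| + #|same Y i| + #|C| <= q)%N.
  have -> : q = #|[set~ i]| by rewrite cardsC1 cI.
  have d1 : same X i :&: same Y i = set0.
    apply/setP=> j; rewrite !inE; apply/negP => /andP[/andP[ji Xj] /andP[_ Yj]].
    by move: (D j ji Xj); rewrite Yj.
  have d2 : (same X i :|: same Y i) :&: C = set0.
    apply/setP=> j; rewrite !inE; apply/negP => /and3P[/orP[] /andP[ji E] _ /andP[XN YN]].
      by rewrite E in XN.
    by rewrite E in YN.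
  have := cardsUI (same X i) (same Y i); rewrite d1 cards0 addn0 => <-.
  have := cardsUI (same X i :|: same Y i) C; rewrite d2 cards0 addn0 => <-.
  apply/subset_leq_card/subsetP=> j; rewrite !inE -!orbA.
  by case/or3P=> [/andP[]|/andP[]|/and3P[]].
pose r := (q.-2 - #|same Y i|)%N.
pose C1 := [set j in take r (enum C)]; pose C2 := [set j in drop r (enum C)].
have cC1 : (#|C1| <= r)%N.
  rewrite cardsE (leq_trans (card_size _)) // size_take; case: ltnP => //.
have cC2 : (#|C2| <= #|C| - r)%N.
  by rewrite cardsE (leq_trans (card_size _)) // size_drop -cardE.
have C12 j : j \in C -> (j \in C1) || (j \in C2).
  by rewrite !inE -mem_cat cat_take_drop mem_enum inE.
have C1C j : j \in C1 -> j \in C.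
  by rewrite inE => /mem_take; rewrite mem_enum.
have C2C j : j \in C2 -> j \in C.
  by rewrite inE => /mem_drop; rewrite mem_enum.
exists (same Y i :|: C1), (same X i :|: C2); split.
- move=> j ji; rewrite !in_setU.
  case XE: (X j == X i); first by rewrite [j \in same X i]inE ji XE orbT.
  case YE: (Y j == Y i); first by rewrite [j \in same Y i]inE ji YE.
  have : j \in C by rewrite inE ji XE YE.
  by move/C12 => /orP[] ->; rewrite !orbT.
- move=> j; rewrite in_setU => /orP[|/C1C]; last by rewrite inE => /and3P[].
  by rewrite inE => /andP[ji YE]; apply: contraTneq YE => /eqP /(D j ji).
- move=> j; rewrite in_setU => /orP[|/C2C]; last by rewrite inE => /and3P[].
  by rewrite inE => /andP[ji /(D j ji)].
- apply: leq_trans (leq_card_setU _ _).1 _.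
  by apply: leq_trans (leq_add (leqnn _) cC1) _; rewrite /r subnKC.
- apply: leq_trans (leq_card_setU _ _).1 _.
  apply: leq_trans (leq_add (leqnn _) cC2) _.
  by move: cC sX sY q3; rewrite /r; clear; lia.
Qed.

(** The class of i has at least q of the q+1 points, so at most one point j is outside. Such a j
    shares X with nobody and Y with at most one point, since points with equal X differ in Y; as q-2
    > 1, neither class of j is big. *)
Lemma big_class_all (X Y : I -> K) i : (forall j k, X j = X k -> Y j = Y k -> j = k) ->
  (forall j, (q.-2 < #|same X j|)%N \/ (q.-2 < #|same Y j|)%N) ->
  (q.-2 < #|same X i|)%N -> forall j, X j = X i.
Proof.
move=> inj big Xi j; apply/eqP; apply: contraT => Xj.
have ji : j != i by apply: contraNneq Xj => ->.
have all l : l != j -> X l = X i.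
  move=> lj; apply/eqP; apply: contraT => Xl.
  have li : l != i by apply: contraNneq Xl => ->.
  suff : (#|same X i| + 3 <= q.+1)%N by move: Xi; clear; lia.
  have c3 : #|[set i; j; l]| = 3%N.
    by rewrite -setUA cardsU1 cards2 !inE negb_or ![i == _]eq_sym ji li eq_sym lj.
  have := cardsUI (same X i) [set i; j; l].
  have -> : same X i :&: [set i; j; l] = set0.
    apply/setP=> k; rewrite !inE; apply/negP=> /andP[/andP[ki kX]].
    by rewrite (negPf ki) /= => /orP[]/eqP kE; rewrite kE ?(negPf Xj) ?(negPf Xl) in kX.
  by rewrite cards0 addn0 c3 -cI => <-; apply: max_card.
case: (big j) => [|].
  rewrite (_ : same X j = set0) ?cards0 //; apply/setP=> l; rewrite !inE.
  apply/negP=> /andP[/all -> /eqP E]; by rewrite E eqxx in Xj.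
have : (#|same Y j| <= 1)%N.
  apply/card_le1_eqP=> k l; rewrite !inE => /andP[kj /eqP Yk] /andP[lj /eqP Yl].
  by apply: inj; rewrite ?Yk ?Yl ?all.
by move: q3; clear; lia.
Qed.
End Separation.

Lemma collinear_fiber (I : finType) (K : eqType) q (X Y : I -> K) :
  (3 < q)%N -> #|I| = q.+1 ->
  (forall j k, X j = X k -> Y j = Y k -> j = k) ->
  (forall i (A B : {set I}), (forall j, j != i -> (j \in A) || (j \in B)) ->
    (forall j, j \in A -> X j != X i) -> (forall j, j \in B -> Y j != Y i) ->
    (#|A| <= q.-2)%N -> (#|B| <= q.-2)%N -> False) ->
  (forall i j, X i = X j) \/ (forall i j, Y i = Y j).
Proof.
move=> q3 cI inj sep.
pose same (Z : I -> K) i := [set j | (j != i) && (Z j == Z i)].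
have big i : (q.-2 < #|same X i|)%N \/ (q.-2 < #|same Y i|)%N.
  case: (ltnP q.-2 #|same X i|) => [|sX]; first by left.
  case: (ltnP q.-2 #|same Y i|) => [|sY]; first by right.
  have [A [B [AB AX BY cA cB]]] := split_others q3 cI inj sX sY.
  by case: (sep i A B).
have /card_gt0P[i _] : (0 < #|I|)%N by rewrite cI.
have inj' j k : Y j = Y k -> X j = X k -> j = k by move=> a b; apply: inj.
have big' j : (q.-2 < #|same Y j|)%N \/ (q.-2 < #|same X j|)%N by case: (big j); [right|left].
case: (big i) => ci.
  by left=> j k; rewrite (big_class_all q3 cI inj big ci) -(big_class_all q3 cI inj big ci k).
by right=> j k; rewrite (big_class_all q3 cI inj' big' ci) -(big_class_all q3 cI inj' big' ci k).
Qed.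

(** * Values and uniformizers on a generic fibre *)

Section GenericFiber.
Variables (K : closedFieldType) (L : fieldType) (iota : {rmorphism K -> L}).
Variables (q : nat) (m n : K).
Hypothesis HP : curve_params q m n.
Local Notation cpair := (cpair iota q m n).
Local Notation F := (curve_poly q m n).

Lemma vmax_frac O x y a b P (E : {poly K}) : valring iota O ->
  vmax O (x - iota a) -> vmax O (y - iota b) -> E.[a] != 0 -> ex iota x E != 0 ->
  vmax O (ev iota x y P / ex iota x E - iota ((spec a P).[b] / E.[a])).
Proof.
move=> HO mx my Ea Ex.
have iE : iota E.[a] != 0 by rewrite fmorph_eq0.
have Ox := vr_center HO mx; have Oy := vr_center HO my.
have OE' : O (ex iota x E)^-1.
  have [|//] := vr_unit HO (vr_ex HO E Ox).
  move=> mE; case/negP: Ea; apply/eqP; apply: (vmax_const HO).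
  have -> : iota E.[a] = ex iota x E - (ex iota x E - iota E.[a]) by ring.
  by apply: (vmax_sub HO) => //; apply: (vmax_ex HO).
have -> : ev iota x y P / ex iota x E - iota ((spec a P).[b] / E.[a]) =
  ((ev iota x y P - iota (spec a P).[b]) * iota E.[a]
   - iota (spec a P).[b] * (ex iota x E - iota E.[a]))
  * (ex iota x E)^-1 * iota E.[a]^-1.
  by rewrite fmorph_div fmorphV; field; rewrite Ex iE.
apply: (vmax_mulr HO); last exact: (vr_const HO).
apply: (vmax_mulr HO) => //; apply: (vmax_sub HO).
  by apply: (vmax_mulr HO); [apply: (vmax_ev HO)|apply: (vr_const HO)].
by apply: (vmax_mull HO); [apply: (vr_const HO)|apply: (vmax_ex HO)].
Qed.

(** Since b is a simple root of [spec a F], the equation expanded at x = a expresses y - b as a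
    multiple of x - a, with the unit [E(y)] as denominator. *)
Lemma smooth_uniformizer O x y a b P : cpair x y -> valring iota O ->
  vmax O (x - iota a) -> vmax O (y - iota b) -> a ^+ q != a ->
  curveF q m n a b = 0 -> (spec a P).[b] = 0 -> O (ev iota x y P / (x - iota a)).
Proof.
move=> cxy HO mx my aq Fab /eqP/factor_theorem[P2 EP].
have Ox := vr_center HO mx; have Oy := vr_center HO my.
have xa : x - iota a != 0 by rewrite subr_eq0; apply: cpair_neq cxy.
have [E EF Eb] := curve_simple_root HP aq Fab.
have [P1 ->] := ev_taylor_at iota x y a P.
have [F1] := ev_taylor_at iota x y a F.
rewrite ev_curve_poly (cp_eq cxy) EF EP !exM exB exX exC => E0.
have [|Ey OE'] := vr_unit HO (vr_ex HO E Oy).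
  move=> mE; case/negP: Eb; apply/eqP; apply: (vmax_const HO).
  have -> : iota E.[b] = ex iota y E - (ex iota y E - iota E.[b]) by ring.
  by apply: (vmax_sub HO) => //; apply: (vmax_ex HO).
have yb : y - iota b = - (x - iota a) * ev iota x y F1 * (ex iota y E)^-1.
  apply: (mulIf Ey); rewrite mulfVK //; apply/eqP; rewrite -subr_eq0 mulNr opprK.
  by rewrite -E0.
have -> : (ex iota y P2 * (y - iota b) + (x - iota a) * ev iota x y P1) / (x - iota a)
   = ev iota x y P1 - ex iota y P2 * ev iota x y F1 * (ex iota y E)^-1.
  by rewrite yb; field; rewrite xa Ey.
apply: (vr_sub HO); first exact: (vr_ev HO).
apply: (vr_mul HO) => //; apply: (vr_mul HO); [exact: (vr_ex HO)|exact: (vr_ev HO)].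
Qed.

Section Values.
Variables (x y : L) (c : K).
Hypothesis cxy : cpair x y.

Let exn D : D != 0 -> ex iota x D != 0.
Proof. by case: cxy => _ + _; apply. Qed.

Lemma cpair_ker (P : {poly {poly K}}) : ev iota x y P = 0 -> exists Q, P = Q * F.
Proof.
have [Fxy Htr Hgen] := cxy.
apply: (model_ker (r := q.+1)) => //.
- by move=> S; apply: (curve_indep HP Htr Fxy).
- by rewrite ev_curve_poly.
- exact: (size_curve_poly HP).
- exact: (spec_curve_neq0 HP).
Qed.

Lemma cpair_repr z : exists (P : {poly {poly K}}) (D : {poly K}),
  [/\ D != 0, (size P <= q.+1)%N & z = ev iota x y P / ex iota x D].
Proof.
have [Fxy Htr Hgen] := cxy.
apply: (model_repr (G := F)) => //.
- by move=> S; apply: (curve_indep HP Htr Fxy).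
- by rewrite ev_curve_poly.
- exact: (size_curve_poly HP).
Qed.

(** The value of z at (c, b), as a relation because it is read off some fraction; [value_uniq] gives
    independence of the fraction when (c, b) is on the curve. Denominators depend on x alone, so
    regularity is a condition on the whole fibre over c. *)
Definition value (b : K) (z : L) (k : K) := exists P E,
  [/\ E.[c] != 0, z = ev iota x y P / ex iota x E & k = (spec c P).[b] / E.[c]].

Definition regular_at (z : L) := exists P E,
  E.[c] != 0 /\ z = ev iota x y P / ex iota x E.

Lemma regular_value b z : regular_at z -> exists k, value b z k.
Proof. by case=> P [E [Ec ->]]; exists ((spec c P).[b] / E.[c]); exists P, E. Qed.

Let exc E : E.[c] != 0 -> ex iota x E != 0.
Proof. by move=> Ec; apply: exn; apply: contraNneq Ec => ->; rewrite horner0. Qed.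

Section AtPoint.
Variable b : K.
Hypothesis Fcb : curveF q m n c b = 0.

Lemma value_uniq z k k' : value b z k -> value b z k' -> k = k'.
Proof.
case=> P [E [Ec -> ->]] [P' [E' [Ec' EE ->]]].
have Ex := exc Ec; have Ex' := exc Ec'.
have /cpair_ker[Q EQ] : ev iota x y (P * E'%:P - P' * E%:P) = 0.
  rewrite evB !evM !evC; apply/eqP; rewrite subr_eq0; apply/eqP.
  have -> : ev iota x y P = ev iota x y P / ex iota x E * ex iota x E by rewrite divfK.
  by rewrite EE; field.
have := congr1 (fun P => (spec c P).[b]) EQ => /=.
rewrite specB !specM !specC hornerD hornerN !hornerM !hornerC horner_spec_curve Fcb mulr0.
move/eqP; rewrite subr_eq0 => /eqP EE2.
by apply/eqP; rewrite eqr_div //; apply/eqP.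
Qed.

Lemma value_const k : value b (iota k) k.
Proof.
exists k%:P%:P, 1; rewrite hornerC oner_neq0 evCC ex1 divr1; split=> //.
by rewrite specC !hornerC divr1.
Qed.

Lemma value_x : value b x c.
Proof.
exists 'X%:P, 1; rewrite hornerC oner_neq0 evCX ex1 divr1; split=> //.
by rewrite specC hornerX hornerC divr1.
Qed.

Lemma value_y : value b y b.
Proof.
exists 'X, 1; rewrite hornerC oner_neq0 evX ex1 divr1; split=> //.
by rewrite specX hornerX divr1.
Qed.

Lemma value_add z w k l : value b z k -> value b w l -> value b (z + w) (k + l).
Proof.
case=> P [E [Ec -> ->]] [P' [E' [Ec' -> ->]]].
exists (P * E'%:P + P' * E%:P), (E * E'); split.
- by rewrite hornerM mulf_neq0.
- by rewrite addf_div ?exc // evD !evM !evC exM.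
- by rewrite addf_div // specD !specM !specC hornerD !hornerM !hornerC.
Qed.

Lemma value_mul z w k l : value b z k -> value b w l -> value b (z * w) (k * l).
Proof.
case=> P [E [Ec -> ->]] [P' [E' [Ec' -> ->]]].
exists (P * P'), (E * E'); split.
- by rewrite hornerM mulf_neq0.
- by rewrite mulf_div evM exM.
- by rewrite mulf_div specM !hornerM.
Qed.

Lemma value_opp z k : value b z k -> value b (- z) (- k).
Proof.
move=> zk; rewrite -mulN1r -[- k]mulN1r -(rmorph1 iota) -rmorphN.
by apply: value_mul => //; apply: value_const.
Qed.

Lemma value_sub z w k l : value b z k -> value b w l -> value b (z - w) (k - l).
Proof. by move=> zk wl; apply: value_add => //; apply: value_opp. Qed.

Lemma value_exp z k e : value b z k -> value b (z ^+ e) (k ^+ e).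
Proof.
move=> zk; elim: e => [|e IH]; last by rewrite !exprS; apply: value_mul.
by rewrite !expr0 -(rmorph1 iota); apply: value_const.
Qed.

Lemma value_ex z k p : value b z k -> value b (ex iota z p) p.[k].
Proof.
move=> zk; elim/poly_ind: p => [|p l IH].
  by rewrite ex0 horner0 -(rmorph0 iota); apply: value_const.
rewrite exD exM exX exC hornerMXaddC; apply: value_add; last exact: value_const.
exact: value_mul.
Qed.

Lemma value_ev z w k l P : value b z k -> value b w l ->
  value b (ev iota z w P) (spec k P).[l].
Proof.
move=> zk wl; elim/poly_ind: P => [|P p IH].
  by rewrite ev0 spec0 horner0 -(rmorph0 iota); apply: value_const.
rewrite evD evM evX evC specD specM specX specC hornerMXaddC.
by apply: value_add; [apply: value_mul | apply: value_ex].
Qed.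

Lemma value_place O z k : valring iota O -> vmax O (x - iota c) ->
  vmax O (y - iota b) -> value b z k -> vmax O (z - iota k).
Proof.
by move=> HO mx my [P [E [Ec -> ->]]]; apply: vmax_frac => //; apply: exc.
Qed.

Lemma value_unit z k : value b z k -> z != 0 -> regular_at z^-1 -> k != 0.
Proof.
move=> zk z0 /(regular_value b)[l zl]; apply/eqP=> k0.
have := value_uniq (value_mul zk zl); rewrite mulfV // k0 mul0r.
move/(_ 1); rewrite -(rmorph1 iota) => /(_ (value_const 1))/eqP.
by rewrite eq_sym oner_eq0.
Qed.

End AtPoint.
End Values.

Lemma generic_regular x y (zs : seq L) : cpair x y -> exists2 D : {poly K}, D != 0 &
  forall c, D.[c] != 0 -> {in zs, forall z, regular_at x y c z}.
Proof.
move=> cxy; elim: zs => [|z zs [D D0 IH]]; first by exists 1; rewrite ?oner_neq0.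
have [P [E [E0 _ EP]]] := cpair_repr cxy z.
exists (E * D); first by rewrite mulf_neq0.
move=> c; rewrite hornerM mulf_eq0 negb_or => /andP[Ec Dc] w.
rewrite inE => /predU1P[->|]; last exact: IH.
by exists P, E.
Qed.

End GenericFiber.

Section Automorphisms.
Variables (K : closedFieldType) (L : fieldType) (iota : {rmorphism K -> L}).
Variables (q : nat) (m n : K).
Hypothesis HP : curve_params q m n.
Local Notation cpair := (cpair iota q m n).
Local Notation F := (curve_poly q m n).

Lemma rmorph_ex (s : {rmorphism L -> L}) z p : (forall c, s (iota c) = iota c) ->
  s (ex iota z p) = ex iota (s z) p.
Proof.
move=> Hs; elim/poly_ind: p => [|p c IH]; first by rewrite !ex0 rmorph0.
by rewrite !exD !exM !exX !exC rmorphD rmorphM IH Hs.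
Qed.

Lemma rmorph_ev (s : {rmorphism L -> L}) z w P : (forall c, s (iota c) = iota c) ->
  s (ev iota z w P) = ev iota (s z) (s w) P.
Proof.
move=> Hs; elim/poly_ind: P => [|P p IH]; first by rewrite !ev0 rmorph0.
by rewrite !evD !evM !evX !evC rmorphD rmorphM IH rmorph_ex.
Qed.

Variables (s t : {rmorphism L -> L}).
Hypothesis s_fix : forall c, s (iota c) = iota c.
Hypothesis t_fix : forall c, t (iota c) = iota c.
Hypothesis st : cancel s t.
Hypothesis ts : cancel t s.

Lemma valring_pullback O : valring iota O -> valring iota (O \o s).
Proof.
case=> [Oc Ob Om Ot]; split=> /= [c|a b|a b|a].
- by rewrite s_fix.
- by rewrite rmorphB; apply: Ob.
- by rewrite rmorphM; apply: Om.
- by rewrite fmorphV.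
Qed.

Lemma vmax_pullback O w : vmax (O \o s) w <-> vmax O (s w).
Proof.
rewrite /vmax /= fmorphV; split=> -[Ow [w0|nw]]; split=> //; try by right.
  by left; rewrite w0 rmorph0.
by left; move/eqP: w0; rewrite fmorph_eq0 => /eqP.
Qed.

(** The zeros of [s x - c] are the points (X i, Y i), the values of (t x, t y) at the points (c, b
    i). The regularity hypotheses keep every X i outside F_q and off the zeros of the denominators
    of [s x] and [s y], so these zeros are smooth and finite. *)
Lemma generic_fiber_collinear x y c (A B : {poly {poly K}}) (D E : {poly K})
    (U V : {poly {poly K}}) (D1 D2 : {poly K}) : cpair x y -> c ^+ q != c ->
  (size A <= q.+1)%N -> (size B <= q.+1)%N ->
  t x = ev iota x y A / ex iota x D -> t y = ev iota x y B / ex iota x E ->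
  D.[c] != 0 -> E.[c] != 0 -> D1 != 0 -> D2 != 0 ->
  s x = ev iota x y U / ex iota x D1 -> s y = ev iota x y V / ex iota x D2 ->
  regular_at iota x y c (t x ^+ q - t x)^-1 ->
  regular_at iota x y c (ex iota (t x) D1)^-1 ->
  regular_at iota x y c (ex iota (t x) D2)^-1 ->
  (size (spec c A) <= 1)%N \/ (size (spec c B) <= 1)%N.
Proof.
move=> cxy cq sA sB tx ty Dc Ec D10 D20 sx sy regq reg1 reg2.
have [bs [ubs sbs memb]] := curve_fiber HP cq.
have [Fxy Htr Hgen] := cxy.
pose b (i : 'I_q.+1) := bs`_i.
have bbs i : b i \in bs by rewrite mem_nth ?sbs.
have Fb i : curveF q m n c (b i) = 0 by apply/eqP; rewrite -memb.
have b_inj : injective b.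
  by move=> i j /eqP; rewrite nth_uniq ?sbs // => /eqP/val_inj.
pose X i := (spec c A).[b i] / D.[c]; pose Y i := (spec c B).[b i] / E.[c].
have vX i : value iota x y c (b i) (t x) (X i) by exists A, D.
have vY i : value iota x y c (b i) (t y) (Y i) by exists B, E.
have tF : curveF q (iota m) (iota n) (t x) (t y) = 0.
  by rewrite -(t_fix m) -(t_fix n) -rmorph_curveF Fxy rmorph0.
have XYin i : curveF q m n (X i) (Y i) = 0.
  apply: (value_uniq HP cxy (Fb i) (z := 0)); last first.
    by rewrite -(rmorph0 iota); apply: value_const.
  have vm := value_const iota x y c (b i) m; have vn := value_const iota x y c (b i) n.
  rewrite -tF /curveF.
  apply: (value_sub cxy).
    apply: (value_sub cxy).
      by apply: (value_add cxy); apply: value_exp.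
    apply: value_mul => //.
    by apply: (value_add cxy); apply: value_mul => //; apply: value_exp.
  apply: value_mul => //.
  by apply: (value_add cxy); apply: value_mul => //; apply: value_exp.
have t_tr : transcendental_over iota (t x).
  apply/transcendentalP=> k; apply/eqP=> E0.
  have := cpair_neq k cxy; rewrite -(ts x) E0 s_fix eqxx //.
have Xq i : X i ^+ q != X i.
  have vq : value iota x y c (b i) (t x ^+ q - t x) (X i ^+ q - X i).
    by apply: (value_sub cxy) => //; apply: value_exp.
  rewrite -subr_eq0; apply: (value_unit HP cxy (Fb i) vq) => //.
  have : ex iota (t x) ('X^q - 'X) != 0.
    apply: t_tr; rewrite -size_poly_eq0 size_polyDl ?size_polyXn //.
    by rewrite size_polyN size_polyX ltnS; apply: leq_trans (cp_q HP).
  by rewrite exB exXn exX.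
have tex z : t (ex iota x z) = ex iota (t x) z by apply: rmorph_ex.
have tev z : t (ev iota x y z) = ev iota (t x) (t y) z by apply: rmorph_ev.
have D1X i : D1.[X i] != 0.
  apply: (value_unit HP cxy (Fb i) (value_ex cxy D1 (vX i))) => //; exact: t_tr.
have D2X i : D2.[X i] != 0.
  apply: (value_unit HP cxy (Fb i) (value_ex cxy D2 (vX i))) => //; exact: t_tr.
have cE i : (spec (X i) U).[Y i] = c * D1.[X i].
  apply: (value_uniq HP cxy (Fb i)); first exact: (value_ev cxy U (vX i) (vY i)).
  have -> : ev iota (t x) (t y) U = x * ex iota (t x) D1.
    have xE : x = ev iota (t x) (t y) U / ex iota (t x) D1.
      by rewrite -tev -tex -fmorph_div -sx st.
    by rewrite -[LHS](divfK (t_tr D1 D10)) -[(_.[t x])]/(ex iota (t x) D1) -xE.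
  by apply: value_mul; [apply: value_x | apply: (value_ex cxy)].
have bE i : (spec (X i) V).[Y i] = b i * D2.[X i].
  apply: (value_uniq HP cxy (Fb i)); first exact: (value_ev cxy V (vX i) (vY i)).
  have -> : ev iota (t x) (t y) V = y * ex iota (t x) D2.
    have yE : y = ev iota (t x) (t y) V / ex iota (t x) D2.
      by rewrite -tev -tex -fmorph_div -sy st.
    by rewrite -[LHS](divfK (t_tr D2 D20)) -[(_.[t x])]/(ex iota (t x) D2) -yE.
  by apply: value_mul; [apply: value_y | apply: (value_ex cxy)].
(* Evaluating [s y] at (X i, Y i) gives back b i. *)
have XYinj i j : X i = X j -> Y i = Y j -> i = j.
  move=> XE YE; apply: b_inj; apply: (mulIf (D2X i)).
  by rewrite -bE XE YE bE.
pose u := s x - iota c.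
have u0 : u != 0.
  rewrite subr_eq0; apply/eqP=> E0.
  by have := cpair_neq c cxy; rewrite -(st x) E0 t_fix eqxx.
(* Pulling the place back along [s] turns a zero of [s x - c] into a place over x = c, where x - c
   is a uniformizer; both facts are carried back by the automorphism. *)
have u_zeros O : valring iota O -> vmax O u ->
  exists i, [/\ vmax O (x - iota (X i)), vmax O (y - iota (Y i))
    & forall f : {poly {poly K}}, (spec (X i) f).[Y i] = 0 -> O (ev iota x y f / u)].
  move=> HO mu; have HO' := valring_pullback HO.
  have mx : vmax (O \o s) (x - iota c) by apply/vmax_pullback; rewrite rmorphB s_fix.
  have [b0 [Fb0 my]] := center_fiber HP HO' cxy mx.
  have b0bs : b0 \in bs by rewrite memb Fb0.
  have ib : (index b0 bs < q.+1)%N by rewrite -sbs index_mem.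
  exists (Ordinal ib).
  have bi : b (Ordinal ib) = b0 by rewrite /b /= nth_index.
  move: (Ordinal ib) bi => i bi {ib b0bs}.
  rewrite -{}bi in my Fb0; split.
  - have /vmax_pullback := value_place cxy HO' mx my (vX i).
    by rewrite rmorphB s_fix ts.
  - have /vmax_pullback := value_place cxy HO' mx my (vY i).
    by rewrite rmorphB s_fix ts.
  move=> f f0.
  have [P [G [Gc EP fE]]] := value_ev cxy f (vX i) (vY i).
  have Gx : ex iota x G != 0 by apply: Htr; apply: contraNneq Gc => ->; rewrite horner0.
  have P0 : (spec c P).[b i] = 0.
    move/eqP: fE; rewrite f0 eq_sym mulf_eq0 invr_eq0 (negPf Gc) orbF.
    by move/eqP.
  have := smooth_uniformizer HP cxy HO' mx my cq (Fb i) P0.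
  have OG : (O \o s) (ex iota x G)^-1.
    have Ox := vr_center HO' mx.
    have [|//] := vr_unit HO' (vr_ex HO' G Ox).
    move=> mE; case/negP: Gc; apply/eqP; apply: (vmax_const HO').
    have -> : iota G.[c] = ex iota x G - (ex iota x G - iota G.[c]) by ring.
    by apply: (vmax_sub HO') => //; apply: (vmax_ex HO').
  move/(vr_mul HO' OG) => /=.
  have -> : (ex iota x G)^-1 * (ev iota x y P / (x - iota c)) =
    ev iota (t x) (t y) f / (x - iota c) by rewrite EP; ring.
  have -> : s (ev iota (t x) (t y) f / (x - iota c)) = ev iota x y f / u.
    rewrite (fmorph_div s); congr (_ / _); last by rewrite rmorphB s_fix.
    by rewrite (rmorph_ev _ _ _ s_fix) !ts.
  exact: id.
have u_vanish O i : valring iota O ->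
  vmax O (x - iota (X i)) -> vmax O (y - iota (Y i)) -> vmax O u.
  move=> HO mx my.
  have := vmax_frac U HO mx my (D1X i) (Htr D1 D10).
  by rewrite -/(ex iota x D1) -sx cE mulfK.
(* A polynomial of degree at most q in y with one value at q+1 points is constant. *)
have const_of (G : {poly {poly K}}) k : (size G <= q.+1)%N ->
    (forall i, (spec c G).[b i] = k) -> (size (spec c G) <= 1)%N.
  move=> sG Gk; have : spec c G - k%:P = 0.
    apply/eqP; apply: contraT => G0.
    have sGk : (size (spec c G - k%:P)%R <= q.+1)%N.
      apply: leq_trans (size_polyD _ _) _; rewrite geq_max size_polyN.
      rewrite (leq_trans (size_spec _ _)) //=.
      by apply: leq_trans (size_polyC_leq1 _) _.
    move: sGk; rewrite leqNgt -sbs => /negP; case.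
    apply: max_poly_roots => //; apply/allP=> z /(nthP 0)[i ibs <-].
    rewrite sbs in ibs; rewrite /root hornerD hornerN hornerC.
    by rewrite -[bs`_i]/(b (Ordinal ibs)) Gk subrr.
  by move/eqP; rewrite subr_eq0 => /eqP->; apply: size_polyC_leq1.
have sep i A' B' := pencil_not_separated HP cxy u0 XYin Xq u_zeros u_vanish
  (i0 := i) (A := A') (B := B').
case: (collinear_fiber (cp_q HP) (card_ord _) XYinj sep) => [XX|YY]; [left|right].
  apply: (const_of A (X ord0 * D.[c])) => // i.
  by rewrite (XX ord0 i) divfK.
apply: (const_of B (Y ord0 * E.[c])) => // i.
by rewrite (YY ord0 i) divfK.
Qed.

Definition rational_in (x z : L) :=
  exists P D : {poly K}, D != 0 /\ z = ex iota x P / ex iota x D.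

Lemma size1_rational x y (A : {poly {poly K}}) (D : {poly K}) z : D != 0 ->
  (size A <= 1)%N -> z = ev iota x y A / ex iota x D -> rational_in x z.
Proof.
by move=> D0 sA; rewrite (size1_polyC sA) evC => ->; exists A`_0, D.
Qed.

(** If both numerators involved y, a c outside the zeros of their leading coefficients would keep
    them nonconstant on the fibre, against the collinearity of that fibre. *)
Theorem aut_rational x y : cpair x y -> rational_in x (t x) \/ rational_in x (t y).
Proof.
move=> cxy; have [Fxy Htr Hgen] := cxy.
have [A [D [D0 sA tx]]] := cpair_repr HP cxy (t x).
have [B [E [E0 sB ty]]] := cpair_repr HP cxy (t y).
have [U [D1 [D10 _ sx]]] := cpair_repr HP cxy (s x).
have [V [D2 [D20 _ sy]]] := cpair_repr HP cxy (s y).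
have [sA1|sA1] := leqP (size A) 1%N; first by left; apply: size1_rational tx.
have [sB1|sB1] := leqP (size B) 1%N; first by right; apply: size1_rational ty.
exfalso.
have [G G0 Greg] := generic_regular HP
  [:: (t x ^+ q - t x)^-1; (ex iota (t x) D1)^-1; (ex iota (t x) D2)^-1] cxy.
have Xq0 : 'X^q - 'X != 0 :> {poly K}.
  rewrite -size_poly_eq0 size_polyDl ?size_polyXn //.
  by rewrite size_polyN size_polyX ltnS; apply: leq_trans (cp_q HP).
have A0 : A != 0 by rewrite -size_poly_eq0; case: (size A) sA1.
have B0 : B != 0 by rewrite -size_poly_eq0; case: (size B) sB1.
have [c] : exists c, (G * ('X^q - 'X) * D * E * lead_coef A * lead_coef B).[c] != 0.
  by apply: poly_nonroot; rewrite !mulf_neq0 // lead_coef_eq0.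
rewrite !hornerM !mulf_eq0 !negb_or => /andP[/andP[/andP[/andP[/andP[Gc Xc] Dc] Ec] Ac] Bc].
have cq : c ^+ q != c by rewrite -subr_eq0; move: Xc; rewrite !hornerE.
have reg := Greg c Gc.
have big (P : {poly {poly K}}) : (1 < size P)%N -> (lead_coef P).[c] != 0 ->
    (1 < size (spec c P))%N.
  move=> sP Pc; rewrite ltnNge; apply/negP=> sP1; case/negP: Pc.
  rewrite lead_coefE -coef_spec nth_default // (leq_trans sP1) //.
  by case: (size P) sP => [|[]].
case: (generic_fiber_collinear cxy cq sA sB tx ty Dc Ec D10 D20 sx sy).
- by apply: reg; rewrite !inE eqxx.
- by apply: reg; rewrite !inE eqxx orbT.
- by apply: reg; rewrite !inE eqxx !orbT.
- by rewrite leqNgt big.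
- by rewrite leqNgt big.
Qed.

End Automorphisms.

(** * Moebius maps *)

Section RationalAutomorphisms.
Variables (K : closedFieldType) (L : fieldType) (iota : {rmorphism K -> L}).

Lemma poly_avoid (s : seq K) : exists c, c \notin s.
Proof.
have [|c] := @poly_nonroot K (\prod_(z <- s) ('X - z%:P)).
  by rewrite monic_neq0 // monic_prod_XsubC.
by rewrite -[_ == 0]/(root _ c) root_prod_XsubC => cs; exists c.
Qed.

Lemma coprime_repr x z : transcendental_over iota x -> rational_in iota x z ->
  exists P D : {poly K}, [/\ D != 0, coprimep P D & z = ex iota x P / ex iota x D].
Proof.
move=> Htr [P [D [D0 ->]]].
have g0 : gcdp P D != 0 by rewrite gcdp_eq0 negb_and D0 orbT.
have gx : ex iota x (gcdp P D) != 0 by apply: Htr.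
exists (P %/ gcdp P D), (D %/ gcdp P D).
have EP : P %/ gcdp P D * gcdp P D = P by rewrite divpK // dvdp_gcdl.
have ED : D %/ gcdp P D * gcdp P D = D by rewrite divpK // dvdp_gcdr.
have D1 : D %/ gcdp P D != 0 by apply: contraNneq D0 => E; rewrite -ED E mul0r.
split=> //; first by rewrite coprimep_div_gcd // D0 orbT.
have exP : ex iota x P = ex iota x (P %/ gcdp P D) * ex iota x (gcdp P D).
  by rewrite -exM EP.
have exD' : ex iota x D = ex iota x (D %/ gcdp P D) * ex iota x (gcdp P D).
  by rewrite -exM ED.
by rewrite exP exD' -mulf_div mulfV // mulr1.
Qed.

(** The form of degree N attached to [P], evaluated at (A, B): the numerator of P(A / B) over
    B^N. *)
Definition homog (A B : {poly K}) N (P : {poly K}) : {poly K} :=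
  \sum_(i < N.+1) P`_i *: (A ^+ i * B ^+ (N - i)).

Lemma ex_homog x (A B : {poly K}) N (P : {poly K}) : ex iota x B != 0 -> (size P <= N.+1)%N ->
  ex iota x (homog A B N P) =
  ex iota x B ^+ N * ex iota (ex iota x A / ex iota x B) P.
Proof.
move=> B0 sP; rewrite (ex_sum _ _ sP) (big_morph _ (exD iota x) (ex0 iota x)) mulr_sumr.
apply: eq_bigr => i _; rewrite -mul_polyC !exM exC !exXn expr_div_n.
have -> : ex iota x B ^+ N = ex iota x B ^+ (N - i) * ex iota x B ^+ i.
  by rewrite -exprD subnK // -ltnS.
by field; rewrite expf_neq0.
Qed.

Lemma horner_homog (A B : {poly K}) N (P : {poly K}) z k : (size P <= N.+1)%N -> A.[z] = k * B.[z] ->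
  (homog A B N P).[z] = B.[z] ^+ N * P.[k].
Proof.
move=> sP Az; rewrite horner_sum (horner_coef_wide _ sP) mulr_sumr.
apply: eq_bigr => i _; rewrite hornerZ hornerM !horner_exp Az exprMn.
have -> : B.[z] ^+ N = B.[z] ^+ (N - i) * B.[z] ^+ i.
  by rewrite -exprD subnK // -ltnS.
ring.
Qed.

Lemma transcendental_inj x (P Q : {poly K}) : transcendental_over iota x ->
  ex iota x P = ex iota x Q -> P = Q.
Proof.
move=> Htr E; apply/eqP; rewrite -subr_eq0; apply: contraT => /Htr.
by rewrite -[_.[x]]/(ex iota x _) exB E subrr eqxx.
Qed.

(** Since C / E inverts r = A / B, the level r = t0 can only contain the point k, and only simply: A
    - t0 B divides X - k times a polynomial to which it is coprime. *)
Lemma level_linear x (A B C E : {poly K}) k t0 : transcendental_over iota x ->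
  A != 0 -> B != 0 -> coprimep A B -> coprimep C E -> E != 0 ->
  let r := ex iota x A / ex iota x B in
  ex iota r C = x * ex iota r E ->
  C.[t0] = k * E.[t0] -> (size (A - t0 *: B)%R <= 2)%N.
Proof.
move=> Htr A0 B0 cAB cCE E0 r rE t0E.
have Bx : ex iota x B != 0 by apply: Htr.
have : root (C - k *: E) t0 by rewrite /root hornerD hornerN hornerZ t0E subrr.
case/factor_theorem=> W CE.
pose N := maxn (size W) (size E).
have sW : (size W <= N.+1)%N by rewrite leqW // leq_maxl.
have sE : (size E <= N.+1)%N by rewrite leqW // leq_maxr.
have key : (A - t0 *: B) * homog A B N W = B * homog A B N E * ('X - k%:P).
  apply: (transcendental_inj Htr).
  rewrite !exM !exB -!mul_polyC exM !exC exX !ex_homog // -/r.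
  have <- : ex iota x B * (r - iota t0) = ex iota x A - iota t0 * ex iota x B.
    by rewrite /r; field.
  have : ex iota r W * (r - iota t0) = ex iota r E * (x - iota k).
    have := congr1 (ex iota r) CE; rewrite exM !exB -mul_polyC exM !exC exX rE => <-.
    by ring.
  move: (ex iota r W) (ex iota r E) (ex iota x B ^+ N) => w e bN we.
  transitivity (ex iota x B * bN * (w * (r - iota t0))); first by ring.
  by rewrite we; ring.
have Et0 : E.[t0] != 0.
  apply/eqP=> Et0; move: t0E; rewrite Et0 mulr0 => Ct0.
  by have := coprimep_root cCE; move/(_ t0); rewrite /root Ct0 eqxx Et0 eqxx => /(_ isT).
have : A - t0 *: B %| 'X - k%:P.
  rewrite -(@Gauss_dvdpr _ _ (B * homog A B N E)).
    by rewrite -key dvdp_mulIl.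
  apply/Pdiv.ClosedField.root_coprimep => z; rewrite /root hornerD hornerN hornerZ.
  rewrite subr_eq0 => /eqP Az.
  have Bz : B.[z] != 0.
    apply/eqP=> Bz; move: Az; rewrite Bz mulr0 => Az.
    by have := coprimep_root cAB; move/(_ z); rewrite /root Az eqxx Bz eqxx => /(_ isT).
  by rewrite hornerM (horner_homog sE Az) !mulf_neq0 // expf_neq0.
by move/dvdp_leq; rewrite polyXsubC_eq0 size_XsubC; apply.
Qed.

(** Two levels t1 and t2 whose polynomials A - t1 B and A - t2 B have degree at most 1 bound the
    degrees of A and B, because they span both. *)
Lemma rational_moebius x (s t : {rmorphism L -> L}) : transcendental_over iota x ->
  (forall c, t (iota c) = iota c) -> cancel s t ->
  transcendental_over iota (s x) -> transcendental_over iota (t x) ->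
  rational_in iota x (t x) -> rational_in iota x (s x) ->
  exists a b c d, a * d - b * c != 0 /\ t x = moebius iota a b c d x.
Proof.
move=> Htr t_fix st Htrs Htrt /(coprime_repr Htr)[A [B [B0 cAB tx]]].
move=> /(coprime_repr Htr)[C [E [E0 cCE sx]]].
have A0 : A != 0.
  apply: contraTneq isT => A0; move/transcendentalP: Htrt => /(_ 0).
  by rewrite tx A0 ex0 mul0r rmorph0 eqxx.
have rE : ex iota (t x) C = x * ex iota (t x) E.
  have := congr1 t sx; rewrite st fmorph_div !rmorph_ex // => E1.
  by rewrite {2}E1 divfK //; apply: Htrt.
have size1 k : (size (C - k *: E)%R <= 1)%N -> exists l, C = l%:P + k *: E.
  move=> sk; exists (C - k *: E)`_0.
  by rewrite -(size1_polyC sk) subrK.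
(* Two different exceptional values would make C and E constant, and [s x] with them. Every other k
   has a level point t0. *)
have notconst k l : (size (C - k *: E)%R <= 1)%N -> (size (C - l *: E)%R <= 1)%N -> k = l.
  move=> /size1[k' Ek] /size1[l' El]; apply/eqP; apply: contraT => kl.
  have kl0 : l - k != 0 by rewrite subr_eq0 eq_sym.
  have EE : (l - k) *: E = (k' - l')%:P.
    have : k'%:P + k *: E = l'%:P + l *: E by rewrite -Ek -El.
    move=> Eq; rewrite scalerBl polyCB.
    have -> : l *: E = k'%:P + k *: E - l'%:P by rewrite Eq addrAC subrr add0r.
    by move: (k *: E) => u; ring.
  have Ec : E = ((l - k)^-1 * (k' - l'))%:P.
    by rewrite polyCM -EE mul_polyC scalerA mulVf // scale1r.
  move: ((l - k)^-1 * (k' - l')) Ec => w Ec.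
  move/transcendentalP: Htrs => /(_ ((k' + k * w) / w)).
  by rewrite sx Ek Ec -mul_polyC exD exM !exC fmorph_div rmorphD rmorphM eqxx.
have pick (bad : seq K) : exists k t0, [/\ k \notin bad, C.[t0] = k * E.[t0] & E.[t0] != 0].
  have [k kb] : exists k, k \notin bad /\ (1 < size (C - k *: E)%R)%N.
    have [k1 k1b] := poly_avoid bad; have [k2] := poly_avoid (k1 :: bad).
    rewrite inE negb_or => /andP[k21 k2b].
    have [s1|s1] := leqP (size (C - k1 *: E)) 1%N; last by exists k1.
    have [s2|s2] := leqP (size (C - k2 *: E)) 1%N; last by exists k2.
    by rewrite (notconst _ _ s1 s2) eqxx in k21.
  case: kb => kb sk; have /closed_rootP[t0] : size (C - k *: E) != 1%N by rewrite gtn_eqF.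
  rewrite /root hornerD hornerN hornerZ subr_eq0 => /eqP Ct0; exists k, t0; split=> //.
  apply/eqP=> Et0; have := coprimep_root cCE; move/(_ t0).
  by rewrite /root Ct0 Et0 mulr0 eqxx => /(_ isT)/negP; apply.
have [k1 [t1 [_ E1 Et1]]] := pick [::].
have [k2 [t2 [k21 E2 Et2]]] := pick [:: k1].
have t12 : t1 != t2.
  apply: contraNneq k21 => t12; rewrite inE.
  by apply/eqP; apply: (mulIf Et2); rewrite -E2 -t12 E1 t12.
rewrite tx in rE.
have S1 := level_linear Htr A0 B0 cAB cCE E0 rE E1.
have S2 := level_linear Htr A0 B0 cAB cCE E0 rE E2.
have t120 : t2 - t1 != 0 by rewrite subr_eq0 eq_sym.
have BE : B = (t2 - t1)^-1 *: ((A - t1 *: B) - (A - t2 *: B)).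
  have -> : A - t1 *: B - (A - t2 *: B) = (t2 - t1) *: B.
    by rewrite scalerBl; move: (t1 *: B) (t2 *: B) => u v; ring.
  by rewrite scalerA mulVf // scale1r.
have sB : (size B <= 2)%N.
  rewrite BE size_scale ?invr_neq0 // (leq_trans (size_polyD _ _)) //.
  by rewrite geq_max S1 size_polyN S2.
have sA : (size A <= 2)%N.
  rewrite -[A](subrK (t1 *: B)) (leq_trans (size_polyD _ _)) // geq_max S1 /=.
  exact: leq_trans (size_scale_leq _ _) sB.
have lin (P : {poly K}) z : (size P <= 2)%N -> ex iota z P = iota P`_1 * z + iota P`_0.
  move=> sP; rewrite (ex_sum _ _ sP) !big_ord_recl big_ord0 /= addr0 expr0 mulr1 expr1.
  by rewrite addrC.
exists A`_1, A`_0, B`_1, B`_0; split; last by rewrite tx !lin.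
(* A vanishing determinant would make [t x] a constant. *)
apply/eqP=> D0.
move/transcendentalP: Htrt; rewrite tx !lin //.
have [b1|b1] := eqVneq B`_1 0.
  have b0 : B`_0 != 0.
    apply: contraNneq B0 => b0; rewrite -size_poly_eq0 -leqn0; apply/leq_sizeP => j _.
    case: j => [|[|j]] //; apply: nth_default; exact: leq_trans sB _.
  have a1 : A`_1 = 0.
    by move/eqP: D0; rewrite b1 mulr0 subr0 mulf_eq0 (negPf b0) orbF => /eqP.
  by move/(_ (A`_0 / B`_0)); rewrite a1 b1 rmorph0 !mul0r !add0r fmorph_div eqxx.
move/(_ (A`_1 / B`_1)); case/negP; apply/eqP.
have Bx : iota B`_1 * x + iota B`_0 != 0 by rewrite -lin //; apply: Htr.
have ib : iota B`_1 != 0 by rewrite fmorph_eq0.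
rewrite fmorph_div; apply/eqP; rewrite eqr_div //; apply/eqP.
have : iota A`_1 * iota B`_0 = iota A`_0 * iota B`_1.
  by apply/eqP; rewrite -subr_eq0 -!rmorphM -rmorphB D0 rmorph0.
by move=> E3; rewrite mulrDl mulrDr E3; ring.
Qed.

End RationalAutomorphisms.

(** * Places over P^1(F_q) under an automorphism *)

Section SpecialPlaces.
Variables (K : closedFieldType) (L : fieldType) (iota : {rmorphism K -> L}).
Variables (q : nat) (m n : K).
Hypothesis HP : curve_params q m n.
Local Notation cpair := (cpair iota q m n).

(** [be] is the preimage of [al], finite because a - al c is not 0. The two differences are
    associates in the valuation ring, so orders of vanishing can be compared through the map. *)
Lemma moebius_sub O a b c d z al : a * d - b * c != 0 -> a - al * c != 0 ->
  transcendental_over iota z -> valring iota O ->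
  vmax O (moebius iota a b c d z - iota al) ->
  let be := (al * d - b) / (a - al * c) in
  exists u v, [/\ O u, O v, z - iota be = (moebius iota a b c d z - iota al) * u
    & moebius iota a b c d z - iota al = (z - iota be) * v].
Proof.
move=> D0 al0 Htr HO mZ be; have cz := moebius_den_neq0 D0 Htr.
have [cZ zE] := moebiusK D0 cz.
set Z := moebius iota a b c d z in mZ cZ zE *.
have ial : iota a - iota al * iota c != 0.
  by rewrite -rmorphM -rmorphB fmorph_eq0.
have iD : iota a * iota d - iota b * iota c != 0.
  by rewrite -!rmorphM -rmorphB fmorph_eq0.
have Oc k : O (iota k) by apply: (vr_const HO).
have OZ := vr_center HO mZ.
have Oden : O (- iota c * Z + iota a)^-1.
  have Od : O (- iota c * Z + iota a).
    by rewrite -rmorphN; apply: (vr_add HO) => //; apply: (vr_mul HO).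
  have [|//] := vr_unit HO Od.
  move=> mden; case/negP: al0; apply/eqP; apply: (vmax_const HO).
  have -> : iota (a - al * c) = (- iota c * Z + iota a) + iota c * (Z - iota al).
    by rewrite rmorphB rmorphM; ring.
  by apply: (vmax_add HO) => //; apply: (vmax_mull HO).
have E1 : Z - iota al = (z - iota be) * ((iota a - iota al * iota c) / (iota c * z + iota d)).
  rewrite /be fmorph_div !rmorphB !rmorphM /Z /moebius; field.
  by rewrite cz ial.
have E2 : (iota c * z + iota d)^-1 =
  (- iota c * Z + iota a) / (iota a * iota d - iota b * iota c).
  by rewrite /Z /moebius; field; rewrite cz iD.
have Oz : O z.
  rewrite -zE /moebius !rmorphN; apply: (vr_mul HO) => //.
  by rewrite -rmorphN; apply: (vr_add HO) => //; apply: (vr_mul HO).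
have Kc k : O (iota k)^-1 by rewrite -fmorphV.
exists ((iota c * z + iota d) / (iota a - iota al * iota c)),
  ((iota a - iota al * iota c) / (iota c * z + iota d)); split=> //.
- apply: (vr_mul HO); first by apply: (vr_add HO) => //; apply: (vr_mul HO).
  by rewrite -rmorphM -rmorphB.
- rewrite E2; apply: (vr_mul HO); first by rewrite -rmorphM -rmorphB.
  apply: (vr_mul HO); last by rewrite -!rmorphM -rmorphB.
  by rewrite -rmorphN; apply: (vr_add HO) => //; apply: (vr_mul HO).
- by rewrite E1; field; rewrite cz ial.
Qed.

(* Over a point of P^1(F_q) there is a place where x - al vanishes to order q
   at least while y - al is a uniformizer; elsewhere x and y both are. *)
Lemma special_point (s t : {rmorphism L -> L}) x y a b c d a' b' c' d' al :
  cpair x y -> (forall k, s (iota k) = iota k) -> cancel t s ->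
  a * d - b * c != 0 -> a' * d' - b' * c' != 0 ->
  t x = moebius iota a b c d x -> t y = moebius iota a' b' c' d' y ->
  al ^+ q = al -> a - al * c != 0 -> a' - al * c' != 0 ->
  let be := (al * d - b) / (a - al * c) in
  be ^+ q = be /\ (al * d' - b') / (a' - al * c') = be.
Proof.
move=> cxy s_fix ts D0 D0' tx ty alq al0 al0' be.
have [Fxy Htr Hgen] := cxy; have [_ Htr' _] := cpair_swap HP cxy.
have [O [w [HO my Ow xE]]] := swapped_branch HP (cpair_translate HP alq cxy).
have HO' := valring_pullback s_fix HO.
have sx : s (moebius iota a b c d x - iota al) = x - iota al.
  by rewrite rmorphB s_fix -tx ts.
have sy : s (moebius iota a' b' c' d' y - iota al) = y - iota al.
  by rewrite rmorphB s_fix -ty ts.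
have myt : vmax (O \o s) (moebius iota a' b' c' d' y - iota al).
  by apply/vmax_pullback; rewrite sy.
have q0 := q_gt0 HP.
have mxt : vmax (O \o s) (moebius iota a b c d x - iota al).
  apply/vmax_pullback; rewrite sx xE; apply: (vmax_mulr HO) => //.
  by rewrite -(prednK q0); apply: (vmax_expS HO).
have [u [v [Ou Ov E1 E2]]] := moebius_sub D0 al0 Htr HO' mxt.
have [u' [v' [Ou' Ov' E1' E2']]] := moebius_sub D0' al0' Htr' HO' myt.
set ga := (al * d' - b') / (a' - al * c') in E1' E2' *.
rewrite -/be in E1 E2.
have Otw : (O \o s) (t w) by rewrite /= ts.
have tE : moebius iota a b c d x - iota al =
    (moebius iota a' b' c' d' y - iota al) ^+ q * t w.
  by apply: (fmorph_inj s); rewrite rmorphM rmorphXn ts sx sy.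
have mx : vmax (O \o s) (x - iota be) by rewrite E1; apply: (vmax_mulr HO').
have my' : vmax (O \o s) (y - iota ga) by rewrite E1'; apply: (vmax_mulr HO').
(* Otherwise the centre is a smooth point and y - ga is a multiple of x - be. But x - be is a
   multiple of (y - ga)^q, hence of (x - be)^q, which is absurd for q > 1. *)
have beq : be ^+ q = be.
  apply/eqP; apply: contraT => beq.
  have Fbg : curveF q m n be ga = 0.
    rewrite -horner_spec_curve; apply: (vmax_ev0 HO' mx my').
    by rewrite ev_curve_poly Fxy; apply: (vmax0 HO').
  have xb : x - iota be != 0 by rewrite subr_eq0; apply: cpair_neq cxy.
  have Og : (O \o s) ((y - iota ga) / (x - iota be)).
    rewrite -(ev_lineY iota x); apply: (smooth_uniformizer HP cxy HO' mx my') => //.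
    by rewrite spec_lineY subrr.
  case: (vmax1 HO').
  have -> : 1 = (x - iota be) ^+ q.-1 * (((y - iota ga) / (x - iota be)) ^+ q * v' ^+ q * t w * u).
    apply: (mulfI xb); rewrite mulr1 {1}E1 tE E2' exprMn.
    rewrite expr_div_n -[in (x - iota be) ^+ q](prednK q0) exprS; field.
    by rewrite xb expf_neq0.
  have q1 : (0 < q.-1)%N by case: (q) (cp_q HP) => [|[]].
  apply: (vmax_mulr HO').
    by rewrite -(prednK q1); apply: (vmax_expS HO').
  apply: (vr_mul HO') => //; apply: (vr_mul HO') => //.
  by apply: (vr_mul HO'); apply: (vr_exp HO').
split=> //; apply/eqP; rewrite -subr_eq0; apply/eqP; apply: (vmax_const HO').
have -> : iota (ga - be) = (y - iota be) - (y - iota ga) by rewrite rmorphB; ring.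
by apply: (vmax_sub HO') => //; apply: (center_node HP HO' cxy beq mx).
Qed.

Lemma three_points_eq (a b c d a' b' c' d' : K) (bs : seq K) : uniq bs ->
  (2 < size bs)%N ->
  (forall z, z \in bs -> (a * z + b) * (c' * z + d') = (a' * z + b') * (c * z + d)) ->
  [/\ a * c' = a' * c, a * d' + b * c' = a' * d + b' * c & b * d' = b' * d].
Proof.
move=> ubs sbs H.
pose P : {poly K} := Poly [:: b * d' - b' * d; a * d' + b * c' - (a' * d + b' * c);
  a * c' - a' * c].
have P0 : P = 0.
  apply/eqP; apply: contraT => P0.
  have : (size P <= 3)%N by apply: leq_trans (size_Poly _) _.
  rewrite leqNgt => /negP; case; apply: leq_ltn_trans sbs _.
  apply: max_poly_roots => //; apply/allP=> z /H Hz; rewrite /root /P horner_Poly /=.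
  apply/eqP; transitivity ((a * z + b) * (c' * z + d') - (a' * z + b') * (c * z + d)).
    by ring.
  by rewrite Hz subrr.
have C i : (Poly [:: b * d' - b' * d; a * d' + b * c' - (a' * d + b' * c);
  a * c' - a' * c])`_i = 0 by rewrite -/P P0 coef0.
have := C 0%N; have := C 1%N; have := C 2%N; rewrite !coef_Poly /=.
by move=> /subr0_eq -> /subr0_eq -> /subr0_eq ->.
Qed.

(** The equations say that the matrix and its Frobenius conjugate define the same Moebius map.
    Normalizing an entry to 1, c if it is nonzero and d otherwise, makes the conjugates equal. *)
Lemma frob_projective (a b c d : K) : a * d - b * c != 0 ->
  a * c ^+ q = a ^+ q * c -> a * d ^+ q + b * c ^+ q = a ^+ q * d + b ^+ q * c ->
  b * d ^+ q = b ^+ q * d ->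
  exists k, k != 0 /\ [/\ (k * a) ^+ q = k * a, (k * b) ^+ q = k * b,
    (k * c) ^+ q = k * c & (k * d) ^+ q = k * d].
Proof.
move=> D0 E1 E2 E3; have q0 := q_gt0 HP.
have [c0|c0] := eqVneq c 0.
  have d0 : d != 0 by apply: contraNneq D0 => ->; rewrite c0 !mulr0 subrr.
  exists d^-1; rewrite invr_eq0 d0; split=> //.
  have dq : d ^+ q != 0 by rewrite expf_neq0.
  rewrite c0 (frob0 HP) !mulr0 !addr0 in E2.
  rewrite ![d^-1 * _]mulrC !expr_div_n c0 (frob0 HP) !mul0r !divff //; split=> //.
    by apply/eqP; rewrite eqr_div // E2.
  by apply/eqP; rewrite eqr_div // E3.
exists c^-1; rewrite invr_eq0 c0; split=> //.
have cq : c ^+ q != 0 by rewrite expf_neq0.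
rewrite ![c^-1 * _]mulrC (divff c0) expr1n.
have Aq : (a / c) ^+ q = a / c.
  by rewrite expr_div_n; apply/eqP; rewrite eqr_div // E1.
have F2 : (a / c) * (d / c) ^+ q + b / c = (a / c) * (d / c) + (b / c) ^+ q.
  rewrite -{2}Aq !expr_div_n.
  transitivity ((a * d ^+ q + b * c ^+ q) / (c * c ^+ q)); first by field; rewrite c0 cq.
  by rewrite E2; field; rewrite c0 cq.
have F3 : (b / c) * (d / c) ^+ q = (b / c) ^+ q * (d / c).
  transitivity ((b * d ^+ q) / (c * c ^+ q)).
    by rewrite !expr_div_n; field; rewrite c0 cq.
  by rewrite E3 !expr_div_n; field; rewrite c0 cq.
have D1 : (a / c) * (d / c) - b / c != 0.
  have -> : (a / c) * (d / c) - b / c = (a * d - b * c) / (c * c) by field.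
  by rewrite mulf_neq0 // invr_eq0 mulf_neq0.
have Dq : (d / c) ^+ q = d / c.
  apply/eqP; rewrite -subr_eq0 -(inj_eq (mulfI D1)) mulr0; apply/eqP.
  transitivity ((d / c) * ((a / c) * (d / c) ^+ q + b / c - ((a / c) * (d / c) + (b / c) ^+ q))
     - ((b / c) * (d / c) ^+ q - (b / c) ^+ q * (d / c))); first by ring.
  by rewrite F2 F3 !subrr mulr0 subrr.
by split=> //; move: F2; rewrite Dq => /addrI/esym.
Qed.

(* Three points of P^1(F_q), mapped into P^1(F_q) in the same way by both
   components, determine the two matrices up to a scalar. *)
Theorem moebius_over_Fq (s t : {rmorphism L -> L}) x y (fq : seq K) :
  uniq fq -> (4 < size fq)%N -> (forall k, k \in fq -> k ^+ q = k) ->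
  cpair x y -> (forall k, s (iota k) = iota k) -> cancel t s ->
  (exists a b c d, a * d - b * c != 0 /\ t x = moebius iota a b c d x) ->
  (exists a b c d, a * d - b * c != 0 /\ t y = moebius iota a b c d y) ->
  exists a b c d, [/\ a * d - b * c != 0,
    [/\ a ^+ q = a, b ^+ q = b, c ^+ q = c & d ^+ q = d],
    t x = moebius iota a b c d x & t y = moebius iota a b c d y].
Proof.
move=> ufq sfq fqP cxy s_fix ts [a [b [c [d [D0 tx]]]]] [a' [b' [c' [d' [D0' ty]]]]].
have [_ Htr _] := cxy; have [_ Htr' _] := cpair_swap HP cxy.
(* The images of infinity under the two maps, whose preimages are not finite. With at least five
   elements in [fq], three remain for the comparison of the matrices. *)
pose bad := [:: a / c; a' / c'].
pose als := [seq k <- fq | k \notin bad].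
have sals : (2 < size als)%N.
  have : (size fq <= size (bad ++ als))%N.
    apply: uniq_leq_size => // k kfq; rewrite mem_cat mem_filter kfq andbT.
    by case: (k \in bad).
  by rewrite size_cat /= => /(leq_trans sfq).
have als0 k : k \in als -> [/\ k ^+ q = k, a - k * c != 0 & a' - k * c' != 0].
  rewrite mem_filter !inE negb_or => /andP[/andP[k1 k2] /fqP kq]; split=> //.
    apply/eqP=> /subr0_eq E; have [c0|c0] := eqVneq c 0.
      by move: D0; rewrite E c0 mulr0 mul0r mulr0 subrr eqxx.
    by move: k1; rewrite E mulfK // eqxx.
  apply/eqP=> /subr0_eq E; have [c0|c0] := eqVneq c' 0.
    by move: D0'; rewrite E c0 mulr0 mul0r mulr0 subrr eqxx.
  by move: k2; rewrite E mulfK // eqxx.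
pose be k := (k * d - b) / (a - k * c).
have beP k : k \in als -> [/\ be k ^+ q = be k, a * be k + b = k * (c * be k + d)
   & a' * be k + b' = k * (c' * be k + d')].
  move=> /als0 [kq k0 k0'].
  have [bq E] := special_point cxy s_fix ts D0 D0' tx ty kq k0 k0'.
  rewrite -/(be k) in bq E; split=> //; first by rewrite /be; field.
  by rewrite -E; field.
have den k : k \in als -> c * be k + d != 0.
  move=> kals; have [bq E _] := beP k kals; apply/eqP=> E0; case/negP: D0.
  rewrite E0 mulr0 in E; apply/eqP.
  have -> : a * d - b * c = a * (c * be k + d) - c * (a * be k + b) by ring.
  by rewrite E0 E !mulr0 subrr.
have be_inj : {in als &, injective be}.
  move=> k l kals lals E; apply: (mulIf (den k kals)).
  by have [_ <- _] := beP k kals; have [_] := beP l lals; rewrite -E => <-.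
have ubes : uniq (map be als) by rewrite map_inj_in_uniq // filter_uniq.
have sbes : (2 < size (map be als))%N by rewrite size_map.
have fD := frobD (cp_frob HP) (idfun : {rmorphism K -> K}).
(* Both [be k] and its image k are in F_q, so the Frobenius conjugate of the matrix takes the same
   values at three points. *)
have [e1 e2 e3] : [/\ a * c ^+ q = a ^+ q * c,
    a * d ^+ q + b * c ^+ q = a ^+ q * d + b ^+ q * c & b * d ^+ q = b ^+ q * d].
  apply: (three_points_eq ubes sbes) => z /mapP[k kals ->].
  have [bq E _] := beP k kals; have [kq _ _] := als0 k kals.
  move: (be k) bq E => w bq E.
  have : (a * w + b) ^+ q = (k * (c * w + d)) ^+ q by rewrite E.
  by rewrite !exprMn !fD !exprMn bq kq E => ->; ring.
have [f1 f2 f3] : [/\ a * c' = a' * c, a * d' + b * c' = a' * d + b' * c & b * d' = b' * d].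
  apply: (three_points_eq ubes sbes) => z /mapP[k kals ->].
  by have [_ -> ->] := beP k kals; ring.
have [k [k0 [ka kb kc kd]]] := frob_projective D0 e1 e2 e3.
have ik : iota k != 0 by rewrite fmorph_eq0.
have scale z : transcendental_over iota z ->
    moebius iota (k * a) (k * b) (k * c) (k * d) z = moebius iota a b c d z.
  move=> Hz; have cz := moebius_den_neq0 D0 Hz.
  by rewrite /moebius !rmorphM -!mulrA -!mulrDr -mulf_div divff // mul1r.
exists (k * a), (k * b), (k * c), (k * d); split=> //.
- have -> : k * a * (k * d) - k * b * (k * c) = k * k * (a * d - b * c) by ring.
  by rewrite !mulf_neq0.
- by rewrite scale.
rewrite scale // ty /moebius.
have cy := moebius_den_neq0 D0 Htr'; have cy' := moebius_den_neq0 D0' Htr'.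
apply/eqP; rewrite eqr_div //; apply/eqP.
have g1 : iota a * iota c' = iota a' * iota c by rewrite -!rmorphM f1.
have g2 : iota a * iota d' + iota b * iota c' = iota a' * iota d + iota b' * iota c.
  by rewrite -!rmorphM -!rmorphD f2.
have g3 : iota b * iota d' = iota b' * iota d by rewrite -!rmorphM f3.
transitivity ((iota a' * iota c) * y ^+ 2 + (iota a' * iota d + iota b' * iota c) * y
   + iota b' * iota d); first by ring.
by rewrite -g1 -g2 -g3; ring.
Qed.

End SpecialPlaces.

(** * Construction of automorphisms *)

Section KAutomorphisms.
Variables (K L : fieldType) (iota : {rmorphism K -> L}).

Lemma isKAut_rmorphism (s : L -> L) : isKAut iota s ->
  exists f : {rmorphism L -> L}, (f : L -> L) = s.
Proof.
case=> sD sM s1 _ _.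
have s0 : s 0 = 0 by apply: (addrI (s 0)); rewrite -sD !addr0.
have sB : zmod_morphism s.
  by move=> a b; apply: (addIr (s b)); rewrite -sD !subrK.
have sMM : monoid_morphism s by split.
pose Z := GRing.isZmodMorphism.Build L L s sB.
pose M := GRing.isMonoidMorphism.Build L L s sMM.
pose f : {rmorphism L -> L} := HB.pack s Z M.
by exists f.
Qed.

Lemma isKAut_fix (s : L -> L) : isKAut iota s -> forall c, s (iota c) = iota c.
Proof. by case. Qed.

Lemma isKAut_id : isKAut iota id.
Proof. by split=> //; exists id. Qed.

Lemma isKAut_comp s s' : isKAut iota s -> isKAut iota s' -> isKAut iota (s \o s').
Proof.
case=> sD sM s1 sbij sfix [sD' sM' s1' sbij' sfix']; split=> /=.
- by move=> a b; rewrite sD' sD.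
- by move=> a b; rewrite sM' sM.
- by rewrite s1' s1.
- exact: bij_comp.
- by move=> c; rewrite sfix' sfix.
Qed.

Lemma isKAut_inv s : isKAut iota s ->
  exists s', [/\ isKAut iota s', cancel s s' & cancel s' s].
Proof.
case=> sD sM s1 [s' ss' s's] sfix; exists s'; split=> //; split.
- by move=> a b; apply: (can_inj ss'); rewrite sD !s's.
- by move=> a b; apply: (can_inj ss'); rewrite sM !s's.
- by rewrite -s1 ss'.
- by exists s.
- by move=> c; rewrite -{1}(sfix c) ss'.
Qed.

Lemma isKAut_eq x y s s' : generated_by iota x y -> isKAut iota s ->
  isKAut iota s' -> s x = s' x -> s y = s' y -> s = s'.
Proof.
move=> Hgen Hs Hs' Ex Ey; apply: functional_extensionality.
have sf := isKAut_fix Hs; have sf' := isKAut_fix Hs'.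
have [f fE] := isKAut_rmorphism Hs; have [g gE] := isKAut_rmorphism Hs'.
apply: (Hgen (fun z => s z = s' z)) => //.
- by move=> c; rewrite sf sf'.
- by rewrite -fE -gE => a b Ea Eb; rewrite !rmorphD Ea Eb.
- by rewrite -fE -gE => a Ea; rewrite !rmorphN Ea.
- by rewrite -fE -gE => a b Ea Eb; rewrite !rmorphM Ea Eb.
- by rewrite -fE -gE => a Ea; rewrite !fmorphV Ea.
Qed.
End KAutomorphisms.

Section Extension.
Variables (K : closedFieldType) (L : fieldType) (iota : {rmorphism K -> L}).
Variables (q : nat) (m n : K).
Hypothesis HP : curve_params q m n.
Local Notation cpair := (cpair iota q m n).
Local Notation F := (curve_poly q m n).

Lemma cpair_transfer x y x' y' P : cpair x y -> cpair x' y' ->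
  ev iota x y P = 0 -> ev iota x' y' P = 0.
Proof.
move=> cxy cxy' /(cpair_ker HP cxy)[Q ->].
by rewrite evM ev_curve_poly (cp_eq cxy') mulr0.
Qed.

(** Both pairs satisfy exactly the multiples of [F], so sending P(x, y) / Q(x, y) to P(x', y') /
    Q(x', y') is a functional relation, and a function is chosen from it. *)
Lemma cpair_hom x y x' y' : cpair x y -> cpair x' y' ->
  exists s : L -> L, [/\ (forall a b, s (a + b) = s a + s b),
    (forall a b, s (a * b) = s a * s b), s 1 = 1,
    (forall c, s (iota c) = iota c) & s x = x' /\ s y = y'].
Proof.
move=> cxy cxy'; have [Fxy Htr Hgen] := cxy.
have neq0 P : ev iota x y P != 0 -> ev iota x' y' P != 0.
  by apply: contra_neq; apply: cpair_transfer.
pose R z w := exists P Q, [/\ ev iota x y Q != 0,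
  z = ev iota x y P / ev iota x y Q & w = ev iota x' y' P / ev iota x' y' Q].
have total z : exists w, R z w.
  have [P [Q [Q0 zE]]] := model_frac Hgen z.
  by exists (ev iota x' y' P / ev iota x' y' Q), P, Q.
have func z w w' : R z w -> R z w' -> w = w'.
  case=> P [Q [Q0 zE ->]] [P' [Q' [Q'0 zE' ->]]].
  apply/eqP; rewrite eqr_div ?neq0 // -!evM -subr_eq0 -evB; apply/eqP.
  apply: (cpair_transfer cxy cxy'); rewrite evB !evM; apply/eqP.
  by rewrite subr_eq0 -eqr_div // -zE -zE'.
have RP P : R (ev iota x y P) (ev iota x' y' P).
  by exists P, 1; rewrite !ev1 oner_neq0 !divr1.
have [s sR] : exists s, forall z, R z (s z).
  exists (fun z => proj1_sig (constructive_indefinite_description _ (total z))).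
  by move=> z; apply: proj2_sig.
exists s; split.
- move=> a b; apply: (func (a + b)); first exact: sR.
  have [P [Q [Q0 -> ->]]] := sR a; have [P' [Q' [Q'0 -> ->]]] := sR b.
  exists (P * Q' + P' * Q), (Q * Q').
  by rewrite !addf_div ?neq0 // !evD !evM; split=> //; rewrite mulf_neq0.
- move=> a b; apply: (func (a * b)); first exact: sR.
  have [P [Q [Q0 -> ->]]] := sR a; have [P' [Q' [Q'0 -> ->]]] := sR b.
  exists (P * P'), (Q * Q').
  by rewrite !mulf_div ?neq0 // !evM; split=> //; rewrite mulf_neq0.
- by apply: (func _ _ _ (sR 1)); have := RP 1; rewrite !ev1.
- by move=> c; apply: (func _ _ _ (sR _)); have := RP c%:P%:P; rewrite !evCC.
split.
  by apply: (func _ _ _ (sR _)); have := RP 'X%:P; rewrite !evCX.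
by apply: (func _ _ _ (sR _)); have := RP 'X; rewrite !evX.
Qed.

Lemma cpair_aut x y x' y' : cpair x y -> cpair x' y' ->
  exists s, [/\ isKAut iota s, s x = x' & s y = y'].
Proof.
move=> cxy cxy'.
have fixed (f : L -> L) u v : cpair u v -> (forall a b, f (a + b) = f a + f b) ->
    (forall a b, f (a * b) = f a * f b) -> f 1 = 1 -> (forall c, f (iota c) = iota c) ->
    f u = u -> f v = v -> forall z, f z = z.
  move=> [_ _ Hgen] fD fM f1 fc fu fv; apply: Hgen => //.
  - by move=> a b Ea Eb; rewrite fD Ea Eb.
  - move=> a Ea; apply: (addrI a); rewrite -{1}Ea -fD !subrr.
    by rewrite -(rmorph0 iota) fc.
  - by move=> a b Ea Eb; rewrite fM Ea Eb.
  - move=> a Ea; have [->|a0] := eqVneq a 0.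
      by rewrite invr0 -(rmorph0 iota) fc.
    by apply: (mulfI a0); rewrite -{1}Ea -fM mulfV.
have [s [sD sM s1 sc [sx sy]]] := cpair_hom cxy cxy'.
have [t [tD tM t1 tc [tx ty]]] := cpair_hom cxy' cxy.
have st : cancel s t.
  apply: (fixed (t \o s) x y) => //=.
  - by move=> a b; rewrite sD tD.
  - by move=> a b; rewrite sM tM.
  - by rewrite s1 t1.
  - by move=> c; rewrite sc tc.
  - by rewrite sx tx.
  - by rewrite sy ty.
have ts : cancel t s.
  apply: (fixed (s \o t) x' y') => //=.
  - by move=> a b; rewrite tD sD.
  - by move=> a b; rewrite tM sM.
  - by rewrite t1 s1.
  - by move=> c; rewrite tc sc.
  - by rewrite tx sx.
  - by rewrite ty sy.
by exists s; split=> //; split=> //; exists t.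
Qed.

End Extension.

(** * Embedding an abstract finite field into K *)

Section FiniteFieldEmbedding.

Lemma prime_field_hom (R : nzRingType) p : p \in [pchar R] ->
  exists f : {rmorphism 'F_p -> R}, True.
Proof.
move=> pR; pose f : {rmorphism 'F_p -> pPrimeCharType pR} :=
  GRing.in_alg (pPrimeCharType pR).
by exists f.
Qed.

Lemma finField_generator (F : finFieldType) :
  exists th : F, forall a, a != 0 -> exists i, a = th ^+ i.
Proof.
have /cyclicP[u E] := field_unit_group_cyclic [set: {unit F}]%G.
exists (FinRing.uval u) => a a0.
have ua : a \is a GRing.unit by rewrite unitfE.
have : FinRing.unit F ua \in <[u]>%g by rewrite -E inE.
case/cycleP=> i Ei; exists i; move/(congr1 val): Ei => /= ->.
by rewrite FinRing.val_unitX.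
Qed.

Lemma annihilator_generator (k : fieldType) (R : fieldType) (f : {rmorphism k -> R}) (th : R)
    (P0 : {poly k}) : P0 != 0 -> (map_poly f P0).[th] = 0 ->
  exists2 m : {poly k}, (map_poly f m).[th] = 0 &
    m != 0 /\ forall Q : {poly k}, (map_poly f Q).[th] = 0 -> m %| Q.
Proof.
move: {2}(size P0) (leqnn (size P0)) => s; elim: s P0 => [|s IH] P0 sP P00 P0th.
  by move: P00; rewrite -size_poly_eq0; case: (size P0) sP.
have [[P1 [P1s P10 P1th]]|min] := excluded_middle_informative
  (exists P1 : {poly k}, [/\ (size P1 < size P0)%N, P1 != 0 & (map_poly f P1).[th] = 0]).
  by apply: (IH P1) => //; rewrite -ltnS; apply: leq_trans sP.
exists P0 => //; split=> // Q Qth; rewrite /dvdp; apply: contraT => Q0; case: min.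
exists (Q %% P0); split=> //; first by rewrite ltn_modp.
have := congr1 (fun P => (map_poly f P).[th]) (divp_eq Q P0) => /=.
by rewrite rmorphD rmorphM /= hornerD hornerM P0th mulr0 add0r Qth.
Qed.

(** A generator [th] of the multiplicative group is sent to a root in [K] of its minimal polynomial
    over the prime field; every element of [F] is 0 or a power of [th]. *)
Lemma finField_embedding (F : finFieldType) (K : closedFieldType) p :
  p \in [pchar F] -> p \in [pchar K] -> exists f : {rmorphism F -> K}, True.
Proof.
move=> pF pK; have [f _] := prime_field_hom pF; have [g _] := prime_field_hom pK.
have [th thP] := finField_generator F.
have [||m mth [m0 mP]] := @annihilator_generator 'F_p F f th ('X^#|F| - 'X).
- rewrite -size_poly_eq0 size_polyDl ?size_polyXn //.
  by rewrite size_polyN size_polyX ltnS finRing_gt1.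
- by rewrite rmorphB /= map_polyXn map_polyX !hornerE expf_card subrr.
have [ze ze0] : exists ze : K, root (map_poly g m) ze.
  apply/closed_rootP; rewrite size_map_poly; apply/negP=> /size_poly1P[c c0 mc].
  by move/eqP: mth; rewrite mc map_polyC hornerC fmorph_eq0 (negPf c0).
pose R a b := exists P : {poly 'F_p}, a = (map_poly f P).[th] /\ b = (map_poly g P).[ze].
have total a : exists b, R a b.
  have [->|a0] := eqVneq a 0.
    by exists 0, 0; rewrite !rmorph0 !horner0.
  have [i ->] := thP a a0; exists (ze ^+ i), 'X^i.
  by rewrite !map_polyXn !hornerXn.
have func a b b' : R a b -> R a b' -> b = b'.
  case=> P [aP ->] [P' [aP' ->]].
  have /dvdpP[Q EQ] : m %| P - P'.
    by apply: mP; rewrite rmorphB /= hornerD hornerN -aP -aP' subrr.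
  apply/eqP; rewrite -subr_eq0 -hornerN -hornerD -rmorphB EQ rmorphM hornerM.
  by move/rootP: ze0 => /= ->; rewrite mulr0.
have [s sR] : exists s, forall a, R a (s a).
  exists (fun z => proj1_sig (constructive_indefinite_description _ (total z))).
  by move=> z; apply: proj2_sig.
have sB : zmod_morphism s.
  move=> a b; apply: (func _ _ _ (sR _)).
  have [P [aP ->]] := sR a; have [P' [bP' ->]] := sR b.
  by exists (P - P'); rewrite !rmorphB /= !hornerD !hornerN -aP -bP'.
have sMM : monoid_morphism s.
  split=> [|a b]; apply: (func _ _ _ (sR _)).
    by exists 1; rewrite !rmorph1 !hornerC.
  have [P [aP ->]] := sR a; have [P' [bP' ->]] := sR b.
  by exists (P * P'); rewrite !rmorphM /= !hornerM -aP -bP'.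
pose Z := GRing.isZmodMorphism.Build F K s sB.
pose M := GRing.isMonoidMorphism.Build F K s sMM.
by exists (HB.pack s Z M : {rmorphism F -> K}).
Qed.

End FiniteFieldEmbedding.

(** * The automorphism group *)

Section Classification.
Variables (K : closedFieldType) (L : fieldType) (iota : {rmorphism K -> L}).
Variables (q : nat) (m n : K).
Hypothesis HP : curve_params q m n.
Local Notation cpair := (cpair iota q m n).
Local Notation rational_in := (rational_in iota).

Lemma rational_ex x z P : transcendental_over iota x -> rational_in x z ->
  rational_in x (ex iota z P).
Proof.
move=> Htr [A [D [D0 ->]]].
have rat_add u v : rational_in x u -> rational_in x v -> rational_in x (u + v).
  move=> [B [E [E0 ->]]] [B' [E' [E0' ->]]].
  exists (B * E' + B' * E), (E * E'); rewrite mulf_neq0 //; split=> //.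
  by rewrite addf_div ?Htr // exD !exM.
elim/poly_ind: P => [|P c IH].
  by exists 0, 1; rewrite oner_neq0 !ex0 mul0r.
rewrite exD exM exX exC; apply: rat_add; last first.
  by exists c%:P, 1; rewrite oner_neq0 exC ex1 divr1.
case: IH => B [E [E0 ->]]; exists (B * A), (E * D).
by rewrite mulf_neq0 // mulf_div !exM.
Qed.

Lemma rational_trans x z w : transcendental_over iota x -> rational_in x z ->
  rational_in z w -> rational_in x w.
Proof.
move=> Htr Hz [P [D [_ ->]]].
have [A [E [E0 ->]]] := rational_ex P Htr Hz.
have [B [G [G0 ->]]] := rational_ex D Htr Hz.
have [->|B0] := eqVneq B 0.
  by exists 0, 1; rewrite oner_neq0 !ex0 mul0r invr0 mulr0 mul0r.
exists (A * G), (E * B); rewrite mulf_neq0 //; split=> //.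
by rewrite invf_div mulf_div !exM.
Qed.

Lemma rational_moebius_inv a b c d z : a * d - b * c != 0 ->
  transcendental_over iota z -> rational_in (moebius iota a b c d z) z.
Proof.
move=> D0 Htr; have [Z0 {2}<-] := moebiusK D0 (moebius_den_neq0 D0 Htr).
have lin k l Z : ex iota Z (k%:P * 'X + l%:P) = iota k * Z + iota l.
  by rewrite exD exM !exC exX.
exists (d%:P * 'X + (- b)%:P), ((- c)%:P * 'X + a%:P); rewrite !lin; split=> //.
by apply: contraNneq Z0 => E; rewrite -rmorphN -lin E ex0.
Qed.

Lemma cpair_irrational x y : cpair x y -> ~ rational_in x y.
Proof.
move=> cxy [P [D [D0 yE]]]; have [Fxy Htr _] := cxy.
have : D%:P * 'X - P%:P = 0.
  apply: (curve_indep HP Htr Fxy).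
    apply: leq_trans (size_polyD _ _) _; rewrite geq_max size_polyN size_Cmul // size_polyX.
    rewrite (leq_trans (size_polyC_leq1 _)) // andbT ltnS.
    exact: q_gt0 HP.
  by rewrite evB evM !evC evX yE mulrC divfK ?subrr // Htr.
move/(congr1 (fun S : {poly {poly K}} => S`_1)).
rewrite coefB coefCM coefX coefC coef0 mulr1 subr0 => /eqP.
by rewrite (negPf D0).
Qed.

Lemma transcendental_aut s z : isKAut iota s -> transcendental_over iota z ->
  transcendental_over iota (s z).
Proof.
move=> [_ _ _ sbij sfix] /transcendentalP Hz; apply/transcendentalP=> c.
by apply: contra_neq (Hz c) => E; apply: (bij_inj sbij); rewrite sfix.
Qed.

(** The alternative of [aut_rational] for the inverse, and for the pair (y, x), has only one
    possible outcome: the other would put y in K(x) or x in K(y). *)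
Lemma aut_moebius t x y (fq : seq K) :
  uniq fq -> (4 < size fq)%N -> (forall k, k \in fq -> k ^+ q = k) ->
  cpair x y -> isKAut iota t -> rational_in x (t x) ->
  exists a b c d, [/\ a * d - b * c != 0,
    [/\ a ^+ q = a, b ^+ q = b, c ^+ q = c & d ^+ q = d],
    t x = moebius iota a b c d x & t y = moebius iota a b c d y].
Proof.
move=> ufq sfq fqP cxy Ht Htx; have [s [Hs ts st]] := isKAut_inv Ht.
have cyx := cpair_swap HP cxy.
have [_ Htr _] := cxy; have [_ Htr' _] := cyx.
have tt z : transcendental_over iota z -> transcendental_over iota (t z).
  exact: transcendental_aut.
have tts z : transcendental_over iota z -> transcendental_over iota (s z).
  exact: transcendental_aut.
have tf := isKAut_fix Ht; have sf := isKAut_fix Hs.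
have [t' tE] := isKAut_rmorphism Ht; have [s' sE] := isKAut_rmorphism Hs.
rewrite -tE -sE in Htx ts st tt tts tf sf *.
have back u v : rational_in u (s' v) -> rational_in (t' u) v.
  case=> P [D [D0 E]]; exists P, D; split=> //.
  by rewrite -[v]st E fmorph_div !rmorph_ex.
have Hsx : rational_in x (s' x).
  case: (aut_rational HP tf sf ts st cxy) => // /back Hy.
  by case: (cpair_irrational cxy); apply: rational_trans Hy.
have Mx := rational_moebius Htr tf st (tts _ Htr) (tt _ Htr) Htx Hsx.
have Hty : rational_in y (t' y).
  case: (aut_rational HP sf tf st ts cyx) => // Hx; case: (cpair_irrational cyx).
  have [a [b [c [d [D0 E]]]]] := Mx.
  by apply: (rational_trans Htr' Hx); rewrite E; apply: rational_moebius_inv.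
have Hsy : rational_in y (s' y).
  case: (aut_rational HP tf sf ts st cyx) => // /back Hx.
  by case: (cpair_irrational cyx); apply: rational_trans Hx.
have My := rational_moebius Htr' tf st (tts _ Htr') (tt _ Htr') Hty Hsy.
exact: (moebius_over_Fq HP ufq sfq fqP cxy sf ts Mx My).
Qed.

Lemma aut_rational_or t x y : cpair x y -> isKAut iota t ->
  rational_in x (t x) \/ rational_in x (t y).
Proof.
move=> cxy Ht; have [s [Hs ts st]] := isKAut_inv Ht.
have tf := isKAut_fix Ht; have sf := isKAut_fix Hs.
have [t' tE] := isKAut_rmorphism Ht; have [s' sE] := isKAut_rmorphism Hs.
rewrite -tE -sE in ts st tf sf *.
exact: (aut_rational HP sf tf st ts cxy).
Qed.

End Classification.

Lemma det_mx22 (R : comNzRingType) (g : 'M[R]_2) :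
  \det g = g 0 0 * g 1 1 - g 0 1 * g 1 0.
Proof.
have l0 : lift ord0 ord0 = 1 :> 'I_2 by apply/val_inj.
have l1 : lift 1 0 = 0 :> 'I_2 by apply/val_inj.
rewrite (expand_det_row _ 0) !big_ord_recl big_ord0 addr0 /cofactor !det_mx11 !mxE.
by rewrite l0 l1 /= expr0 expr1 mul1r mulN1r mulrN.
Qed.

(** * The action of GL(2, q) on the function field *)

Section GL2Action.
Variables (K : closedFieldType) (L : fieldType) (iota : {rmorphism K -> L}).
Variables (q : nat) (m n : K).
Hypothesis HP : curve_params q m n.
Local Notation cpair := (cpair iota q m n).
Variables (Fq : finFieldType) (e : {rmorphism Fq -> K}).
Hypothesis cardFq : #|Fq| = q.
Variables (x y : L).
Hypothesis cxy : cpair x y.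

Let Htr : transcendental_over iota x. Proof. by case: cxy. Qed.
Let Htr' : transcendental_over iota y. Proof. by case: (cpair_swap HP cxy). Qed.
Let Hgen : generated_by iota x y. Proof. by case: cxy. Qed.

Lemma emb_frob a : e a ^+ q = e a.
Proof. by rewrite -rmorphXn -cardFq expf_card. Qed.

Lemma emb_surj k : k ^+ q = k -> exists a, k = e a.
Proof.
move=> kq; have [/mapP[a _ ->]|nk] := boolP (k \in map e (enum Fq)); first by exists a.
have P0 : 'X^q - 'X != 0 :> {poly K}.
  rewrite -size_poly_eq0 size_polyDl ?size_polyXn //.
  by rewrite size_polyN size_polyX ltnS; apply: leq_trans (cp_q HP).
have /(max_poly_roots P0) : all (root ('X^q - 'X)) (k :: map e (enum Fq)).
  apply/allP=> z; rewrite inE /root !hornerE subr_eq0 => /predU1P[->|]; first by rewrite kq.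
  by case/mapP=> a _ ->; rewrite emb_frob.
rewrite /= nk map_inj_uniq ?enum_uniq; last exact: fmorph_inj.
move=> /(_ isT); rewrite size_map -cardE cardFq size_polyDl ?size_polyXn ?ltnn //.
by rewrite size_polyN size_polyX ltnS; apply: leq_trans (cp_q HP).
Qed.

(* The matrix g acts on homogeneous coordinates as (z, 1) |-> (z, 1) *m g, so that
   composition of automorphisms corresponds to the product of matrices. *)
Definition matrix_moebius (g : 'M[Fq]_2) (z : L) : L :=
  moebius iota (e (g 0 0)) (e (g 1 0)) (e (g 0 1)) (e (g 1 1)) z.

Lemma det_emb (g : 'M[Fq]_2) : g \in unitmx ->
  e (g 0 0) * e (g 1 1) - e (g 1 0) * e (g 0 1) != 0.
Proof.
rewrite unitmxE unitfE det_mx22 => D.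
by rewrite -!rmorphM -rmorphB fmorph_eq0 [g 1 0 * _]mulrC.
Qed.

Lemma matrix_cpair (g : 'M[Fq]_2) : g \in unitmx ->
  cpair (matrix_moebius g x) (matrix_moebius g y).
Proof.
move=> gU; apply: (cpair_moebius HP) => //; first exact: det_emb.
by rewrite !emb_frob.
Qed.

Lemma action_exists : exists act : 'M[Fq]_2 -> L -> L, forall g, g \in unitmx ->
  [/\ isKAut iota (act g), act g x = matrix_moebius g x & act g y = matrix_moebius g y].
Proof.
have H g : exists s : L -> L, g \in unitmx ->
    [/\ isKAut iota s, s x = matrix_moebius g x & s y = matrix_moebius g y].
  (* The identity is a dummy value at singular matrices. *)
  have [gU|gU] := boolP (g \in unitmx); last by exists id.
  by have [s Hs] := cpair_aut HP cxy (matrix_cpair gU); exists s.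
exists (fun g => proj1_sig (constructive_indefinite_description _ (H g))).
by move=> g; apply: (proj2_sig (constructive_indefinite_description _ (H g))).
Qed.

Lemma swap_exists : exists Phi, [/\ isKAut iota Phi, Phi x = y & Phi y = x].
Proof. exact: (cpair_aut HP cxy (cpair_swap HP cxy)). Qed.

Variable act : 'M[Fq]_2 -> L -> L.
Hypothesis actP : forall g, g \in unitmx ->
  [/\ isKAut iota (act g), act g x = matrix_moebius g x & act g y = matrix_moebius g y].

Lemma aut_moebiusE s a b c d z : isKAut iota s ->
  s (moebius iota a b c d z) = moebius iota a b c d (s z).
Proof.
move=> Hs; have sf := isKAut_fix Hs; have [f fE] := isKAut_rmorphism Hs.
by rewrite -fE in sf *; rewrite /moebius fmorph_div !rmorphD !rmorphM !sf.
Qed.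

Lemma aut_matrix_moebius s (g : 'M[Fq]_2) z : isKAut iota s ->
  s (matrix_moebius g z) = matrix_moebius g (s z).
Proof. exact: aut_moebiusE. Qed.

Lemma matrix_moebius_comp (g h : 'M[Fq]_2) z : transcendental_over iota z ->
  g \in unitmx -> matrix_moebius h (matrix_moebius g z) = matrix_moebius (g *m h) z.
Proof.
move=> Hz gU; rewrite /matrix_moebius moebius_comp; last first.
  by apply: moebius_den_neq0 Hz; apply: det_emb.
rewrite !mxE !big_ord_recl !big_ord0 !addr0.
rewrite (_ : lift ord0 ord0 = 1); last exact/val_inj.
by congr moebius; rewrite !rmorphD !rmorphM; ring.
Qed.

(** An automorphism over [K] commutes with Moebius maps, so [act g (act h x)] is the map of [h]
    applied to that of [g]; the row convention makes this the product [g *m h]. *)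
Lemma act_mul g h : g \in unitmx -> h \in unitmx -> act (g *m h) = act g \o act h.
Proof.
move=> gU hU; have ghU : g *m h \in unitmx by rewrite unitmx_mul gU.
have [Ag gx gy] := actP gU; have [Ah hx hy] := actP hU.
have [Agh ghx ghy] := actP ghU.
apply: (isKAut_eq Hgen) => //; first exact: isKAut_comp.
- by rewrite ghx /= hx [in RHS]aut_matrix_moebius // gx matrix_moebius_comp.
- by rewrite ghy /= hy [in RHS]aut_matrix_moebius // gy matrix_moebius_comp.
Qed.

Lemma matrix_moebius_scalar k z : k != 0 -> matrix_moebius k%:M z = z.
Proof.
move=> k0; rewrite /matrix_moebius /moebius !mxE /= !mulr1n !mulr0n !rmorph0.
by rewrite mul0r addr0 add0r mulrC mulKf // !fmorph_eq0.
Qed.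

Lemma unitmx_scalar k : k != 0 -> (k%:M : 'M[Fq]_2) \in unitmx.
Proof. by move=> k0; rewrite unitmxE det_scalar unitfE expf_neq0. Qed.

Lemma act_scalar k : k != 0 -> act k%:M = id.
Proof.
move=> k0; have [Ag gx gy] := actP (unitmx_scalar k0).
apply: (isKAut_eq Hgen) => //; first exact: isKAut_id.
  by rewrite gx matrix_moebius_scalar.
by rewrite gy matrix_moebius_scalar.
Qed.

(** The fixed-point equation of the Moebius map is quadratic in the transcendental x, so its
    coefficients vanish. *)
Lemma act_eq_id g : g \in unitmx -> act g = id -> exists2 k, k != 0 & g = k%:M.
Proof.
move=> gU gid; have [_ gx _] := actP gU; rewrite gid in gx.
have D := det_emb gU; have den := moebius_den_neq0 D Htr.
pose P : {poly K} := (- e (g 0 1))%:P * 'X^2 + (e (g 0 0) - e (g 1 1))%:P * 'X + (e (g 1 0))%:P.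
have P0 : P = 0.
  apply: (transcendental_inj Htr).
  rewrite ex0 !exD !exM !exC !exX rmorphN rmorphB.
  move: gx; rewrite /matrix_moebius /moebius.
  set A := iota _; set B := iota _; set C := iota _; set D' := iota _ => /(congr1 (fun z => z * (C * x + D'))).
  rewrite divfK // => E.
  transitivity (A * x + B - x * (C * x + D')); first by ring.
  by rewrite E subrr.
have g01 : g 0 1 = 0.
  have := congr1 (fun S : {poly K} => S`_2) P0.
  rewrite !coefD !coefCM coefXn coefX coefC coef0 mulr0 !addr0 mulr1 => /eqP.
  by rewrite oppr_eq0 fmorph_eq0 => /eqP.
have g10 : g 1 0 = 0.
  have := congr1 (fun S : {poly K} => S`_0) P0.
  rewrite !coefD !coefCM coefXn coefX coefC coef0 !mulr0 !add0r => /eqP.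
  by rewrite fmorph_eq0 => /eqP.
have g00 : g 0 0 = g 1 1.
  have := congr1 (fun S : {poly K} => S`_1) P0.
  rewrite !coefD !coefCM coefXn coefX coefC coef0 mulr0 add0r addr0 mulr1 => /eqP.
  by rewrite subr_eq0 => /eqP /fmorph_inj.
have gE : g = (g 0 0)%:M.
  apply/matrixP=> i j; rewrite mxE.
  case: (unliftP 0 i) => [i'|] -> {i}; case: (unliftP 0 j) => [j'|] -> {j}; rewrite ?(ord1 i') ?(ord1 j').
  - by rewrite eqxx (_ : lift 0 0 = 1) ?g00 //; apply/val_inj.
  - by rewrite (_ : lift 0 0 = 1) ?g10 //; apply/val_inj.
  - by rewrite (_ : lift 0 0 = 1) ?g01 //; apply/val_inj.
  - by rewrite eqxx.
exists (g 0 0) => //; apply/eqP=> g0; case/negP: D.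
by rewrite -g00 g0 rmorph0 mul0r g10 rmorph0 mul0r subrr.
Qed.

Lemma act_rational g : g \in unitmx -> rational_in iota x (act g x).
Proof.
move=> gU; have [_ -> _] := actP gU; have den := moebius_den_neq0 (det_emb gU) Htr.
have lin k l : ex iota x (k%:P * 'X + l%:P) = iota k * x + iota l.
  by rewrite exD exM !exC exX.
exists ((e (g 0 0))%:P * 'X + (e (g 1 0))%:P), ((e (g 0 1))%:P * 'X + (e (g 1 1))%:P).
by rewrite !lin; split=> //; apply: contraNneq den => E; rewrite -lin E ex0.
Qed.

Variable Phi : L -> L.
Hypothesis PhiP : [/\ isKAut iota Phi, Phi x = y & Phi y = x].

Lemma swap_involutive : Phi \o Phi = id.
Proof.
have [HPhi Px Py] := PhiP; apply: (isKAut_eq Hgen) => /=.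
- exact: isKAut_comp.
- exact: isKAut_id.
- by rewrite Px Py.
- by rewrite Py Px.
Qed.

Lemma act_swap g : g \in unitmx -> act g \o Phi = Phi \o act g.
Proof.
move=> gU; have [HPhi Px Py] := PhiP; have [Ag gx gy] := actP gU.
apply: (isKAut_eq Hgen); [exact: isKAut_comp|exact: isKAut_comp| |].
- by rewrite /= Px gy gx aut_matrix_moebius // Px.
- by rewrite /= Py gx gy aut_matrix_moebius // Py.
Qed.

Lemma act_neq_swap g : g \in unitmx -> act g <> Phi.
Proof.
move=> gU E; have [_ Px _] := PhiP.
by case: (cpair_irrational HP cxy); rewrite -Px -E; apply: act_rational.
Qed.

Lemma unit_of_det (g : 'M[Fq]_2) :
  e (g 0 0) * e (g 1 1) - e (g 1 0) * e (g 0 1) != 0 -> g \in unitmx.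
Proof.
by rewrite unitmxE unitfE det_mx22 -!rmorphM -rmorphB fmorph_eq0 [g 1 0 * _]mulrC.
Qed.

Definition mx22 (a b c d : Fq) : 'M[Fq]_2 :=
  \matrix_(i, j) if i == 0 then if j == 0 then a else b else if j == 0 then c else d.

Lemma act_of_moebius s a b c d : isKAut iota s -> a * d - b * c != 0 ->
  [/\ a ^+ q = a, b ^+ q = b, c ^+ q = c & d ^+ q = d] ->
  s x = moebius iota a b c d x -> s y = moebius iota a b c d y ->
  exists2 g, g \in unitmx & s = act g.
Proof.
move=> Hs D0 [/emb_surj[a1 aE] /emb_surj[b1 bE] /emb_surj[c1 cE] /emb_surj[d1 dE]] sx sy.
subst a b c d; have gU : mx22 a1 c1 b1 d1 \in unitmx by apply: unit_of_det; rewrite !mxE.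
exists (mx22 a1 c1 b1 d1) => //; have [Ag gx gy] := actP gU.
by apply: (isKAut_eq Hgen) => //; rewrite ?gx ?gy ?sx ?sy /matrix_moebius !mxE.
Qed.

Lemma inH_act s : inH iota q x y s -> exists2 g, g \in unitmx & s = act g.
Proof.
elim=> {s} [|s Hs [[al [alq [sx sy]]]|[mu [muq mu0 sx sy]]|[sx sy]]|s t _ [g gU ->] _ [h hU ->]].
- by exists 1%:M; rewrite ?unitmx1 // act_scalar ?oner_neq0.
- apply: (act_of_moebius (a := 1) (b := al) (c := 0) (d := 1)) => //.
  + by rewrite mulr0 subr0 mulr1 oner_neq0.
  + by rewrite !expr1n (frob0 HP).
  + by rewrite sx /moebius !rmorph1 rmorph0 mul0r add0r mul1r divr1.
  + by rewrite sy /moebius !rmorph1 rmorph0 mul0r add0r mul1r divr1.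
- apply: (act_of_moebius (a := mu) (b := 0) (c := 0) (d := 1)) => //.
  + by rewrite mulr0 subr0 mulr1.
  + by rewrite !expr1n (frob0 HP).
  + by rewrite sx /moebius !rmorph1 rmorph0 mul0r add0r addr0 divr1.
  + by rewrite sy /moebius !rmorph1 rmorph0 mul0r add0r addr0 divr1.
- apply: (act_of_moebius (a := 0) (b := 1) (c := 1) (d := 0)) => //.
  + by rewrite mulr0 sub0r mulr1 oppr_eq0 oner_neq0.
  + by rewrite !expr1n (frob0 HP).
  + by rewrite sx /moebius !rmorph1 rmorph0 mul0r add0r addr0 !mul1r.
  + by rewrite sy /moebius !rmorph1 rmorph0 mul0r add0r addr0 !mul1r.
- by exists (g *m h); rewrite ?unitmx_mul ?gU // act_mul.
Qed.

Lemma inH_translation a : exists s, [/\ inH iota q x y s, isKAut iota s,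
  s x = x + iota (e a) & s y = y + iota (e a)].
Proof.
have gU : mx22 1 0 a 1 \in unitmx.
  by apply: unit_of_det; rewrite !mxE /= rmorph1 rmorph0 mulr0 subr0 mulr1 oner_neq0.
have [Ag gx gy] := actP gU; exists (act (mx22 1 0 a 1)).
have ax : act (mx22 1 0 a 1) x = x + iota (e a).
  by rewrite gx /matrix_moebius /moebius !mxE /= !rmorph1 !rmorph0 mul0r add0r mul1r divr1.
have ay : act (mx22 1 0 a 1) y = y + iota (e a).
  by rewrite gy /matrix_moebius /moebius !mxE /= !rmorph1 !rmorph0 mul0r add0r mul1r divr1.
split=> //; apply: inH_gen => //; apply: Or31; exists (e a).
by rewrite emb_frob.
Qed.

Lemma inH_scaling a : a != 0 -> exists s, [/\ inH iota q x y s, isKAut iota s,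
  s x = iota (e a) * x & s y = iota (e a) * y].
Proof.
move=> a0; have gU : mx22 a 0 0 1 \in unitmx.
  by apply: unit_of_det; rewrite !mxE /= rmorph1 rmorph0 mulr0 subr0 mulr1 fmorph_eq0.
have [Ag gx gy] := actP gU; exists (act (mx22 a 0 0 1)).
have ax : act (mx22 a 0 0 1) x = iota (e a) * x.
  by rewrite gx /matrix_moebius /moebius !mxE /= !rmorph1 !rmorph0 mul0r add0r addr0 divr1.
have ay : act (mx22 a 0 0 1) y = iota (e a) * y.
  by rewrite gy /matrix_moebius /moebius !mxE /= !rmorph1 !rmorph0 mul0r add0r addr0 divr1.
split=> //; apply: inH_gen => //; apply: Or32; exists (e a).
by rewrite emb_frob fmorph_eq0.
Qed.

Lemma inH_inversion : exists s, [/\ inH iota q x y s, isKAut iota s,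
  s x = x^-1 & s y = y^-1].
Proof.
have gU : mx22 0 1 1 0 \in unitmx.
  by apply: unit_of_det; rewrite !mxE /= rmorph1 rmorph0 mulr0 sub0r mulr1 oppr_eq0 oner_neq0.
have [Ag gx gy] := actP gU; exists (act (mx22 0 1 1 0)).
have ax : act (mx22 0 1 1 0) x = x^-1.
  by rewrite gx /matrix_moebius /moebius !mxE /= !rmorph1 !rmorph0 mul0r add0r addr0 !mul1r.
have ay : act (mx22 0 1 1 0) y = y^-1.
  by rewrite gy /matrix_moebius /moebius !mxE /= !rmorph1 !rmorph0 mul0r add0r addr0 !mul1r.
by split=> //; apply: inH_gen => //; apply: Or33.
Qed.

(* Bruhat decomposition: for g 0 1 != 0 the map is
   z |-> k / (z + g 1 1 / g 0 1) + g 0 0 / g 0 1. *)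
Lemma act_inH g : g \in unitmx -> inH iota q x y (act g).
Proof.
move=> gU; have [Ag gx gy] := actP gU; have D := det_emb gU.
set a := e (g 0 0) in D; set d := e (g 1 1) in D; set b := e (g 1 0) in D.
set c := e (g 0 1) in D.
have via s : inH iota q x y s -> isKAut iota s -> s x = matrix_moebius g x ->
    s y = matrix_moebius g y -> inH iota q x y (act g).
  by move=> Hs As sx sy; rewrite (isKAut_eq Hgen Ag As) ?gx ?gy.
have aut_lin s (k l : Fq) z : isKAut iota s ->
    s (iota (e k) * z + iota (e l)) = iota (e k) * s z + iota (e l).
  by case=> sD sM _ _ sfix; rewrite sD sM !sfix.
have [c0|c0] := eqVneq (g 0 1) 0.
  have d0 : d != 0.
    by apply: contraNneq D => ->; rewrite /c c0 rmorph0 !mulr0 subrr.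
  have a0 : a != 0.
    by apply: contraNneq D => ->; rewrite /c c0 rmorph0 !mulr0 mul0r subrr.
  have g11 : g 1 1 != 0 by rewrite -(fmorph_eq0 e).
  have g00 : g 0 0 != 0 by rewrite -(fmorph_eq0 e).
  have id0 : iota d != 0 by rewrite fmorph_eq0.
  have k0 : g 0 0 / g 1 1 != 0 by rewrite mulf_neq0 ?invr_neq0.
  have [s1 [H1 A1 x1 y1]] := inH_scaling k0.
  have [s2 [H2 A2 x2 y2]] := inH_translation (g 1 0 / g 1 1).
  have f1 := isKAut_fix A1.
  have E z : iota (e (g 0 0 / g 1 1)) * z + iota (e (g 1 0 / g 1 1)) = matrix_moebius g z.
    rewrite /matrix_moebius /moebius c0 !rmorph0 mul0r add0r !fmorph_div -/a -/b -/d.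
    by field.
  have sD : forall u v, s1 (u + v) = s1 u + s1 v by case: A1.
  apply: (via (s1 \o s2)); [exact: inH_comp|exact: isKAut_comp| |].
    by rewrite /= x2 sD f1 x1.
  by rewrite /= y2 sD f1 y1.
have ce : c != 0 by rewrite fmorph_eq0.
have ic : iota c != 0 by rewrite fmorph_eq0.
(* This is minus the determinant over [(g 0 1)^2], the residue left after the division of numerator
   by denominator. *)
pose k := (g 1 0 * g 0 1 - g 0 0 * g 1 1) / (g 0 1 * g 0 1).
have k0 : k != 0.
  rewrite mulf_neq0 ?invr_neq0 ?mulf_neq0 // -(fmorph_eq0 e) rmorphB !rmorphM.
  by rewrite -oppr_eq0 opprB.
have [s1 [H1 A1 x1 y1]] := inH_translation (g 1 1 / g 0 1).
have [s2 [H2 A2 x2 y2]] := inH_inversion.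
have [s3 [H3 A3 x3 y3]] := inH_scaling k0.
have [s4 [H4 A4 x4 y4]] := inH_translation (g 0 0 / g 0 1).
have [r1 E1] := isKAut_rmorphism A1; have [r2 E2] := isKAut_rmorphism A2.
have [r3 E3] := isKAut_rmorphism A3; have [r4 E4] := isKAut_rmorphism A4.
have f1 := isKAut_fix A1; have f2 := isKAut_fix A2; have f3 := isKAut_fix A3.
have E z : transcendental_over iota z ->
  iota (e k) * (z + iota (e (g 1 1 / g 0 1)))^-1 + iota (e (g 0 0 / g 0 1)) = matrix_moebius g z.
  move=> Hz; have den := moebius_den_neq0 D Hz.
  rewrite /matrix_moebius /moebius /k !(fmorph_div, rmorphB, rmorphM) -/a -/b -/c -/d.
  by field; rewrite ic andbT.
(* Composition of automorphisms substitutes from the outside in: [s4] gives the outermost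
   translation of the map, [s1] the innermost one. *)
apply: (via (s1 \o (s2 \o (s3 \o s4)))).
- by do 3!apply: inH_comp => //.
- by do 3!apply: isKAut_comp => //.
- rewrite -E //= x4 -E3 rmorphD E3 f3 x3 -E2 rmorphD rmorphM E2 !f2 x2.
  by rewrite -E1 rmorphD rmorphM fmorphV E1 !f1 x1.
- rewrite -E //= y4 -E3 rmorphD E3 f3 y3 -E2 rmorphD rmorphM E2 !f2 y2.
  by rewrite -E1 rmorphD rmorphM fmorphV E1 !f1 y1.
Qed.

Hypothesis q4 : (4 < q)%N.

(** When it is the image of y that lies in K(x), composing with the exchange reduces to the Moebius
    case. *)
Theorem aut_classification s : isKAut iota s ->
  exists2 g, g \in unitmx & s = act g \/ s = act g \o Phi.
Proof.
move=> Hs; have [HPhi Px Py] := PhiP.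
pose fq := map e (enum Fq).
have ufq : uniq fq by rewrite map_inj_uniq ?enum_uniq //; apply: fmorph_inj.
have sfq : (4 < size fq)%N by rewrite size_map -cardE cardFq.
have fqP k : k \in fq -> k ^+ q = k by case/mapP=> a _ ->; apply: emb_frob.
have direct t : isKAut iota t -> rational_in iota x (t x) -> exists2 g, g \in unitmx & t = act g.
  move=> Ht tx; have [a [b [c [d [D0 F1 tx' ty']]]]] := aut_moebius HP ufq sfq fqP cxy Ht tx.
  exact: act_of_moebius D0 F1 tx' ty'.
case: (aut_rational_or HP cxy Hs) => [sx|sy].
  by have [g gU ->] := direct s Hs sx; exists g => //; left.
have [||g gU E] := direct (s \o Phi); first exact: isKAut_comp.
  by rewrite /= Px.
exists g => //; right; rewrite -E.
by apply: functional_extensionality => z /=; rewrite -[Phi (Phi z)]/((Phi \o Phi) z) swap_involutive.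
Qed.

End GL2Action.

(** * PGL(2, q) as a quotient group and its order *)

Section ProjectiveGroup.
Variable F : finFieldType.

(** Commuting with the two elementary transvections already forces a matrix to be scalar. *)
Lemma central_scalar (u : {'GL_2[F]}) :
  u \in 'Z('GL_2[F])%g <-> exists2 k : F, k != 0 & GLval u = k%:M.
Proof.
split=> [/centerP[_ uC] | [k k0 uk]]; last first.
  apply/centerP; split; first by rewrite inE.
  move=> v _; apply: val_inj; change (GLval u *m GLval v = GLval v *m GLval u).
  by rewrite uk mul_scalar_mx mul_mx_scalar.
have comm (g : 'M[F]_2) : g \in unitmx -> GLval u *m g = g *m GLval u.
  move=> gU; have := uC (FinRing.unit _ (gU : g \is a GRing.unit)).
  by rewrite inE => /(_ isT) /(congr1 (@GLval 2 F)).
have E12 : mx22 1 1 0 (1 : F) \in unitmx.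
  by rewrite unitmxE det_mx22 !mxE /= mulr0 subr0 mulr1 unitr1.
have E21 : mx22 1 0 1 (1 : F) \in unitmx.
  by rewrite unitmxE det_mx22 !mxE /= mul0r subr0 mulr1 unitr1.
have l0 : lift ord0 ord0 = 1 :> 'I_2 by apply/val_inj.
have := comm _ E12 => /matrixP C1; have := comm _ E21 => /matrixP C2.
move: (C1 0 0) (C1 0 1) (C2 0 0).
rewrite !mxE !big_ord_recl !big_ord0 !l0 !mxE /= !(mulr1, mul1r, mulr0, mul0r, addr0).
move: (GL_unitmx u) C1 C2 => uU _ _.
set M := GLval u in uU *; move=> H1 H2 H3.
have c0 : M 1 0 = 0 by apply: (addrI (M 0 0)); rewrite -H1 addr0.
have b0 : M 0 1 = 0 by apply: (addrI (M 0 0)); rewrite H3 addr0.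
have ad : M 0 0 = M 1 1 by move: H2; rewrite b0 addr0 add0r.
have ME : M = (M 0 0)%:M.
  apply/matrixP=> i j; rewrite mxE.
  case: (unliftP 0 i) => [i'|] -> {i}; case: (unliftP 0 j) => [j'|] -> {j};
    rewrite ?(ord1 i') ?(ord1 j') ?l0 //.
exists (M 0 0) => //.
have : \det (M : 'M_2) != 0 by rewrite -unitfE -unitmxE.
by rewrite det_mx22 b0 mul0r subr0 -ad mulf_eq0 orbb.
Qed.

Lemma card_center_GL2 : #|'Z('GL_2[F])%g| = #|F|.-1.
Proof.
have <- : #|[set~ (0 : F)]| = #|F|.-1 by rewrite cardsC1.
rewrite -(card_in_imset (f := fun u : {'GL_2[F]} => GLval u 0 0)).
  apply: eq_card => k; rewrite !inE; apply/imsetP/idP => [[u /central_scalar[l l0 uE] ->]|k0].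
    by rewrite uE mxE eqxx mulr1n.
  have kU : (k%:M : 'M[F]_2) \is a GRing.unit.
    by rewrite -[_ \is a _]/(_ \in unitmx) unitmxE det_scalar unitfE expf_neq0.
  exists (FinRing.unit _ kU); last by rewrite /= mxE eqxx mulr1n.
  by apply/central_scalar; exists k.
move=> u v /central_scalar[k _ uE] /central_scalar[l _ vE] E.
apply: val_inj; change (GLval u = GLval v); move: E.
by rewrite uE vE !mxE eqxx !mulr1n => ->.
Qed.

Lemma mem_PGL2 (u : coset_of 'Z('GL_2[F])) : u \in PGL2 F.
Proof. by rewrite -(coset_reprK u); apply: mem_quotient; rewrite inE. Qed.

Lemma card_PGL2 : #|{: coset_of 'Z('GL_2[F])}| = (#|F| ^ 3 - #|F|)%N.
Proof.
have -> : #|{: coset_of 'Z('GL_2[F])}| = #|PGL2 F|.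
  by apply: eq_card => u; rewrite mem_PGL2.
rewrite /PGL2 -divg_normal ?center_normal // card_center_GL2 card_GL_2.
have F1 : (1 < #|F|)%N := finRing_gt1 F.
have F0 : (0 < #|F|.-1)%N by rewrite -ltnS prednK // ltnW.
rewrite (_ : (#|F| * #|F|.-1 ^ 2 * #|F|.+1 = (#|F| ^ 3 - #|F|) * #|F|.-1)%N) ?mulnK //.
by move: (#|F|) F1 => [|k] //= _; nia.
Qed.

Lemma coset_centerP (u v : {'GL_2[F]}) :
  coset 'Z('GL_2[F]) u = coset 'Z('GL_2[F]) v <->
  exists2 k : F, k != 0 & GLval u = k *: GLval v.
Proof.
have nZ w : w \in 'N('Z('GL_2[F]))%g.
  by apply: (subsetP (normal_norm (center_normal _))); rewrite inE.
split=> [/(rcoset_kercosetP (nZ u) (nZ v))/rcosetP[z /central_scalar[k k0 zE] ->]|[k k0 uE]].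
  by exists k; rewrite // GL_MxE zE mul_scalar_mx.
apply/(rcoset_kercosetP (nZ u) (nZ v))/rcosetP; exists (u * v^-1)%g; last by rewrite mulgKV.
apply/central_scalar; exists k => //.
by rewrite GL_MxE uE -scalemxAl GL_VxE mulmxV ?GL_unitmx // scalemx1.
Qed.

End ProjectiveGroup.

(** The coefficient of x^(q+1) in the given equation is 1 - lambda. Dividing by it produces m = 2 /
    (1 - lambda), and n = -(1 + lambda) / (1 - lambda) from the mixed terms. *)
Lemma curve_equation_params (q : nat) (R : fieldType) (l x y : R) : 1 - l != 0 ->
  (x + y) ^+ q = x ^+ q + y ^+ q -> (x - y) ^+ q = x ^+ q - y ^+ q ->
  (x + y) ^+ q.+1 - 2%:R * ((x * y) ^+ q + x * y) - l * (x - y) ^+ q.+1 = 0 ->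
  curveF q (2%:R / (1 - l)) (- (1 + l) / (1 - l)) x y = 0.
Proof.
move=> l1 HD HB; rewrite !exprSr HD HB exprMn => E.
transitivity (((x ^+ q + y ^+ q) * (x + y) - 2%:R * (x ^+ q * y ^+ q + x * y) -
    l * ((x ^+ q - y ^+ q) * (x - y))) / (1 - l)); last by rewrite E mul0r.
by rewrite /curveF !exprSr; field.
Qed.

Theorem mainTheorem19
  (p q : nat) (Hp : prime p) (Hpodd : odd p) (Hq : exists n, q = (p ^ n)%N) (Hq3 : (3 < q)%N)
  (K : closedFieldType) (HcharK : p \in [pchar K])
  (Kalg : forall a : K, exists n, (0 < n)%N /\ a ^+ (p ^ n) = a)
  (lambda : K) (Hl1 : lambda != 1) (Hlm1 : lambda != -1)
  (L : fieldType) (iota : {rmorphism K -> L}) (x y : L)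
  (Hcurve : (x + y) ^+ q.+1 - 2%:R * ((x * y) ^+ q + x * y)
            - iota lambda * (x - y) ^+ q.+1 = 0)
  (Hgen : generated_by iota x y)
  (Htr : transcendental_over iota x)
  (Fq : finFieldType) (HFq : #|Fq| = q) :
  (exists Phi : L -> L,
     [/\ isKAut iota Phi, Phi x = y, Phi y = x, Phi \o Phi = id &
      [/\ (forall s, isKAut iota s <->
                    exists h, inH iota q x y h /\ (s = h \/ s = h \o Phi)),
         (forall h, inH iota q x y h -> h \o Phi = Phi \o h) &
         ~ inH iota q x y Phi]])
  /\
  (exists phi : coset_of 'Z('GL_2[Fq]) -> bool -> (L -> L),
     [/\ (forall g e, g \in PGL2 Fq -> isKAut iota (phi g e)),
         (forall s, isKAut iota s -> exists g e, g \in PGL2 Fq /\ s = phi g e),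
         (forall g g' e e', g \in PGL2 Fq -> g' \in PGL2 Fq ->
             phi g e = phi g' e' -> g = g' /\ e = e') &
         (forall g g' e e', g \in PGL2 Fq -> g' \in PGL2 Fq ->
             phi (g * g')%g (e (+) e') = phi g e \o phi g' e')])
  /\
  (exists f : 'I_(2 * (q ^ 3 - q)) -> (L -> L),
     injective f /\ forall s, isKAut iota s <-> exists i, s = f i).
Proof.
have [k qE] := Hq.
have k0 : (0 < k)%N by case: k qE => // qE; rewrite qE in Hq3.
have two0 : 2%:R != 0 :> K.
  rewrite -(dvdn_pcharf HcharK) dvdn_prime2 //.
  by apply: contraTneq Hpodd => ->.
have qodd : odd q by rewrite qE oddX Hpodd orbT.
(* Oddness excludes q = 4, so five elements of F_q are available for the comparison of Moebius
   maps. *)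
have q4 : (4 < q)%N by rewrite ltn_neqAle Hq3 andbT; apply: contraTneq qodd => <-.
have l1 : 1 - lambda != 0 by rewrite subr_eq0 eq_sym.
(* Odd characteristic makes m nonzero, and lambda != -1 makes n nonzero. *)
have HP : curve_params q (2%:R / (1 - lambda)) (- (1 + lambda) / (1 - lambda)).
  split=> //.
  - by rewrite qE pnatX pnatE // HcharK.
  - by field.
  - by rewrite mulf_neq0 // invr_eq0.
  - by rewrite mulf_neq0 ?invr_eq0 // oppr_eq0 addrC addr_eq0.
have cxy : cpair iota q (2%:R / (1 - lambda)) (- (1 + lambda) / (1 - lambda)) x y.
  split=> //.
  have -> : iota (2%:R / (1 - lambda)) = 2%:R / (1 - iota lambda).
    by rewrite fmorph_div rmorph_nat rmorphB rmorph1.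
  have -> : iota (- (1 + lambda) / (1 - lambda)) = - (1 + iota lambda) / (1 - iota lambda).
    by rewrite fmorph_div rmorphN rmorphD rmorphB rmorph1.
  apply: curve_equation_params => //.
  - by rewrite -(rmorph1 iota) -rmorphB fmorph_eq0.
  - exact: (frobD (cp_frob HP) iota).
  - exact: (frobB (cp_frob HP) iota).
have [e _] : exists e : {rmorphism Fq -> K}, True.
  apply: (finField_embedding (p := p)) => //.
  by apply: (@card_finPcharP Fq p k); rewrite ?HFq.
have [act actP] := action_exists HP e HFq cxy.
have [Phi PhiP] := swap_exists HP cxy.
have [HPhi Phix Phiy] := PhiP.
have PhiK := swap_involutive cxy PhiP.
have classif s := aut_classification HP HFq cxy actP PhiP q4 (s := s).
have actU (u : {'GL_2[Fq]}) : GLval u \in unitmx by apply: GL_unitmx.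
have actA g : g \in unitmx -> isKAut iota (act g) by case/actP.
have act_PhiA g : g \in unitmx -> isKAut iota (act g \o Phi).
  by move=> gU; apply: isKAut_comp; [apply: actA|].
have act_coset (u v : {'GL_2[Fq]}) : act (GLval u) = act (GLval v) <->
    coset 'Z('GL_2[Fq]) u = coset 'Z('GL_2[Fq]) v.
  split=> [E|/coset_centerP[c c0 uE]].
    have Eid : act (GLval (u * v^-1)%g) = id.
      rewrite GL_MxE (act_mul HP cxy actP) ?actU // E.
      rewrite -(act_mul HP cxy actP) ?actU // GL_VxE mulmxV ?actU //.
      exact: (act_scalar cxy actP (oner_neq0 _)).
    have [c c0 cE] := act_eq_id cxy actP (actU (u * v^-1)%g) Eid.
    apply/coset_centerP; exists c => //.
    by rewrite -mul_scalar_mx -cE -GL_MxE mulgKV.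
  rewrite uE -mul_scalar_mx (act_mul HP cxy actP) ?actU ?unitmx_scalar //.
  by rewrite (act_scalar cxy actP c0).
(* By [act_coset] the automorphism does not depend on the representative, and distinct cosets give
   distinct ones. The boolean records a factor [Phi]. *)
pose phi (u : coset_of 'Z('GL_2[Fq])) (b : bool) : L -> L :=
  if b then act (GLval (repr u)) \o Phi else act (GLval (repr u)).
have phiA u b : isKAut iota (phi u b).
  by case: b; [apply: act_PhiA|apply: actA]; apply: actU.
have phi_surj s : isKAut iota s -> exists u b, s = phi u b.
  case/classif=> g gU sE; pose v : {'GL_2[Fq]} := FinRing.unit _ (gU : g \is a GRing.unit).
  have E : act g = act (GLval (repr (coset 'Z('GL_2[Fq]) v))).
    by apply/(act_coset v); rewrite coset_reprK.
  by case: sE => ->; exists (coset 'Z('GL_2[Fq]) v); [exists false|exists true]; rewrite /phi E.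
(* Equality would make [Phi] itself the action of the matrix [invmx h *m g]. *)
have not_mixed (g h : 'M[Fq]_2) : g \in unitmx -> h \in unitmx -> act g <> act h \o Phi.
  move=> gU hU E; have hV : invmx h \in unitmx by rewrite unitmx_inv.
  case: (act_neq_swap HP cxy actP PhiP (_ : invmx h *m g \in unitmx)).
    by rewrite unitmx_mul hV.
  rewrite (act_mul HP cxy actP) // E.
  have -> : act (invmx h) \o (act h \o Phi) = (act (invmx h) \o act h) \o Phi by [].
  by rewrite -(act_mul HP cxy actP) // mulVmx // (act_scalar cxy actP (oner_neq0 _)).
have phi_inj u v b b' : phi u b = phi v b' -> u = v /\ b = b'.
  have base : act (GLval (repr u)) = act (GLval (repr v)) -> u = v.
    by move/act_coset; rewrite !coset_reprK.
  case: b; case: b' => /= E.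
  - split=> //; apply: base.
    have : (act (GLval (repr u)) \o Phi) \o Phi = (act (GLval (repr v)) \o Phi) \o Phi.
      by rewrite E.
    have shift (h : L -> L) : (h \o Phi) \o Phi = h \o (Phi \o Phi) by [].
    by rewrite !shift PhiK.
  - by case: (not_mixed (GLval (repr v)) (GLval (repr u))); rewrite ?actU.
  - by case: (not_mixed (GLval (repr u)) (GLval (repr v))); rewrite ?actU.
  - by split=> //; apply: base.
have act_reprM (u v : coset_of 'Z('GL_2[Fq])) :
    act (GLval (repr (u * v)%g)) = act (GLval (repr u)) \o act (GLval (repr v)).
  rewrite -(act_mul HP cxy actP) ?actU //.
  have -> : GLval (repr u) *m GLval (repr v) = GLval (repr u * repr v)%g by [].
  apply/act_coset.
  by rewrite coset_reprK coset_morphM ?repr_coset_norm // !coset_reprK.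
have phi_mul u v b b' : phi (u * v)%g (b (+) b') = phi u b \o phi v b'.
  rewrite /phi act_reprM; set g := GLval (repr u); set h := GLval (repr v).
  have hS := act_swap cxy actP PhiP (actU (repr v)).
  case: b; case: b' => //=.
    have -> : (act g \o Phi) \o (act h \o Phi) = act g \o (Phi \o act h) \o Phi by [].
    rewrite -hS.
    have -> : act g \o (act h \o Phi) \o Phi = act g \o act h \o (Phi \o Phi) by [].
    by rewrite PhiK.
  have -> : (act g \o Phi) \o act h = act g \o (Phi \o act h) by [].
  by rewrite -hS.
split; [|split].
- exists Phi; split=> //; split.
  + move=> s; split=> [/classif[g gU sE]|[h [/(inH_act HP HFq cxy actP)[g gU ->]]]].
      by exists (act g); split=> //; apply: (act_inH HP HFq cxy actP).
    by case=> ->; [apply: actA | apply: act_PhiA].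
  + by move=> h /(inH_act HP HFq cxy actP)[g gU ->]; apply: (act_swap cxy actP PhiP).
  + move=> /(inH_act HP HFq cxy actP)[g gU E].
    by case: (act_neq_swap HP cxy actP PhiP gU).
- exists phi; split.
  + by move=> u b _; apply: phiA.
  + by move=> s /phi_surj[u [b ->]]; exists u, b; rewrite mem_PGL2.
  + by move=> u v b b' _ _; apply: phi_inj.
  + by move=> u v b b' _ _; apply: phi_mul.
have cardT : #|{: coset_of 'Z('GL_2[Fq]) * bool}| = (2 * (q ^ 3 - q))%N.
  by rewrite card_prod card_bool card_PGL2 HFq mulnC.
pose T := (coset_of 'Z('GL_2[Fq]) * bool)%type.
pose f (i : 'I_(2 * (q ^ 3 - q))) : L -> L :=
  let u : T := enum_val (cast_ord (esym cardT) i) in phi u.1 u.2.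
exists f; split=> [i j /phi_inj[E1 E2]|s].
  apply/(cast_ord_inj (eq_n := esym cardT))/enum_val_inj.
  by apply/eqP; rewrite -pair_eqE /pair_eq E1 E2 !eqxx.
split=> [/phi_surj[u [b ->]]|[i ->]]; last exact: phiA.
exists (cast_ord cardT (enum_rank ((u, b) : T))).
by rewrite /f cast_ordK enum_rankK.
Qed.
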